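(* Let $p\ge2$ be a fixed integer and $\theta_0\in\mathcal S^{p-1}$. Let $(\eta_n)$ be either the constant sequence $\eta_n\equiv1$ or a sequence in $\mathbb R^+$ that is $o(1)$. Let $(F_n)$ be a sequence of cumulative distribution functions on $[-1,1]$ and assume that the sequence of hypotheses ${\rm P}^{(n)}_{\theta_0,F_n}$ is in an $\eta_n$-neighbourhood of uniformity, with locality parameters $\xi$ and $\tilde e_2$ if $\eta_n\equiv1$ and with locality parameter $\xi$ otherwise, for some $\xi,\tilde e_2>0$. Let $$W_n:=\frac{n(p-1)\bar{\mathbf X}_n'(\mathbf I_p-\theta_0\theta_0')\bar{\mathbf X}_n}{1-\frac1n\sum_{i=1}^n(\mathbf X_{ni}'\theta_0)^2},\qquad S_n:=\frac{n(p-1)(\bar{\mathbf X}_n'\theta_0)^2\,\hat\theta_n'(\mathbf I_p-\theta_0\theta_0')\hat\theta_n}{1-\frac1n\sum_{i=1}^n(\mathbf X_{ni}'\theta_0)^2},$$ where $\bar{\mathbf X}_n:=\frac1n\sum_{i=1}^n\mathbf X_{ni}$ and $\hat\theta_n:=\bar{\mathbf X}_n/\|\bar{\mathbf X}_n\|$. Then, as $n\to\infty$ under ${\rm P}^{(n)}_{\theta_0,F_n}$: (i) if $\eta_n\equiv1$, or (ii) if $\eta_n=o(1)$ with $\sqrt n\,\eta_n\to\infty$, then $W_n\stackrel{\mathcal D}{\to}\chi^2_{p-1}$ and $S_n\stackrel{\mathcal D}{\to}\chi^2_{p-1}$, and one actually then has $S_n=W_n+o_{\rm P}(1)$; (iii)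 if $\sqrt n\,\eta_n\to1$, then $$W_n\stackrel{\mathcal D}{\to}\chi^2_{p-1}\quad\text{and}\quad S_n\stackrel{\mathcal D}{\to}\Big(1+\frac{Q}{(Z+\xi)^2}\Big)^{-1}Q,$$ where $Z\sim\mathcal N(0,1)$ and $Q\sim\chi^2_{p-1}$ are independent; (iv) if $\sqrt n\,\eta_n\to0$, then $$W_n\stackrel{\mathcal D}{\to}\chi^2_{p-1}\quad\text{and}\quad S_n\stackrel{\mathcal D}{\to}\Big(1+\frac{Q}{Z^2}\Big)^{-1}Q,$$ where $Z\sim\mathcal N(0,1)$ and $Q\sim\chi^2_{p-1}$ are independent.
   Context: $\mathcal S^{p-1}=\{\mathbf x\in\mathbb R^p:\|\mathbf x\|=1\}$; a prime denotes transpose; $\mathbf I_p$ is the $p\times p$ identity matrix; $\stackrel{\mathcal D}{\to}$ is weak convergence; $o_{\rm P}(1)$ denotes convergence to zero in probability; $\chi^2_\ell$ is the chi-square distribution with $\ell$ degrees of freedom. Rotational symmetry: a random vector $\mathbf X$ with values in $\mathcal S^{p-1}$ is rotationally symmetric about $\theta\in\mathcal S^{p-1}$ if $\mathbf O\mathbf X$ is equal in distribution to $\mathbf X$ for every orthogonal $p\times p$ matrix $\mathbf O$ with $\mathbf O\theta=\theta$. Such a distribution is characterized by $\theta$ and the cumulative distribution function $F$ of $\mathbf X'\theta$, and is denoted $\mathcal R(\theta,F)$. For sequences $(\theta_n)$ in $\mathcal S^{p-1}$ and $(F_n)$ of cumulative distribution functions on $[-1,1]$, ${\rm P}^{(n)}_{\theta_n,F_n}$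 denotes the hypothesis under which $\mathbf X_{n1},\ldots,\mathbf X_{nn}$ are i.i.d. with distribution $\mathcal R(\theta_n,F_n)$ (triangular array). Put $e_{n1}={\rm E}[\mathbf X_{n1}'\theta_n]$ and $\tilde e_{n2}={\rm Var}[\mathbf X_{n1}'\theta_n]$ under ${\rm P}^{(n)}_{\theta_n,F_n}$. For a sequence $\eta_n=o(1)$ in $\mathbb R^+$ and $\xi>0$, ${\rm P}^{(n)}_{\theta_n,F_n}$ is in an $\eta_n$-neighbourhood of uniformity with locality parameter $\xi$ if and only if $e_{n1}=\eta_n\xi/\sqrt p+o(\eta_n)$ and $\tilde e_{n2}=1/p+o(1)$ as $n\to\infty$. For $\eta_n\equiv1$ and $\xi,\tilde e_2>0$, ${\rm P}^{(n)}_{\theta_n,F_n}$ is in a $1$-neighbourhood of uniformity (stays away from uniformity) with locality parameters $\xi$ and $\tilde e_2$ if and only if $e_{n1}=\xi/\sqrt p+o(1)$ and $\tilde e_{n2}=\tilde e_2+o(1)$ as $n\to\infty$.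
   Formalization: In the case η_n ≡ 1 the condition ξ²/p + ẽ₂ < 1 is added; it excludes only the boundary ξ²/p + ẽ₂ = 1, where the claim can fail (e.g. X_ni = ±θ_0 almost surely, so W_n = 0/0). *)

(* Defs.v *)
From HB Require Import structures.
From mathcomp Require Import all_boot all_order all_algebra.
From mathcomp Require Import all_classical all_reals all_analysis.
From mathcomp Require Import measurable_realfun.

Set Implicit Arguments.
Unset Strict Implicit.
Unset Printing Implicit Defensive.

Import Order.TTheory GRing.Theory Num.Theory.
Import numFieldNormedType.Exports.

Local Open Scope classical_set_scope.
Local Open Scope ring_scope.

Section euclid.
Context {R : realType} {p : nat}.

Definition dot (u v : 'cV[R]_p) : R := (u^T *m v) 0 0.

(* Euclidean norm; the library norm on matrices is the sup norm. *)
Definition enorm (u : 'cV[R]_p) : R := Num.sqrt (dot u u).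

Definition sphere : set 'cV[R]_p := [set u | enorm u = 1].

Definition orthogonal_mx (O : 'M[R]_p) : Prop := O^T *m O = 1%:M.

End euclid.

(* R^p with its Borel sigma-algebra *)
Notation borel_cV R p := (g_sigma_algebraType (@open 'cV[R]_p)).

Section dot_measurable.
Context {R : realType} {p : nat} (theta : 'cV[R]_p).

Definition dotr (x : borel_cV R p) : R := dot x theta.

Let measurable_dotr : measurable_fun [set: borel_cV R p] dotr.
Proof.
have mcoord k : measurable_fun [set: borel_cV R p]
    (fun x : borel_cV R p => (x : 'cV[R]_p) k 0).
  apply: (measurability _ (RGenOpens.measurableE R)) => _ [_ [a [b ->] <-]].
  rewrite setTI; apply: sub_sigma_algebra.
  by apply: open_comp => [x _|]; [exact: coord_continuous|exact: interval_open].
rewrite (_ : dotr = fun x => \sum_(k < p) (x : 'cV[R]_p) k 0 * theta k 0).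
  by apply: measurable_sum => k; exact: measurable_funM.
by apply/funext => x; rewrite /dotr /dot mxE; apply: eq_bigr => k _; rewrite mxE.
Qed.

HB.instance Definition _ :=
  isMeasurableFun.Build _ _ _ _ dotr measurable_dotr.

End dot_measurable.

Section random_elements.
Context {d d'} {T : measurableType d} {T' : measurableType d'} {R : realType}.
Variable P : probability T R.

Definition same_distribution (X Y : T -> T') : Prop :=
  forall B, measurable B -> P (X @^-1` B) = P (Y @^-1` B).

Definition mutually_independent (n : nat) (X : 'I_n -> {RV P >-> T'}) : Prop :=
  forall (J : {set 'I_n}) (B : 'I_n -> set T'),
    (forall i, measurable (B i)) ->
    P (\bigcap_(i in [set i | i \in J]) (X i @^-1` B i)) =
    (\prod_(i in J) P (X i @^-1` B i))%E.

Definition independent2 (X Y : {RV P >-> T'}) : Prop :=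
  forall A B, measurable A -> measurable B ->
    P (X @^-1` A `&` Y @^-1` B) = (P (X @^-1` A) * P (Y @^-1` B))%E.

End random_elements.

(* The library has two sigma-algebra structures on R, with the same measurable
   sets: the codomain of real random variables is [R] itself, and named
   probability laws such as [normal_prob] live on [measurableTypeR R]. *)
Definition has_distribution {d} {T : measurableType d} {R : realType}
    (P : probability T R) (X : {RV P >-> R})
    (nu : probability (measurableTypeR R) R) : Prop :=
  forall B : set R, measurable B -> P (X @^-1` B) = nu B.

Section convergence.
Context {R : realType} {d : nat -> measure_display}.
Context {T : forall n, measurableType (d n)}.
Variable P : forall n, probability (T n) R.

Definition cvg_in_distribution (Y : forall n, T n -> R)
    (nu : probability (measurableTypeR R) R) : Prop :=
  forall f : R -> R, continuous f -> (exists M : R, forall x, `|f x| <= M) ->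
    'E_(P n)[f \o Y n]%E @[n --> \oo] --> (\int[nu]_x (f x)%:E)%E.

(* Y_n = o_P(1) *)
Definition cvg_in_probability0 (Y : forall n, T n -> R) : Prop :=
  forall e : R, 0 < e ->
    P n [set w | e <= `|Y n w|] @[n --> \oo] --> 0%E.

End convergence.

Section product_probability.
Context {R : realType} {d1 d2} {T1 : measurableType d1}
  {T2 : measurableType d2}.
Variables (P1 : probability T1 R) (P2 : probability T2 R).

Definition product_probability : set (T1 * T2) -> \bar R := (P1 \x P2)%E.

HB.instance Definition _ := Measure.on product_probability.

Let product_probability_setT : product_probability [set: T1 * T2] = 1%E.
Proof.
rewrite /product_probability -setXTT product_measure1E//.
by rewrite -[RHS]mule1; congr (_ * _)%E; exact: probability_setT.
Qed.

HB.instance Definition _ :=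
  Measure_isProbability.Build _ _ _ product_probability product_probability_setT.

End product_probability.

Section chi_square.
Context {R : realType}.

Local Notation mR := (measurableTypeR R).

Definition add_square (xz : mR * mR) : mR := (xz.1 : R) + (xz.2 : R) ^+ 2.

Let measurable_add_square : measurable_fun [set: mR * mR] add_square.
Proof.
apply: measurable_funD; first exact: measurable_fst.
by apply: measurable_funX; exact: measurable_snd.
Qed.

HB.instance Definition _ :=
  isMeasurableFun.Build _ _ _ _ add_square measurable_add_square.

(* law of the sum of the squares of k independent standard normal variables *)
Fixpoint chi2 (k : nat) : probability mR R :=
  if k is k'.+1
  then distribution (product_probability (chi2 k') (normal_prob 0 1)) add_square
  else dirac (0 : mR).

End chi_square.

(* The limits of S_n below quantify over all such pairs (Z, Q): they exist. *)
Lemma independent_normal_chi2_exists (R : realType) (k : nat) :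
  exists (d : measure_display) (T : measurableType d) (P : probability T R)
    (Z Q : {RV P >-> R}),
  [/\ has_distribution Z (normal_prob 0 1), has_distribution Q (chi2 k)
    & independent2 Z Q].
Proof.
pose mR := measurableTypeR R.
pose P := product_probability (normal_prob 0 1 : probability mR R) (chi2 k).
have mZ : measurable_fun [set: mR * mR] (fst : mR * mR -> R).
  exact: measurable_fst.
have mQ : measurable_fun [set: mR * mR] (snd : mR * mR -> R).
  exact: measurable_snd.
pose Z : {RV P >-> R} := HB.pack (fst : mR * mR -> R)
  (isMeasurableFun.Build _ _ _ _ (fst : mR * mR -> R) mZ).
pose Q : {RV P >-> R} := HB.pack (snd : mR * mR -> R)
  (isMeasurableFun.Build _ _ _ _ (snd : mR * mR -> R) mQ).
have PAB (A B : set R) : measurable A -> measurable B ->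
    P (Z @^-1` A `&` Q @^-1` B) = (normal_prob (0 : R) 1 A * chi2 k B)%E.
  move=> mA mB; rewrite /P /product_probability.
  by rewrite (_ : _ `&` _ = A `*` B)//; exact: product_measure1E.
have hZ : has_distribution Z (normal_prob 0 1).
  move=> A mA; have := PAB A setT mA measurableT.
  rewrite preimage_setT setIT => E; apply: (etrans E).
  rewrite -[RHS]mule1; congr (_ * _)%E; exact: probability_setT.
have hQ : has_distribution Q (chi2 k).
  move=> B mB; have := PAB setT B measurableT mB.
  rewrite preimage_setT setTI => E; apply: (etrans E).
  rewrite -[RHS]mul1e; congr (_ * _)%E; exact: probability_setT.
exists _, _, P, Z, Q; split => // A B mA mB.
by apply: (etrans (PAB A B mA mB)); rewrite -hZ// -hQ.
Qed.

Section S_limit.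
Context {d} {T : measurableType d} {R : realType} {P : probability T R}.
Variables (a : R) (Z Q : {RV P >-> R}).

Definition S_limit (w : T) : measurableTypeR R :=
  (1 + Q w / (Z w + a) ^+ 2)^-1 * Q w.

Let measurable_S_limit : measurable_fun [set: T] S_limit.
Proof.
have mV : measurable_fun [set: R] (fun x : R => x^-1).
  rewrite -(setUv [set 0]); apply/measurable_funU => //.
    exact: measurableC.
  split; first exact: measurable_fun_set1.
  apply: open_continuous_measurable_fun.
    by apply: closed_openC; exact: closed_eq.
  apply/in_setP => x /= /eqP x0; exact: inv_continuous.
apply: measurable_funM => //; apply: (measurableT_comp mV).
apply: measurable_funD => //; apply: measurable_funM => //.
apply: (measurableT_comp mV); apply: measurable_funX.
exact: measurable_funD.
Qed.

HB.instance Definition _ :=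
  isMeasurableFun.Build _ _ _ _ S_limit measurable_S_limit.

End S_limit.

Section rotational_symmetry.
Context {R : realType} {p : nat} {d} {T : measurableType d}.
Variable P : probability T R.
Implicit Types (theta : 'cV[R]_p) (F : R -> R).

Definition rotationally_symmetric theta (X : {RV P >-> borel_cV R p}) : Prop :=
  {ae P, forall w, sphere (X w)} /\
  forall O : 'M[R]_p, orthogonal_mx O -> O *m theta = theta ->
    same_distribution P (fun w => O *m X w : borel_cV R p) X.

(* X is distributed according to R(theta, F) *)
Definition rotsym_distributed theta F (X : {RV P >-> borel_cV R p}) : Prop :=
  rotationally_symmetric theta X /\
  forall r, cdf (dotr theta \o X : {RV P >-> R}) r = (F r)%:E.

(* X 0, ..., X n.-1 are i.i.d. with distribution R(theta, F) *)
Definition rotsym_sample (n : nat) theta F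
    (X : nat -> {RV P >-> borel_cV R p}) : Prop :=
  [/\ mutually_independent (fun i : 'I_n => X i),
      forall i j : 'I_n, same_distribution P (X i) (X j)
    & forall i : 'I_n, rotsym_distributed theta F (X i)].

End rotational_symmetry.

(* [cumulativeBounded 0 1] is the type of cumulative distribution functions. *)
Definition cdf_on_m11 {R : realType} (F : cumulativeBounded (0 : R) (1 : R)) :=
  (forall x, x < -1 -> F x = 0) /\ (forall x, 1 <= x -> F x = 1).

Section neighbourhoods.
Context {R : realType} {p : nat} {d : nat -> measure_display}.
Context {T : forall n, measurableType (d n)}.
Variable P : forall n, probability (T n) R.
Variable theta : 'cV[R]_p.
Variable X : forall n, nat -> {RV (P n) >-> borel_cV R p}.

(* mean and variance of the first observation of the n-th row projected on
   theta; row 0 is empty, the value at n = 0 plays no role *)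
Definition proj_mean (n : nat) : R := fine 'E_(P n)[dotr theta \o X n 0]%E.

Definition proj_var (n : nat) : R := fine 'V_(P n)[dotr theta \o X n 0]%E.

Definition eta_neighbourhood (eta : nat -> R) (xi : R) : Prop :=
  (fun n => proj_mean n - eta n * xi / Num.sqrt p%:R) =o_\oo eta /\
  proj_var n @[n --> \oo] --> (p%:R^-1 : R).

Definition one_neighbourhood (xi te2 : R) : Prop :=
  proj_mean n @[n --> \oo] --> xi / Num.sqrt p%:R /\
  proj_var n @[n --> \oo] --> te2.

End neighbourhoods.

Section sample.
Context {R : realType} {p : nat}.
Variables (n : nat) (x : nat -> 'cV[R]_p).

Definition sample_mean : 'cV[R]_p := n%:R^-1 *: \sum_(i < n) x i.

(* equal to 0 when the sample mean is 0 *)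
Definition spherical_mean : 'cV[R]_p := (enorm sample_mean)^-1 *: sample_mean.

End sample.

Section test_statistics.
Context {R : realType} {p : nat} {d : nat -> measure_display}.
Context {T : forall n, measurableType (d n)}.
Context {P : forall n, probability (T n) R}.
Variable theta0 : 'cV[R]_p.
Variable X : forall n, nat -> {RV (P n) >-> borel_cV R p}.

Definition Wstat (n : nat) (w : T n) : R :=
  let x i : 'cV[R]_p := X n i w in
  let xbar := sample_mean n x in
  n%:R * p.-1%:R * (xbar^T *m (1%:M - theta0 *m theta0^T) *m xbar) 0 0 /
    (1 - n%:R^-1 * \sum_(i < n) dot (x i) theta0 ^+ 2).

Definition Sstat (n : nat) (w : T n) : R :=
  let x i : 'cV[R]_p := X n i w in
  let xbar := sample_mean n x in
  let thetahat := spherical_mean n x in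
  n%:R * p.-1%:R * dot xbar theta0 ^+ 2 *
    (thetahat^T *m (1%:M - theta0 *m theta0^T) *m thetahat) 0 0 /
    (1 - n%:R^-1 * \sum_(i < n) dot (x i) theta0 ^+ 2).

End test_statistics.

(* Main.v *)
(** Rotate so that theta0 becomes the first basis vector. Rotational symmetry makes the
    other ("tangential") coordinates of an observation centred, uncorrelated with each
    other and with the first one, and of common variance (1 - e_n2) / (p - 1). The rows of
    the array are bounded and i.i.d., so the characteristic function of the standardized
    row sum Y converges to that of a standard normal vector. This is upgraded to weak
    convergence by approximating a bounded continuous function on a large cube by a
    trigonometric polynomial with the same global bound (Stone-Weierstrass), second
    moments giving tightness.

    With Q the sum of the squares of the tangential coordinates of Y and U a multiple of
    sqrt n times the mean of the X_ni' theta0, one has W_n = r Q and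
    S_n = r Q U^2 / (U^2 + k Q), where r tends to 1 by the law of large numbers. If
    sqrt n e_n1 tends to infinity, dividing U by it gives U -> 1 and k -> 0, so S_n - W_n
    vanishes; otherwise the scaling of U with k = 1 gives U -> Z + xi or U -> Z. The
    ratio Q U^2 / (U^2 + k Q) is continuous on Q >= 0 for k > 0, even at the origin. *)

From HB Require Import structures.
Require Import Defs.
From mathcomp Require Import all_boot all_order all_fingroup all_algebra.
From mathcomp Require Import all_classical all_reals all_analysis.
From mathcomp Require Import measurable_realfun.
From mathcomp Require Import ring lra.

Set Implicit Arguments.
Unset Strict Implicit.
Unset Printing Implicit Defensive.

Import Order.TTheory GRing.Theory Num.Theory.
Import numFieldNormedType.Exports.
Local Open Scope classical_set_scope.
Local Open Scope ring_scope.

(** * Bounded measurable functions *)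

(** The hypothesis [xi ^+ 2 / p%:R + te2 < 1] of the fixed case makes the limit of 1 - e_n2
    positive. Observations on the sphere only give a limit at least 0, and at 0 the tangential
    variance degenerates, so that the standardization breaks down. When eta_n tends to 0 the limit
    is 1 - 1/p, positive since p >= 2.

    Characteristic functions appear in real form, as expectations of cosines with an arbitrary
    phase. The phase covers the sines and makes the span of these functions an algebra. The global
    bound on the approximants is what lets tightness control the error off the cube, where the
    approximation says nothing.

    The claims on W_n, S_n and S_n - W_n are instances of one limit theorem for lam W_n + mu S_n,
    with (lam, mu) = (1, 0), (0, 1) and (-1, 1). In it the fluctuation of the denominator is a
    random perturbation known only to be small in mean square, while the moments and the scale of U
    are convergent deterministic parameters. *)

Section expectation_of_bounded_functions.
Context {d} {T : measurableType d} {R : realType}.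

Definition bdd_meas (f : T -> R) :=
  measurable_fun [set: T] f /\ exists M, forall x, `|f x| <= M.

Lemma bdd_meas_cst (c : R) : bdd_meas (fun=> c).
Proof. by split; [exact: measurable_cst|exists `|c|]. Qed.

Lemma bdd_measD f g : bdd_meas f -> bdd_meas g -> bdd_meas (fun x => f x + g x).
Proof.
move=> [mf [M fM]] [mg [N gN]]; split; first exact: measurable_funD.
by exists (M + N) => x; rewrite (le_trans (ler_normD _ _))// lerD.
Qed.

Lemma bdd_measM f g : bdd_meas f -> bdd_meas g -> bdd_meas (fun x => f x * g x).
Proof.
move=> [mf [M fM]] [mg [N gN]]; split; first exact: measurable_funM.
by exists (M * N) => x; rewrite normrM ler_pM.
Qed.

Lemma bdd_measZ c f : bdd_meas f -> bdd_meas (fun x => c * f x).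
Proof. by move=> bf; apply: bdd_measM => //; exact: bdd_meas_cst. Qed.

Lemma bdd_measB f g : bdd_meas f -> bdd_meas g -> bdd_meas (fun x => f x - g x).
Proof.
move=> bf bg; have := bdd_measD bf (bdd_measZ (-1) bg).
by under eq_fun do rewrite mulN1r.
Qed.

Lemma bdd_measX n f : bdd_meas f -> bdd_meas (fun x => f x ^+ n).
Proof.
move=> bf; elim: n => [|n IH]; first exact: bdd_meas_cst.
by under eq_fun do rewrite exprS; exact: bdd_measM.
Qed.

Lemma bdd_meas_sum (I : Type) (s : seq I) (Q : pred I) (f : I -> T -> R) :
  (forall i, bdd_meas (f i)) -> bdd_meas (fun x => \sum_(i <- s | Q i) f i x).
Proof.
move=> bf; elim: s => [|i s IH].
  by under eq_fun do rewrite big_nil; exact: bdd_meas_cst.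
under eq_fun do rewrite big_cons.
by case: (Q i) => //; exact: bdd_measD.
Qed.

Lemma bdd_meas_prod (I : Type) (s : seq I) (Q : pred I) (f : I -> T -> R) :
  (forall i, bdd_meas (f i)) -> bdd_meas (fun x => \prod_(i <- s | Q i) f i x).
Proof.
move=> bf; elim: s => [|i s IH].
  by under eq_fun do rewrite big_nil; exact: bdd_meas_cst.
under eq_fun do rewrite big_cons.
by case: (Q i) => //; exact: bdd_measM.
Qed.

Lemma bdd_meas_cos f : measurable_fun [set: T] f -> bdd_meas (fun x => cos (f x)).
Proof.
move=> mf; split; last by exists 1 => x; rewrite ler_norml cos_geN1 cos_le1.
exact: (measurableT_comp (continuous_measurable_fun (@continuous_cos R))).
Qed.

Lemma bdd_meas_sin f : measurable_fun [set: T] f -> bdd_meas (fun x => sin (f x)).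
Proof.
move=> mf; split; last by exists 1 => x; rewrite ler_norml sin_geN1 sin_le1.
exact: (measurableT_comp (continuous_measurable_fun (@continuous_sin R))).
Qed.

Lemma bdd_meas_indic A : measurable A -> bdd_meas (\1_A : T -> R).
Proof.
move=> mA; split; first exact: measurable_indic.
by exists 1 => x; rewrite indicE; case: (_ \in _); rewrite ?normr1 ?normr0.
Qed.

(** Real-valued expectation: on [bdd_meas] functions it is finite, so linearity and monotonicity
    need no side conditions on integrability and the estimates stay in R. *)
Definition Ex (P : probability T R) (f : T -> R) : R := Rintegral P setT f.

Variable P : probability T R.

Lemma bdd_meas_integrable f : bdd_meas f -> P.-integrable setT (EFin \o f).
Proof.
move=> [mf [M fM]]; apply: measurable_bounded_integrable => //.
  exact: (le_lt_trans (probability_le1 _ measurableT) (ltry _)).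
exists M; split; first exact: num_real.
by move=> N MN x _ /=; rewrite (le_trans (fM x))// ltW.
Qed.

Lemma Ex_integral f : bdd_meas f -> (\int[P]_x (f x)%:E)%E = (Ex P f)%:E.
Proof.
by move=> /bdd_meas_integrable fi; rewrite /Ex /Rintegral fineK// integrable_fin_num.
Qed.

Lemma Ex_cst c : Ex P (fun=> c) = c.
Proof.
rewrite /Ex Rintegral_cst// -[RHS]mulr1; congr (_ * _).
by rewrite -[RHS]/(fine (1%E : \bar R)); congr fine; exact: probability_setT.
Qed.

Lemma ExD f g : bdd_meas f -> bdd_meas g ->
  Ex P (fun x => f x + g x) = Ex P f + Ex P g.
Proof. by move=> bf bg; rewrite /Ex RintegralD//; exact: bdd_meas_integrable. Qed.

Lemma ExB f g : bdd_meas f -> bdd_meas g ->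
  Ex P (fun x => f x - g x) = Ex P f - Ex P g.
Proof. by move=> bf bg; rewrite /Ex RintegralB//; exact: bdd_meas_integrable. Qed.

Lemma ExZ c f : bdd_meas f -> Ex P (fun x => c * f x) = c * Ex P f.
Proof. by move=> bf; rewrite /Ex RintegralZl//; exact: bdd_meas_integrable. Qed.

Lemma Ex_sum (I : Type) (s : seq I) (Q : pred I) (f : I -> T -> R) :
  (forall i, bdd_meas (f i)) ->
  Ex P (fun x => \sum_(i <- s | Q i) f i x) = \sum_(i <- s | Q i) Ex P (f i).
Proof.
move=> bf; elim: s => [|i s IH].
  by rewrite big_nil; under eq_fun do rewrite big_nil; rewrite Ex_cst.
rewrite big_cons; under eq_fun do rewrite big_cons.
by case: (Q i) => //; rewrite ExD ?IH//; exact: bdd_meas_sum.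
Qed.

Lemma Ex_le f g : bdd_meas f -> bdd_meas g -> (forall x, f x <= g x) ->
  Ex P f <= Ex P g.
Proof. by move=> bf bg fg; apply: le_Rintegral => //; exact: bdd_meas_integrable. Qed.

Lemma Ex_ge0 f : (forall x, 0 <= f x) -> 0 <= Ex P f.
Proof. by move=> f0; exact: Rintegral_ge0. Qed.

Lemma Ex_norm f g : bdd_meas f -> bdd_meas g -> (forall x, `|f x| <= g x) ->
  `|Ex P f| <= Ex P g.
Proof.
move=> bf bg fg; rewrite ler_norml; apply/andP; split.
  have -> : - Ex P g = Ex P (fun x => -1 * g x) by rewrite ExZ// mulN1r.
  apply: Ex_le => //; first exact: bdd_measZ.
  by move=> x; rewrite mulN1r; have := fg x; rewrite ler_norml => /andP[].
by apply: Ex_le => // x; have := fg x; rewrite ler_norml => /andP[].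
Qed.

Lemma Ex_norm_cst f M : bdd_meas f -> (forall x, `|f x| <= M) -> `|Ex P f| <= M.
Proof.
move=> bf fM; rewrite -[leRHS]Ex_cst; apply: Ex_norm => //; exact: bdd_meas_cst.
Qed.

Lemma Ex_dist f g h : bdd_meas f -> bdd_meas g -> bdd_meas h ->
  (forall x, `|f x - g x| <= h x) -> `|Ex P f - Ex P g| <= Ex P h.
Proof. by move=> bf bg bh fgh; rewrite -ExB//; apply: Ex_norm => //; exact: bdd_measB. Qed.

Lemma Ex_indic A : measurable A -> Ex P \1_A = fine (P A).
Proof. by move=> mA; rewrite /Ex /Rintegral integral_indic// setIT. Qed.

Lemma Ex_ae f g : measurable_fun setT f -> measurable_fun setT g ->
  {ae P, forall x, f x = g x} -> Ex P f = Ex P g.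
Proof.
move=> mf mg fg; congr fine; apply: ae_eq_integral => //.
- exact/measurable_EFinP.
- exact/measurable_EFinP.
- by apply: filterS fg => x -> _.
Qed.

End expectation_of_bounded_functions.

Lemma bdd_meas_comp {d d'} {T : measurableType d} {T' : measurableType d'}
    {R : realType} (f : T' -> R) (X : T -> T') :
  measurable_fun setT X -> bdd_meas f -> bdd_meas (fun x => f (X x)).
Proof.
by move=> mX [mf [M fM]]; split; [exact: measurableT_comp|exists M].
Qed.

(** Both sides are integrals of f against the image law. The two probability spaces may differ,
    which is needed to replace one realization of a limit by another. *)
Lemma eq_law_Ex {d1 d2 d'} {T1 : measurableType d1} {T2 : measurableType d2}
    {T' : measurableType d'} {R : realType}
    (P1 : probability T1 R) (P2 : probability T2 R) (X1 : T1 -> T') (X2 : T2 -> T')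
    (f : T' -> R) :
  measurable_fun setT X1 -> measurable_fun setT X2 ->
  (forall B, measurable B -> P1 (X1 @^-1` B) = P2 (X2 @^-1` B)) ->
  bdd_meas f -> Ex P1 (fun x => f (X1 x)) = Ex P2 (fun x => f (X2 x)).
Proof.
move=> m1 m2 E bf.
have bf1 := bdd_meas_comp m1 bf; have bf2 := bdd_meas_comp m2 bf.
pose f1 : {mfun T1 >-> T'} := HB.pack X1 (isMeasurableFun.Build _ _ _ _ X1 m1).
pose f2 : {mfun T2 >-> T'} := HB.pack X2 (isMeasurableFun.Build _ _ _ _ X2 m2).
have mf : measurable_fun setT (EFin \o f) by apply/measurable_EFinP; exact: bf.1.
rewrite /Ex /Rintegral; congr fine.
transitivity (\int[distribution P1 f1]_y (f y)%:E)%E.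
  by rewrite integral_distribution//; exact: (bdd_meas_integrable P1 bf1).
rewrite (eq_measure_integral (distribution P2 f2)).
  by rewrite integral_distribution//; exact: (bdd_meas_integrable P2 bf2).
by move=> B mB _; exact: E.
Qed.
Lemma cvg_invn {R : realType} : (n%:R^-1 : R) @[n --> \oo] --> (0 : R).
Proof.
rewrite gtr0_cvgV0; first exact: cvgr_idn.
by near=> n; rewrite ltr0n; near: n; exists 1%N.
Unshelve. all: by end_near. Qed.

(** * Characteristic function of the normal law *)

Section pointwise_derivatives.
Context {R : realType}.
Implicit Types (f g : R -> R) (x c df dg : R).

Lemma der_cst c x : is_derive x 1 (fun=> c : R) (0 : R).
Proof. exact: is_derive_cst. Qed.

Lemma der_id x : is_derive x 1 (fun y : R => y) (1 : R).
Proof. exact: is_derive_id. Qed.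

Lemma derD f g x df dg : is_derive x 1 f df -> is_derive x 1 g dg ->
  is_derive x 1 (fun y => f y + g y) (df + dg).
Proof. by move=> Df Dg; exact: is_deriveD. Qed.

Lemma derN f x df : is_derive x 1 f df -> is_derive x 1 (fun y => - f y) (- df).
Proof. by move=> Df; exact: is_deriveN. Qed.

Lemma derM f g x df dg : is_derive x 1 f df -> is_derive x 1 g dg ->
  is_derive x 1 (fun y => f y * g y) (f x * dg + g x * df).
Proof. by move=> Df Dg; exact: is_deriveM. Qed.

Lemma derX n f x df : is_derive x 1 f df ->
  is_derive x 1 (fun y => f y ^+ n) (n%:R * f x ^+ n.-1 * df).
Proof.
move=> Df; have -> : (fun y => f y ^+ n) = f ^+ n by apply/funext => y; rewrite exprfctE.
exact: is_deriveX.
Qed.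

Lemma der_sin f x df : is_derive x 1 f df ->
  is_derive x 1 (fun y => sin (f y)) (cos (f x) * df).
Proof. by move=> Df; apply: (@is_derive1_comp _ sin f). Qed.

Lemma der_cos f x df : is_derive x 1 f df ->
  is_derive x 1 (fun y => cos (f y)) (- sin (f x) * df).
Proof. by move=> Df; apply: (@is_derive1_comp _ cos f). Qed.

Lemma der_expR f x df : is_derive x 1 f df ->
  is_derive x 1 (fun y => expR (f y)) (expR (f x) * df).
Proof. by move=> Df; apply: (@is_derive1_comp _ expR f). Qed.

End pointwise_derivatives.

Ltac deriv_step := first [ exact: der_cst | exact: der_id
  | notypeclasses refine (derD _ _) | notypeclasses refine (derN _)
  | notypeclasses refine (derX _ _) | notypeclasses refine (der_sin _)
  | notypeclasses refine (der_cos _) | notypeclasses refine (der_expR _)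
  | notypeclasses refine (derM _ _) ].

(** The derivative is left open while the rules build it from the shape of the function; what
    remains is one algebraic identity. *)
Ltac deriv := notypeclasses refine (is_derive_eq _ _); [repeat deriv_step | ].

Section taylor_bounds.
Context {R : realType}.
Implicit Types (f df : R -> R) (x : R).

(** Mean value theorem. The sine and cosine bounds below form a chain in which the derivative of
    each remainder is the preceding one, starting from cos <= 1. *)
Lemma ge0_of_derive_ge0 f df : (forall x, is_derive x 1 f (df x)) -> f 0 = 0 ->
  (forall x, 0 <= x -> 0 <= df x) -> forall x, 0 <= x -> 0 <= f x.
Proof.
move=> Df f0 df0 x; rewrite le_eqVlt => /predU1P[<-|x0]; first by rewrite f0.
have cf : {within `[0, x], continuous f}.
  by apply: derivable_within_continuous => y _; have [] := Df y.
have [c /[!in_itv]/= /andP[c0 _] E] := MVT x0 (fun y _ => Df y) cf.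
by rewrite f0 !subr0 in E; rewrite E mulr_ge0// ?df0// ltW.
Qed.

Lemma sin_le_id x : 0 <= x -> sin x <= x.
Proof.
move=> x0; rewrite -subr_ge0; move: x x0.
have D (y : R) : is_derive y 1 (fun y => y - sin y) (1 - cos y) by deriv; ring.
apply: (ge0_of_derive_ge0 D) => [|y _]; first by rewrite sin0 subrr.
by rewrite subr_ge0 cos_le1.
Qed.

Lemma cos_ge_taylor2 x : 0 <= x -> 0 <= cos x - 1 + x ^+ 2 / 2.
Proof.
move: x; have D (y : R) : is_derive y 1 (fun y => cos y - 1 + y ^+ 2 / 2) (y - sin y).
  by deriv; rewrite /=; field.
apply: (ge0_of_derive_ge0 D) => [|y y0]; last by rewrite subr_ge0 sin_le_id.
by rewrite cos0 expr0n/= mul0r addr0 subrr.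
Qed.

Lemma sin_ge_taylor3 x : 0 <= x -> 0 <= sin x - x + x ^+ 3 / 6.
Proof.
move: x; have D (y : R) : is_derive y 1 (fun y => sin y - y + y ^+ 3 / 6)
    (cos y - 1 + y ^+ 2 / 2) by deriv; rewrite /=; field.
apply: (ge0_of_derive_ge0 D); last exact: cos_ge_taylor2.
by rewrite sin0 expr0n/= mul0r addr0 subrr.
Qed.

Lemma cos_le_taylor4 x : 0 <= x -> 0 <= x ^+ 4 / 24 - (cos x - 1 + x ^+ 2 / 2).
Proof.
move: x; have D (y : R) : is_derive y 1
    (fun y => y ^+ 4 / 24 - (cos y - 1 + y ^+ 2 / 2)) (sin y - y + y ^+ 3 / 6).
  by deriv; rewrite /=; field.
apply: (ge0_of_derive_ge0 D); last exact: sin_ge_taylor3.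
by rewrite cos0 !expr0n/= !mul0r addr0 subrr subrr.
Qed.

Lemma cos_taylor x : `|cos x - 1 + x ^+ 2 / 2| <= x ^+ 4 / 24.
Proof.
wlog x0 : x / 0 <= x.
  move=> H; have [/H//|/ltW x0] := leP 0 x.
  have E4 : (- x) ^+ 4 = x ^+ 4 by ring.
  by have := H (- x); rewrite oppr_ge0 cosN sqrrN E4; exact.
by rewrite ger0_norm ?cos_ge_taylor2// -subr_ge0 cos_le_taylor4.
Qed.

Lemma sin_taylor x : `|sin x - x| <= `|x| ^+ 3 / 6.
Proof.
wlog x0 : x / 0 <= x.
  move=> H; have [/H//|/ltW x0] := leP 0 x.
  by have := H (- x); rewrite oppr_ge0 sinN normrN -opprD normrN; exact.
rewrite (ger0_norm x0) ler_norml; have := sin_ge_taylor3 x0; have := sin_le_id x0.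
by have := exprn_ge0 3 x0; move=> *; apply/andP; split; lra.
Qed.

Lemma expRN_taylor x : 0 <= x -> `|expR (- x) - (1 - x)| <= x ^+ 2.
Proof.
move=> x0; have h1 : 1 - x <= expR (- x) by exact: expR_ge1Dx.
have h2 : expR (- x) <= (1 + x)^-1.
  by rewrite expRN lef_pV2 ?posrE ?expR_gt0 ?expR_ge1Dx//; lra.
(* Because (1 + x)(1 - x + x^2) = 1 + x^3. *)
have h3 : (1 + x)^-1 <= 1 - x + x ^+ 2.
  rewrite -[leLHS]div1r ler_pdivrMr; last lra.
  by have := exprn_ge0 3 x0; nra.
by rewrite ger0_norm; lra.
Qed.

End taylor_bounds.

Section gaussian.
Context {R : realType}.
Local Notation mR := (measurableTypeR R).
Local Notation mu := (@lebesgue_measure R).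
Local Notation N01 := (normal_prob 0 1 : probability mR R).
Let phi : R -> R := normal_pdf 0 1.

Let phi_meas : measurable_fun [set: mR] phi.
Proof. exact: measurable_normal_pdf. Qed.

(** The Radon-Nikodym derivative of the normal law and its density have the same integral over every
    measurable set, hence agree almost everywhere. *)
Lemma Ex_normal_density (f : mR -> R) : bdd_meas f ->
  Ex N01 f = \int[mu]_x (f x * phi x).
Proof.
move=> bf.
have mf : measurable_fun [set: mR] (EFin \o f) by apply/measurable_EFinP; exact: bf.1.
have fi := bdd_meas_integrable N01 bf.
rewrite /Ex /Rintegral; congr fine.
rewrite -(Radon_Nikodym_change_of_variables (normal_prob_dominates 0 1))//=.
under [RHS]eq_integral do rewrite EFinM.
apply: ae_eq_integral => //.
- apply: emeasurable_funM => //; apply: (measurable_int mu).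
  by apply: Radon_Nikodym_integrable; exact: normal_prob_dominates.
- by apply: emeasurable_funM => //=; apply/measurable_EFinP.
- apply: ae_eqe_mul2l => /=.
  rewrite Radon_NikodymE//=; first exact: normal_prob_dominates.
  move=> abmu.
  case: cid => /= h [h1 h2 h3].
  apply: integral_ae_eq => //=.
  + by apply/measurable_EFinP.
  + by move=> E E01 mE; rewrite -h3.
Qed.

Let pk : R := normal_peak 1.

Let phiE x : phi x = pk * expR (- (x ^+ 2 / 2)).
Proof.
rewrite /phi normal_pdfE ?oner_eq0// /normal_fun; congr (_ * expR _).
by rewrite subr0 expr1n mulNr.
Qed.

Let phi_ge0 x : 0 <= phi x. Proof. exact: normal_pdf_ge0. Qed.

Let pk_ge0 : 0 <= pk. Proof. exact: normal_peak_ge0. Qed.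

Let phi_derive (x : R) : is_derive x 1 phi (- x * phi x).
Proof.
have -> : phi = fun y => pk * expR (- (y ^+ 2 / 2)) by apply/funext => y; exact: phiE.
by deriv; rewrite /=; field.
Qed.

Let phi_int : mu.-integrable setT (EFin \o phi).
Proof. exact: integrable_normal_pdf. Qed.

Let intZ c (f : mR -> R) : mu.-integrable setT (EFin \o f) ->
  mu.-integrable setT (EFin \o (fun x => c * f x)).
Proof. exact: (@integrableZl _ _ _ mu _ measurableT c (EFin \o f)). Qed.

Let dom_int (f g : mR -> R) : measurable_fun setT f ->
  mu.-integrable setT (EFin \o g) -> (forall x, `|f x| <= g x) ->
  mu.-integrable setT (EFin \o f).
Proof.
move=> mf gi fg; apply: (le_integrable measurableT _ _ gi) => //.
  exact/measurable_EFinP.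
by move=> x _ /=; rewrite lee_fin (le_trans (fg x))// ler_norm.
Qed.

Let G (x : mR) : R := `|x : R| * phi x.

Let G_meas : measurable_fun [set: mR] G.
Proof. by apply: measurable_funM => //; exact: measurableT_comp. Qed.

(** Since |x| <= 1 + x^2/4 <= exp(x^2/4), the function |x| phi(x) is at most a multiple of
    exp(-x^2/4), the shape of the normal density of variance 2. It is the majorant for
    differentiating under the integral sign. *)
Let G_int : mu.-integrable setT (EFin \o G).
Proof.
pose s2 : R := Num.sqrt 2.
have s20 : s2 != 0 by rewrite gt_eqF// sqrtr_gt0.
have pk2 := normal_peak_gt0 s20.
pose c := pk / normal_peak s2.
have i2 : mu.-integrable setT (EFin \o (fun x => c * normal_pdf 0 s2 x)).
  by apply: intZ; exact: integrable_normal_pdf.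
apply: (dom_int G_meas i2) => x; rewrite /G ger0_norm ?mulr_ge0//.
rewrite normal_pdfE// /c mulrA divfK ?gt_eqF// phiE mulrCA ler_wpM2l//.
rewrite /normal_fun subr0 sqr_sqrtr//.
have -> : - x ^+ 2 / (2 *+ 2) = x ^+ 2 / 4 + - (x ^+ 2 / 2) by field.
rewrite expRD ler_pM2r ?expR_gt0//.
apply: le_trans (expR_ge1Dx _); rewrite -[in leRHS](real_normK (num_real x)).
by have := sqr_ge0 (`|x| / 2 - 1); nra.
Qed.

Let bdd_phi_int (f : mR -> R) : bdd_meas f -> mu.-integrable setT (EFin \o (fun x => f x * phi x)).
Proof.
move=> [mf [M fM]].
have i2 : mu.-integrable setT (EFin \o (fun x => M * phi x)).
  exact: intZ.
apply: (dom_int _ i2); first exact: measurable_funM.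
by move=> x; rewrite normrM (ger0_norm (phi_ge0 x)) ler_wpM2r.
Qed.

Let affine_meas (t a : R) : measurable_fun [set: mR] (fun x : mR => t * x + a).
Proof. by apply: measurable_funD => //; exact: measurable_funM. Qed.

Let H t a (x : R) : R := sin (t * x + a) * phi x.
Let dH t a (x : R) : R := t * (cos (t * x + a) * phi x) - x * sin (t * x + a) * phi x.

Let H_derive t a (x : R) : is_derive x 1 (H t a) (dH t a x).
Proof.
rewrite /H /dH; notypeclasses refine (is_derive_eq _ _).
  by notypeclasses refine (derM _ (phi_derive x)); repeat deriv_step.
by rewrite /=; ring.
Qed.

Let continuous_of_derive (f df : R -> R) : (forall x : R, is_derive x 1 f (df x)) -> continuous f.
Proof.
by move=> D x; apply: differentiable_continuous; apply/derivable1_diffP; have [] := D x.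
Qed.

Let dH_continuous t a : continuous (dH t a).
Proof.
have cphi : continuous phi by exact: (continuous_of_derive phi_derive).
have ca : continuous (fun x : R => t * x + a).
  by move=> x; apply: cvgD; [apply: cvgM; [exact: cvg_cst|exact: cvg_id]|exact: cvg_cst].
move=> x; apply: cvgB; apply: cvgM => //.
- exact: cvg_cst.
- apply: cvgM; last exact: cphi.
  by apply: continuous_comp; [exact: ca|exact: continuous_cos].
- apply: cvgM; first exact: cvg_id.
  by apply: continuous_comp; [exact: ca|exact: continuous_sin].
- exact: cphi.
Qed.

Let xsin_int t a : mu.-integrable setT (EFin \o (fun x : mR => (x : R) * sin (t * x + a) * phi x)).
Proof.
apply: (dom_int _ G_int) => [|x].
  apply: measurable_funM => //; apply: measurable_funM => //.
  exact: (bdd_meas_sin (affine_meas t a)).1.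
rewrite /G !normrM (ger0_norm (phi_ge0 x)) ler_wpM2r//.
by rewrite ler_piMr// ler_norml sin_geN1 sin_le1.
Qed.

Let dH_int t a : mu.-integrable setT (EFin \o dH t a).
Proof.
apply: (@integrableB _ _ _ mu _ measurableT
  (EFin \o (fun x : mR => t * (cos (t * x + a) * phi x)))) (xsin_int t a).
by apply: intZ; apply: bdd_phi_int; exact: bdd_meas_cos.
Qed.

Let H_small t a n : (0 < n)%N -> `|H t a n%:R| + `|H t a (- n%:R)| <= 4 * pk * n%:R^-1.
Proof.
move=> n0.
suff b x : `|x| = n%:R -> `|H t a x| <= 2 * pk * n%:R^-1.
  have b1 := b n%:R; have b2 := b (- n%:R); rewrite normrN in b2.
  have := b1 (ger0_norm (ler0n _ _)); have := b2 (ger0_norm (ler0n _ _)); lra.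
move=> xn; rewrite /H normrM (ger0_norm (phi_ge0 x)) phiE.
have s1 : `|sin (t * x + a)| <= 1 by rewrite ler_norml sin_geN1 sin_le1.
have nR : 1 <= n%:R :> R by rewrite ler1n.
(* A crude rate is enough: exp(x^2/2) >= 1 + n^2/2 >= n/2 when |x| = n. *)
have e1 : expR (- (x ^+ 2 / 2)) <= 2 * n%:R^-1.
  rewrite expRN -[leRHS]invrK lef_pV2 ?posrE ?expR_gt0 ?invr_gt0 ?mulr_gt0 ?invr_gt0 ?ltr0n//.
  rewrite invfM invrK; apply: le_trans (expR_ge1Dx _).
  by rewrite -(real_normK (num_real x)) xn; nra.
have p := expR_ge0 (- (x ^+ 2 / 2)).
rewrite (@le_trans _ _ (1 * (pk * expR (- (x ^+ 2 / 2)))))//.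
  by rewrite ler_wpM2r// mulr_ge0.
by rewrite mul1r -mulrA mulrCA ler_wpM2l.
Qed.

Let J (n : nat) : set mR := [set` `[(- n%:R : R), n%:R]].

Let dH_FTC t a n : (0 < n)%N ->
  (\int[mu]_(x in J n) (dH t a x)%:E = (H t a n%:R)%:E - (H t a (- n%:R))%:E)%E.
Proof.
move=> n0; apply: continuous_FTC2.
- by rewrite -subr_gt0 opprK addr_gt0// ltr0n.
- exact: continuous_subspaceT.
- have cH := continuous_of_derive (H_derive t a).
  split.
  + by move=> x _; have [] := H_derive t a x.
  + by apply: cvg_at_right_filter; exact: cH.
  + by apply: cvg_at_left_filter; exact: cH.
- by move=> x _; rewrite derive1E; have [] := H_derive t a x.
Qed.

(* [sin (t x + a) phi x] vanishes at infinity, so its derivative has integral 0. *)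
Let int_dH0 t a : \int[mu]_x dH t a x = 0.
Proof.
have md : measurable_fun [set: mR] (dH t a) by exact: continuous_measurable_fun.
have mn n : measurable_fun [set: mR] (fun x : mR => ((dH t a \_ (J n)) x)%:E).
  apply/measurable_EFinP/measurable_restrict => //; first exact: measurable_itv.
  exact: measurable_funTS.
have ml : measurable_fun [set: mR] (EFin \o dH t a) by exact/measurable_EFinP.
have cv : {ae mu, forall x, [set: mR] x ->
    ((dH t a \_ (J n)) x)%:E @[n --> \oo] --> (EFin \o dH t a) x}.
  apply: aeW => x _; apply: cvg_near_cst; near=> n; apply/eqP.
  rewrite /= patchE mem_set// /J/= in_itv/= -ler_norml.
  by near: n; exact: nbhs_infty_ger.
pose g (x : mR) : R := `|dH t a x|.
have i1 : mu.-integrable [set: mR] (EFin \o g).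
  exact: integrable_norm.
have bd : {ae mu, forall x n, [set: mR] x ->
    (`|((dH t a \_ (J n)) x)%:E| <= (EFin \o g) x)%E}.
  apply: aeW => x n _; rewrite /= lee_fin /g patchE; case: ifP => // _.
  by rewrite normr0.
have [_ _] := dominated_convergence measurableT mn ml cv i1 bd.
have -> : [sequence (\int[mu]_x ((dH t a \_ (J n)) x)%:E)%E]_n =
    fun n => (\int[mu]_(x in J n) (dH t a x)%:E)%E.
  apply/funext => n /=; rewrite [RHS]integral_mkcond; apply: eq_integral => x _.
  by rewrite restrict_EFin.
move=> D.
have Z : (\int[mu]_(x in J n) (dH t a x)%:E)%E @[n --> \oo] --> (0 : \bar R).
  have zz : H t a n%:R - H t a (- n%:R) @[n --> \oo] --> (0 : R).
    apply/norm_cvg0P.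
    apply: (@squeeze_cvgr _ _ _ _ (cst 0) (fun n => 4 * pk * n%:R^-1)).
    - near=> n; rewrite normr_ge0/= (le_trans (ler_normB _ _))// H_small//.
      by near: n; exists 1%N.
    - exact: cvg_cst.
    - rewrite -[X in _ --> X](mulr0 (4 * pk)); apply: cvgM; [exact: cvg_cst|exact: cvg_invn].
  have : (H t a n%:R - H t a (- n%:R))%:E @[n --> \oo] --> (0%:E : \bar R).
    by apply: cvg_EFin => //; exact: nearW.
  apply: cvg_trans; apply: near_eq_cvg; near=> n.
  by rewrite dH_FTC//; near: n; exists 1%N.
by rewrite /Rintegral (cvg_unique _ D Z).
Unshelve. all: by end_near. Qed.

Let F a t := \int[mu]_x (cos (t * x + a) * phi x).

(** Differentiating under the integral sign gives minus the integral of x sin(t x + a) phi(x); by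
    [int_dH0], an integration by parts, that integral is t F(t). *)
Let F_derive a (t : R) : is_derive t 1 (F a) (- t * F a t).
Proof.
pose f (s : R) (x : mR) : R := cos (s * (x : R) + a) * phi x.
have tI : `]t - 1, t + 1[%classic t by rewrite /= in_itv/=; apply/andP; split; lra.
have fi s : `]t - 1, t + 1[%classic s -> mu.-integrable setT (EFin \o f s).
  by move=> _; apply: bdd_phi_int; exact: bdd_meas_cos.
have fd (s : R) x : is_derive s 1 (f ^~ x) (- (x * sin (s * x + a) * phi x)).
  by rewrite /f; deriv; rewrite /=; ring.
have fd1 s x : `]t - 1, t + 1[%classic s -> [set: mR] x -> derivable (f ^~ x) s 1.
  by move=> _ _; have [] := fd s x.
have p1 s x : partial1of2 f s x = - (x * sin (s * x + a) * phi x).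
  by rewrite partial1of2E; have [] := fd s x.
have ub s x : `]t - 1, t + 1[%classic s -> [set: mR] x -> `|partial1of2 f s x| <= G x.
  move=> _ _; rewrite p1 normrN /G !normrM (ger0_norm (phi_ge0 x)) ler_wpM2r//.
  by rewrite ler_piMr// ler_norml sin_geN1 sin_le1.
have G0 x : 0 <= G x by rewrite mulr_ge0.
have dF := derivable_under_integral measurableT tI fi fd1 G0 G_int ub.
have dFE := differentiation_under_integral measurableT tI fi fd1 G0 G_int ub.
split; first exact: dF.
rewrite -derive1E dFE.
under eq_Rintegral do rewrite p1 -mulN1r.
rewrite RintegralZl//.
have := int_dH0 t a; rewrite /dH RintegralB//; last first.
  by apply: intZ; apply: bdd_phi_int; exact: bdd_meas_cos.
rewrite RintegralZl//; last by apply: bdd_phi_int; exact: bdd_meas_cos.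
by rewrite -/(F a t); lra.
Qed.

(** By the equation F' = - t F, the product F(t) exp(t^2/2) has derivative 0; at t = 0 it is cos
    a. *)
Lemma Ex_normal_cos (t a : R) :
  Ex N01 (fun x : mR => cos (t * (x : R) + a)) = expR (- (t ^+ 2 / 2)) * cos a.
Proof.
rewrite Ex_normal_density; last exact: bdd_meas_cos.
rewrite -/(F a t).
have D (x : R) : is_derive x 1 (fun s => F a s * expR (s ^+ 2 / 2)) 0.
  notypeclasses refine (is_derive_eq _ _).
    by notypeclasses refine (derM (F_derive _ _) _); repeat deriv_step.
  by rewrite /=; field.
have := is_derive_0_is_cst t 0 D.
rewrite expr0n/= mul0r expR0 mulr1 => E.
have F0 : F a 0 = cos a.
  rewrite /F; under eq_Rintegral do rewrite mul0r add0r.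
  rewrite RintegralZl//; have /(congr1 fine) /= := integral_normal_pdf 0 (1 : R).
  by rewrite /Rintegral -/phi => ->; rewrite mulr1.
by rewrite -F0 -E expRN mulrCA mulVf ?mulr1// gt_eqF// expR_gt0.
Qed.

End gaussian.

(** * Characteristic functions of row sums *)

Section independence.
Context {d d'} {T : measurableType d} {T' : measurableType d'} {R : realType}.
Variable P : probability T R.

(* The step functions [floor (N h) / N] approximate a bounded [h] uniformly. *)
Lemma Ex_mul_of_indic (H : T -> R) (X : T -> T') (c : R) :
  bdd_meas H -> measurable_fun setT X ->
  (forall B, measurable B -> Ex P (fun w => H w * \1_B (X w)) = c * Ex P (fun w => \1_B (X w))) ->
  forall h, bdd_meas h -> Ex P (fun w => H w * h (X w)) = c * Ex P (fun w => h (X w)).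
Proof.
move=> bH mX HB h bh.
have [mh [M0 hM0]] := bh.
have [K HK] := bH.2.
pose M := Num.max M0 1.
have M1 : 1 <= M by rewrite /M le_max lexx orbT.
have hM x : `|h x| <= M by rewrite (le_trans (hM0 x))// /M le_max lexx.
apply/eqP; rewrite -subr_eq0 -normr_le0; apply/ler_addgt0Pl => e e0; rewrite addr0.
(* Replacing h by its step function costs at most K/N on the left and |c|/N on the right; the added
   1 makes C positive. *)
pose C := K + `|c| + 1.
have K0 : 0 <= K by rewrite (le_trans _ (HK point)).
have C0 : 0 < C by rewrite /C ltr_wpDl// addr_ge0.
pose N := (Num.truncn (C / e)).+1.
have N0 : 0 < N%:R :> R by rewrite ltr0n.
have NC : C / N%:R <= e.
  by rewrite ler_pdivrMr// mulrC -ler_pdivrMr// ltW// truncnS_gt.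
(* Enough levels of mesh 1/N, starting from -M, to cover [-M, M]. *)
pose L := (Num.truncn (2 * M * N%:R)).+1.
pose lev j : R := j%:R / N%:R - M.
pose B j := h @^-1` `[lev j, lev j.+1[.
pose g x := \sum_(j < L) lev j * \1_(B j) x.
have mB j : measurable (B j).
  by rewrite -[B j]setTI; apply: mh => //; exact: measurable_itv.
have bg1 (j : 'I_L) : bdd_meas (fun x => lev j * \1_(B j) x).
  by apply: bdd_measZ; exact: bdd_meas_indic.
have bg : bdd_meas g by exact: bdd_meas_sum.
have bI (j : 'I_L) : bdd_meas (fun w => \1_(B j) (X w) : R).
  by apply: (bdd_meas_comp mX); exact: bdd_meas_indic.
have gE : Ex P (fun w => H w * g (X w)) = c * Ex P (fun w => g (X w)).
  have -> : (fun w => H w * g (X w)) =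
      (fun w => \sum_(j < L) lev j * (H w * \1_(B j) (X w))).
    apply/funext => w; rewrite /g mulr_sumr; apply: eq_bigr => j _; ring.
  have bHI (j : 'I_L) : bdd_meas (fun w => H w * \1_(B j) (X w)).
    exact: bdd_measM.
  rewrite Ex_sum; last by move=> j; exact: bdd_measZ.
  rewrite Ex_sum; last by move=> j; exact: bdd_measZ.
  rewrite mulr_sumr; apply: eq_bigr => j _.
  rewrite !ExZ// HB//; ring.
have hg x : `|h x - g x| <= N%:R^-1.
  pose y := (h x + M) * N%:R.
  have hx := hM x; rewrite ler_norml in hx; case/andP: hx => hx1 hx2.
  have y0 : 0 <= y by rewrite mulr_ge0 ?(ltW N0)//; lra.
  pose k := Num.truncn y.
  have /andP[k1 k2] : k%:R <= y < k.+1%:R by exact: truncn_itv.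
  have kL : (k < L)%N.
    rewrite ltnS; apply: le_truncn; rewrite /y ler_pM2r//; lra.
  have hB j : (x \in B j) = (j == k).
    apply/idP/eqP.
      rewrite inE /B/= in_itv/= /lev => /andP[a b].
      have a' : j%:R <= y by rewrite /y -ler_pdivrMr// -lerBlDr.
      have b' : y < j.+1%:R by rewrite /y -ltr_pdivlMr// -ltrBrDr.
      have := le_lt_trans k1 b'; have := le_lt_trans a' k2.
      by rewrite !ltr_nat !ltnS => jk kj; apply/eqP; rewrite eqn_leq jk kj.
    move=> ->; rewrite inE /B/= in_itv/= /lev; apply/andP; split.
      by rewrite lerBlDr ler_pdivrMr.
    by rewrite ltrBrDr ltr_pdivlMr.
  have -> : g x = lev k.
    rewrite /g (bigD1 (Ordinal kL))//= indicE hB eqxx mulr1 big1 ?addr0// => j jk.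
    by rewrite indicE hB; move: jk; rewrite -val_eqE/= => /negbTE ->; rewrite mulr0.
  have -> : h x - lev k = (y - k%:R) / N%:R by rewrite /lev /y; field; rewrite gt_eqF.
  rewrite normrM (ger0_norm (_ : 0 <= y - k%:R)) ?subr_ge0//.
  rewrite ger0_norm ?invr_ge0 ?(ltW N0)// ler_piMl ?invr_ge0 ?(ltW N0)//.
  by rewrite lerBlDr addrC natr1 ltW.
have bhX := bdd_meas_comp mX bh; have bgX := bdd_meas_comp mX bg.
have e1 : `|Ex P (fun w => H w * h (X w)) - Ex P (fun w => H w * g (X w))| <= K / N%:R.
  rewrite -[leRHS](Ex_cst P); apply: Ex_dist.
  - exact: bdd_measM.
  - exact: bdd_measM.
  - exact: bdd_meas_cst.
  - by move=> w; rewrite -mulrBr normrM ler_pM.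
have e2 : `|Ex P (fun w => h (X w)) - Ex P (fun w => g (X w))| <= N%:R^-1.
  by rewrite -[leRHS](Ex_cst P); apply: Ex_dist => //; exact: bdd_meas_cst.
rewrite (le_trans _ NC)//.
have -> : Ex P (fun w => H w * h (X w)) - c * Ex P (fun w => h (X w)) =
  (Ex P (fun w => H w * h (X w)) - Ex P (fun w => H w * g (X w))) -
  c * (Ex P (fun w => h (X w)) - Ex P (fun w => g (X w))) by rewrite gE; ring.
rewrite (le_trans (ler_normB _ _))// normrM.
have := ler_wpM2l (normr_ge0 c) e2.
rewrite /C !mulrDl mul1r => e2'.
have Ni0 : 0 < N%:R^-1 :> R by rewrite invr_gt0.
lra.
Qed.

End independence.

Section prefix.
Context {d d'} {T : measurableType d} {T' : measurableType d'} {R : realType}.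
Variables (P : probability T R) (n : nat) (X : nat -> {RV P >-> T'}).

(* [H] behaves like a function of [X 0], ..., [X m.-1]. *)
Definition before (m : nat) (H : T -> R) :=
  bdd_meas H /\ forall B : nat -> set T', (forall i, measurable (B i)) ->
    Ex P (fun w => H w * \prod_(i < n | (m <= i)%N) \1_(B i) (X i w)) =
    Ex P H * \prod_(i < n | (m <= i)%N) Ex P (fun w => \1_(B i) (X i w)).

Lemma prod_geS (A : comPzRingType) (F : nat -> A) m : (m < n)%N ->
  \prod_(i < n | (m <= i)%N) F i = F m * \prod_(i < n | (m.+1 <= i)%N) F i.
Proof.
move=> mn; rewrite (bigD1 (Ordinal mn))//=; congr (_ * _).
by apply: eq_bigl => i; rewrite -val_eqE/= ltn_neqAle andbC eq_sym.
Qed.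

Let bI (B : nat -> set T') i : (forall i, measurable (B i)) ->
  bdd_meas (fun w => \1_(B i) (X i w) : R).
Proof.
move=> mB; apply: (bdd_meas_comp (f := \1_(B i)) (X := X i)) => //.
exact: bdd_meas_indic.
Qed.

Lemma before_bdd_meas m H : before m H -> bdd_meas H. Proof. by case. Qed.

Lemma before1 : mutually_independent (fun i : 'I_n => X i) -> before 0 (fun=> 1).
Proof.
move=> indep; split=> [|B mB]; first exact: bdd_meas_cst.
rewrite Ex_cst mul1r; have := indep [set: 'I_n]%SET (fun i => B i) (fun i => mB i).
set A := \bigcap_(i in _) _ => PA.
have AE w : \prod_(i < n | (0 <= i)%N) \1_(B i) (X i w) = \1_A w :> R.
  rewrite indicE; have [wA|wA] := boolP (w \in A).
    rewrite big1// => i _; rewrite indicE mem_set//.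
    by move: wA; rewrite inE => /(_ i); apply; rewrite /= inE.
  have [i wi] : exists i : 'I_n, ~ B i (X i w).
    apply/existsNP => wB; move/negP: wA; apply; rewrite inE => i _; exact: wB.
  by rewrite (bigD1 i)//= indicE memNset// mul0r.
have mX i : measurable (X i @^-1` B i) by exact: measurable_funPTI.
have mA : measurable A by apply: fin_bigcap_measurable => //; exact: finite_finset.
have -> : (fun w => 1 * \prod_(i < n | (0 <= i)%N) \1_(B i) (X i w)) = \1_A :> (T -> R).
  by apply/funext => w; rewrite mul1r AE.
rewrite Ex_indic// PA.
transitivity (fine (\prod_(i < n) (Ex P (fun w => \1_(B i) (X i w)))%:E)%E).
  congr fine; apply: eq_big => [i|i _]; first by rewrite inE.
  have -> : (fun w => \1_(B i) (X i w)) = \1_(X i @^-1` B i) :> (T -> R) by [].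
  by rewrite Ex_indic// fineK// fin_num_measure.
by rewrite prodEFin.
Qed.

Lemma beforeD m H K : before m H -> before m K -> before m (fun w => H w + K w).
Proof.
move=> [bH HB] [bK KB]; split=> [|B mB]; first exact: bdd_measD.
have bp : bdd_meas (fun w => \prod_(i < n | (m <= i)%N) \1_(B i) (X i w) : R).
  by apply: bdd_meas_prod => i; exact: bI.
rewrite ExD// mulrDl -HB// -KB// -ExD; [|exact: bdd_measM..].
by congr Ex; apply/funext => w; rewrite mulrDl.
Qed.

Lemma beforeZ m c H : before m H -> before m (fun w => c * H w).
Proof.
move=> [bH HB]; split=> [|B mB]; first exact: bdd_measZ.
have bp : bdd_meas (fun w => \prod_(i < n | (m <= i)%N) \1_(B i) (X i w) : R).
  by apply: bdd_meas_prod => i; exact: bI.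
rewrite ExZ// -mulrA -HB// -ExZ; last exact: bdd_measM.
by congr Ex; apply/funext => w; rewrite mulrA.
Qed.

(** For an indicator h this is the identity defining [before m] with the m-th set replaced.
    [Ex_mul_of_indic], with the product over later indices absorbed into the weight, extends it to
    bounded h. *)
Lemma before_mul m H h : (m < n)%N -> before m H -> bdd_meas h ->
  Ex P (fun w => H w * h (X m w)) = Ex P H * Ex P (fun w => h (X m w)) /\
  before m.+1 (fun w => H w * h (X m w)).
Proof.
move=> mn [bH HB] bh.
have bhX : bdd_meas (fun w => h (X m w)) by exact: (bdd_meas_comp (X := X m)).
pose tl (B : nat -> set T') w : R := \prod_(i < n | (m < i)%N) \1_(B i) (X i w).
pose etl (B : nat -> set T') : R :=
  \prod_(i < n | (m < i)%N) Ex P (fun w => \1_(B i) (X i w)).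
have key B : (forall i, measurable (B i)) ->
    Ex P (fun w => H w * h (X m w) * tl B w) =
    Ex P H * Ex P (fun w => h (X m w)) * etl B.
  move=> mB.
  have btl : bdd_meas (tl B) by apply: bdd_meas_prod => i; exact: bI.
  rewrite (_ : (fun w => _) = (fun w => (H w * tl B w) * h (X m w))); last first.
    by apply/funext => w; ring.
  rewrite (@Ex_mul_of_indic _ _ _ _ _ P _ (X m) (Ex P H * etl B))//; last 2 first.
  - exact: bdd_measM.
  - move=> B0 mB0; pose B' i := if i == m then B0 else B i.
    have mB' i : measurable (B' i) by rewrite /B'; case: ifP.
    have := HB B' mB'; rewrite (prod_geS (fun i => Ex P (fun w => \1_(B' i) (X i w))))//.
    rewrite (_ : B' m = B0); last by rewrite /B' eqxx.
    rewrite (_ : \prod_(i < n | (m < i)%N) Ex P (fun w => \1_(B' i) (X i w)) = etl B); last first.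
      by apply: eq_bigr => i mi; rewrite /B' gtn_eqF.
    rewrite (_ : (fun w => _) = (fun w => H w * tl B w * \1_B0 (X m w))); last first.
      apply/funext => w; rewrite (prod_geS (fun i => \1_(B' i) (X i w) : R))//.
      rewrite (_ : B' m = B0); last by rewrite /B' eqxx.
      rewrite (_ : \prod_(i < n | (m < i)%N) \1_(B' i) (X i w) = tl B w); last first.
        by apply: eq_bigr => i mi; rewrite /B' gtn_eqF.
      ring.
    by move=> ->; ring.
  ring.
(* With every set equal to the whole space, the factors of index above m are all 1. *)
have E : Ex P (fun w => H w * h (X m w)) = Ex P H * Ex P (fun w => h (X m w)).
  have := key (fun=> setT) (fun=> measurableT).
  rewrite /etl big1 ?mulr1 => [|i _]; last first.
    by rewrite (_ : (fun w => _) = (fun=> 1)) ?Ex_cst//; apply/funext => w; rewrite indicT.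
  move=> <-; congr Ex; apply/funext => w.
  by rewrite /tl big1 ?mulr1// => i _; rewrite indicT.
split=> //; split; first exact: bdd_measM.
by move=> B mB; rewrite E; exact: key.
Qed.

Lemma before_next m H : (m < n)%N -> before m H -> before m.+1 H.
Proof.
move=> mn bH; have [_] := before_mul mn bH (bdd_meas_cst 1).
by under eq_fun do rewrite mulr1.
Qed.

Hypothesis indep : mutually_independent (fun i : 'I_n => X i).

Lemma before_cst m c : (m <= n)%N -> before m (fun=> c).
Proof.
elim: m => [_|m IH mn]; last exact: (before_next mn (IH (ltnW mn))).
have := beforeZ c (before1 indep); by under eq_fun do rewrite mulr1.
Qed.

Lemma before_sum (h : T' -> R) m : (m <= n)%N -> bdd_meas h ->
  before m (fun w => \sum_(i < m) h (X i w)).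
Proof.
move=> + bh; elim: m => [_|m IH mn].
  by under eq_fun do rewrite big_ord0; exact: before_cst.
under eq_fun do rewrite big_ord_recr/=.
apply: beforeD; first exact: before_next (IH (ltnW mn)).
have [_] := before_mul mn (before_cst 1 (ltnW mn)) bh.
by under eq_fun do rewrite mul1r.
Qed.

(** Adding the term of index m creates a cross product of a [before m] sum with a centred h (X m),
    and [before_mul] makes its expectation 0. *)
Lemma Ex_sum_sqr (h : T' -> R) v : bdd_meas h ->
  (forall i, (i < n)%N -> Ex P (fun w => h (X i w)) = 0) ->
  (forall i, (i < n)%N -> Ex P (fun w => h (X i w) ^+ 2) = v) ->
  Ex P (fun w => (\sum_(i < n) h (X i w)) ^+ 2) = n%:R * v.
Proof.
move=> bh h0 h2.
suff: forall m, (m <= n)%N ->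
    Ex P (fun w => (\sum_(i < m) h (X i w)) ^+ 2) = m%:R * v by apply.
elim=> [_|m IH mn].
  under eq_fun do rewrite big_ord0 expr0n/=.
  by rewrite Ex_cst mul0r.
under eq_fun do rewrite big_ord_recr/= sqrrD -mulr_natl.
have bS := before_sum (ltnW mn) bh.
have bS1 := before_bdd_meas bS.
have bhX : bdd_meas (fun w => h (X m w)) by exact: (bdd_meas_comp (X := X m)).
rewrite ExD; [|apply: bdd_measD|exact: bdd_measX]; last 2 first.
- exact: bdd_measX.
- by apply: bdd_measZ; exact: bdd_measM.
rewrite ExD; [|exact: bdd_measX|by apply: bdd_measZ; exact: bdd_measM].
rewrite ExZ; last exact: bdd_measM.
rewrite (before_mul mn bS bh).1 h0// mulr0 mulr0 addr0 IH ?(ltnW mn)// h2//.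
by rewrite -natr1; ring.
Qed.

(* The recursion of the characteristic function E[exp(i sum h)], in real form. *)
Lemma Ex_cos_sin_sum (h : T' -> R) c s : measurable_fun setT h ->
  (forall i, (i < n)%N -> Ex P (fun w => cos (h (X i w))) = c) ->
  (forall i, (i < n)%N -> Ex P (fun w => sin (h (X i w))) = s) ->
  forall m, (m <= n)%N ->
  [/\ `|Ex P (fun w => cos (\sum_(i < m) h (X i w))) - c ^+ m| <= (m%:R * `|s|) ^+ 2
    & `|Ex P (fun w => sin (\sum_(i < m) h (X i w)))| <= m%:R * `|s|].
Proof.
move=> mh hc hs.
pose Cm m w := cos (\sum_(i < m) h (X i w)).
pose Sm m w := sin (\sum_(i < m) h (X i w)).
have bc := bdd_meas_cos mh; have bs := bdd_meas_sin mh.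
have CS m : (m <= n)%N -> before m (Cm m) /\ before m (Sm m).
  elim: m => [_|m IH mn].
    rewrite /Cm /Sm; split.
      by under eq_fun do rewrite big_ord0 cos0; exact: before_cst.
    by under eq_fun do rewrite big_ord0 sin0; exact: before_cst.
  have [bC bS] := IH (ltnW mn); rewrite /Cm /Sm; split.
    under eq_fun do rewrite big_ord_recr/= cosD -mulN1r.
    apply: beforeD; first by have [] := before_mul mn bC bc.
    by apply: beforeZ; have [] := before_mul mn bS bs.
  under eq_fun do rewrite big_ord_recr/= sinD.
  apply: beforeD; first by have [] := before_mul mn bS bc.
  by have [] := before_mul mn bC bs.
elim=> [_|m IH mn].
  split; last by under eq_fun do rewrite big_ord0 sin0; rewrite Ex_cst normr0 mul0r.
  under eq_fun do rewrite big_ord0 cos0; rewrite Ex_cst subrr normr0.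
  by rewrite mul0r expr0n.
have [IHc IHs] := IH (ltnW mn).
have [bC bS] := CS m (ltnW mn).
have hXm : bdd_meas (fun w => cos (h (X m w))).
  exact: (bdd_meas_comp (f := fun x => cos (h x)) (X := X m)).
have hXs : bdd_meas (fun w => sin (h (X m w))).
  exact: (bdd_meas_comp (f := fun x => sin (h x)) (X := X m)).
have [bC1 bS1] := (before_bdd_meas bC, before_bdd_meas bS).
have c1 : `|c| <= 1.
  rewrite -(hc m mn); apply: Ex_norm_cst => // w.
  by rewrite ler_norml cos_geN1 cos_le1.
have C1 : `|Ex P (Cm m)| <= 1.
  by apply: Ex_norm_cst => // w; rewrite ler_norml cos_geN1 cos_le1.
have S1 : `|Ex P (Sm m)| <= 1.
  by apply: Ex_norm_cst => // w; rewrite ler_norml sin_geN1 sin_le1.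
have s0 := normr_ge0 s.
have Ec : Ex P (Cm m.+1) = Ex P (Cm m) * c - Ex P (Sm m) * s.
  rewrite /Cm; under eq_fun do rewrite big_ord_recr/= cosD.
  rewrite ExB; [|exact: bdd_measM..].
  by rewrite (before_mul mn bC bc).1 (before_mul mn bS bs).1 hc// hs.
have Es : Ex P (Sm m.+1) = Ex P (Sm m) * c + Ex P (Cm m) * s.
  rewrite /Sm; under eq_fun do rewrite big_ord_recr/= sinD.
  rewrite ExD; [|exact: bdd_measM..].
  by rewrite (before_mul mn bC bs).1 (before_mul mn bS bc).1 hc// hs.
split.
  rewrite -/(Cm m.+1) Ec exprSr.
  have -> : Ex P (Cm m) * c - Ex P (Sm m) * s - c ^+ m * c =
    (Ex P (Cm m) - c ^+ m) * c - Ex P (Sm m) * s by ring.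
  rewrite (le_trans (ler_normB _ _))// !normrM.
  have h1 : `|Ex P (Cm m) - c ^+ m| * `|c| <= (m%:R * `|s|) ^+ 2 by rewrite -[leRHS]mulr1 ler_pM.
  have h2 : `|Ex P (Sm m)| * `|s| <= m%:R * `|s| * `|s| by rewrite ler_wpM2r.
  have m0 : 0 <= m%:R :> R by [].
  (* The two errors add up to m^2 s^2 + m s^2 <= ((m + 1) s)^2. *)
  rewrite -natr1; nra.
rewrite -/(Sm m.+1) Es (le_trans (ler_normD _ _))// !normrM.
have h1 : `|Ex P (Sm m)| * `|c| <= m%:R * `|s| by rewrite -[leRHS]mulr1 ler_pM.
have h2 : `|Ex P (Cm m)| * `|s| <= `|s| by rewrite ler_piMl.
rewrite -natr1; lra.
Qed.

End prefix.

Lemma ler_dist_expr {R : realFieldType} (a b : R) n : `|a| <= 1 -> `|b| <= 1 ->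
  `|a ^+ n - b ^+ n| <= n%:R * `|a - b|.
Proof.
move=> a1 b1; elim: n => [|n IH]; first by rewrite !expr0 subrr normr0 mul0r.
have -> : a ^+ n.+1 - b ^+ n.+1 = a * (a ^+ n - b ^+ n) + (a - b) * b ^+ n.
  by rewrite !exprS; ring.
rewrite (le_trans (ler_normD _ _))// !normrM -natr1 mulrDl mul1r lerD//.
  by rewrite -[leRHS]mul1r ler_pM.
by rewrite ler_piMr// normrX exprn_ile1.
Qed.

Section characteristic_function_clt.
Context {R : realType} {d'} {T' : measurableType d'}.

(** With q = E h^2, so that n q = v: as h is centred, E sin h is at most dl q / 6 in absolute value,
    while E cos h differs from 1 - q/2 by at most dl^2 q / 24 and exp(-q/2) by at most q^2/4. Powers
    of numbers in [-1, 1] multiply errors by n at most. The four terms of the bound come, in order,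
    from the sine in the cosine recursion, the cosine remainder, the exponential remainder, and the
    factor sin a. *)
Lemma char_sum_bound {d} {T : measurableType d} (P : probability T R) (n : nat)
    (X : nat -> {RV P >-> T'}) (h : T' -> R) (dl v a : R) :
  (0 < n)%N -> mutually_independent (fun i : 'I_n => X i) ->
  (forall i j : 'I_n, same_distribution P (X i) (X j)) ->
  measurable_fun setT h -> (forall x, `|h x| <= dl) ->
  Ex P (fun w => h (X 0 w)) = 0 -> n%:R * Ex P (fun w => h (X 0 w) ^+ 2) = v ->
  `|Ex P (fun w => cos (\sum_(i < n) h (X i w) + a)) - expR (- (v / 2)) * cos a| <=
    (dl * v) ^+ 2 + dl ^+ 2 * v + v ^+ 2 / n%:R + dl * v.
Proof.
move=> n0 indep same mh hdl h0 h2.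
have bh : bdd_meas h by split=> //; exists dl.
have dl0 : 0 <= dl by rewrite (le_trans _ (hdl point)).
have nR : 0 < n%:R :> R by rewrite ltr0n.
have bX (g : T' -> R) i : bdd_meas g -> bdd_meas (fun w => g (X i w)).
  by move=> bg; apply: (bdd_meas_comp (X := X i)).
have same0 (g : T' -> R) i : bdd_meas g -> (i < n)%N ->
    Ex P (fun w => g (X i w)) = Ex P (fun w => g (X 0 w)).
  move=> bg i_n; apply: eq_law_Ex => // B mB.
  exact: (same (Ordinal i_n) (Ordinal n0)).
pose c := Ex P (fun w => cos (h (X 0 w))); pose s := Ex P (fun w => sin (h (X 0 w))).
pose q := Ex P (fun w => h (X 0 w) ^+ 2).
have q0 : 0 <= q by apply: Ex_ge0 => w; exact: sqr_ge0.
have v0 : 0 <= v by rewrite -h2 mulr_ge0// ltW.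
have bc := bdd_meas_cos mh; have bs := bdd_meas_sin mh.
have bh2 := bdd_measX 2 bh.
have [||Hc Hs] := @Ex_cos_sin_sum _ _ _ _ _ P n X indep h c s mh _ _ n (leqnn n).
- by move=> i i_n; exact: (same0 (fun x => cos (h x))).
- by move=> i i_n; exact: (same0 (fun x => sin (h x))).
have sb : `|s| <= dl / 6 * q.
  have -> : s = s - Ex P (fun w => h (X 0 w)) by rewrite h0 subr0.
  rewrite /s /q -ExZ; last exact: (bX (fun x => h x ^+ 2)).
  apply: Ex_dist.
  - exact: (bX (fun x => sin (h x))).
  - exact: bX.
  - by apply: bdd_measZ; exact: (bX (fun x => h x ^+ 2)).
  move=> w; rewrite (le_trans (sin_taylor _))//.
  have /(ler_wpM2r (sqr_ge0 (h (X 0 w)))) := hdl (X 0 w).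
  have -> : `|h (X 0 w)| ^+ 3 = `|h (X 0 w)| * h (X 0 w) ^+ 2.
    by rewrite exprS real_normK ?num_real.
  lra.
have nsb : n%:R * `|s| <= dl * v / 6.
  have := ler_wpM2l (ltW nR) sb; rewrite -h2 -/q; lra.
have cb : `|c - (1 - q / 2)| <= dl ^+ 2 / 24 * q.
  have -> : 1 - q / 2 = Ex P (fun w => 1 + (- 2^-1) * h (X 0 w) ^+ 2).
    rewrite ExD; [|exact: bdd_meas_cst|by apply: bdd_measZ; exact: (bX (fun x => h x ^+ 2))].
    rewrite Ex_cst ExZ; last exact: (bX (fun x => h x ^+ 2)).
    by rewrite -/q; lra.
  rewrite /c /q -ExZ; last exact: (bX (fun x => h x ^+ 2)).
  apply: Ex_dist.
  - exact: (bX (fun x => cos (h x))).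
  - apply: bdd_measD; first exact: bdd_meas_cst.
    by apply: bdd_measZ; exact: (bX (fun x => h x ^+ 2)).
  - by apply: bdd_measZ; exact: (bX (fun x => h x ^+ 2)).
  move=> w; set y := h (X 0 w).
  have -> : cos y - (1 + - 2^-1 * y ^+ 2) = cos y - 1 + y ^+ 2 / 2 by ring.
  rewrite (le_trans (cos_taylor _))//.
  have y2 : y ^+ 2 <= dl ^+ 2.
    rewrite -[y ^+ 2]real_normK ?num_real//; apply: lerXn2r; rewrite ?nnegrE//.
    exact: hdl.
  have := sqr_ge0 y; rewrite (_ : y ^+ 4 = y ^+ 2 * y ^+ 2); last by ring.
  nra.
pose D := expR (- (q / 2)).
have Db : `|D - (1 - q / 2)| <= (q / 2) ^+ 2 by apply: expRN_taylor; rewrite divr_ge0.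
have c1 : `|c| <= 1.
  apply: Ex_norm_cst; first exact: (bX (fun x => cos (h x))).
  by move=> w; rewrite ler_norml cos_geN1 cos_le1.
have D1 : `|D| <= 1.
  by rewrite ger0_norm ?expR_ge0// -expR0 ler_expR oppr_le0 divr_ge0.
have DE : D ^+ n = expR (- (v / 2)).
  by rewrite /D -expRM_natl; congr expR; rewrite -h2 -/q; ring.
have cD : `|c ^+ n - D ^+ n| <= dl ^+ 2 * v / 24 + v ^+ 2 / n%:R / 4.
  rewrite (le_trans (ler_dist_expr n c1 D1))//.
  have cDb : `|c - D| <= dl ^+ 2 / 24 * q + (q / 2) ^+ 2.
    have -> : c - D = (c - (1 - q / 2)) - (D - (1 - q / 2)) by ring.
    by rewrite (le_trans (ler_normB _ _))// lerD.
  have qE : q = v / n%:R by rewrite -h2 -/q mulrAC mulfV ?mul1r// gt_eqF.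
  have := ler_wpM2l (ltW nR) cDb; rewrite qE => /le_trans; apply.
  rewrite le_eqVlt; apply/orP; left; apply/eqP; field; rewrite gt_eqF//.
have bsum : bdd_meas (fun w => \sum_(i < n) h (X i w)).
  by apply: bdd_meas_sum => i; exact: bX.
have bC := bdd_meas_cos bsum.1; have bS := bdd_meas_sin bsum.1.
set C := Ex P (fun w => cos (\sum_(i < n) h (X i w))) in Hc.
set S := Ex P (fun w => sin (\sum_(i < n) h (X i w))) in Hs.
have -> : Ex P (fun w => cos (\sum_(i < n) h (X i w) + a)) = cos a * C - sin a * S.
  rewrite -!ExZ// -ExB; [|exact: bdd_measZ..].
  by congr Ex; apply/funext => w; rewrite cosD; ring.
have -> : cos a * C - sin a * S - expR (- (v / 2)) * cos a =
  cos a * ((C - c ^+ n) + (c ^+ n - D ^+ n)) - sin a * S by rewrite DE; ring.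
rewrite (le_trans (ler_normB _ _))// !normrM.
have ca : `|cos a| <= 1 by rewrite ler_norml cos_geN1 cos_le1.
have sa : `|sin a| <= 1 by rewrite ler_norml sin_geN1 sin_le1.
have t1 : `|cos a| * `|(C - c ^+ n) + (c ^+ n - D ^+ n)| <=
    (n%:R * `|s|) ^+ 2 + (dl ^+ 2 * v / 24 + v ^+ 2 / n%:R / 4).
  by rewrite -[leRHS]mul1r ler_pM// (le_trans (ler_normD _ _))// lerD.
have t2 : `|sin a| * `|S| <= n%:R * `|s| by rewrite -[leRHS]mul1r ler_pM.
have p1 : 0 <= dl * v by rewrite mulr_ge0.
have p2 : 0 <= dl ^+ 2 * v by rewrite mulr_ge0// sqr_ge0.
have p3 : 0 <= v ^+ 2 / n%:R by rewrite divr_ge0// sqr_ge0.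
have t3 : (n%:R * `|s|) ^+ 2 <= (dl * v) ^+ 2.
  by rewrite ler_sqr ?nnegrE ?mulr_ge0// (le_trans nsb)//; lra.
lra.
Qed.

Lemma char_sum_cvg {d : nat -> measure_display} {T : forall n, measurableType (d n)}
    (P : forall n, probability (T n) R) (X : forall n, nat -> {RV (P n) >-> T'})
    (h : nat -> T' -> R) (dl : nat -> R) (v a : R) :
  (forall n, mutually_independent (fun i : 'I_n => X n i)) ->
  (forall n (i j : 'I_n), same_distribution (P n) (X n i) (X n j)) ->
  (forall n, measurable_fun setT (h n)) ->
  (\forall n \near \oo, forall x, `|h n x| <= dl n) -> dl n @[n --> \oo] --> (0 : R) ->
  (\forall n \near \oo, Ex (P n) (fun w => h n (X n 0 w)) = 0) ->
  n%:R * Ex (P n) (fun w => h n (X n 0 w) ^+ 2) @[n --> \oo] --> v ->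
  Ex (P n) (fun w => cos (\sum_(i < n) h n (X n i w) + a)) @[n --> \oo] -->
    expR (- (v / 2)) * cos a.
Proof.
move=> indep same mh hdl dl0 h0 hv.
pose vn n : R := n%:R * Ex (P n) (fun w => h n (X n 0 w) ^+ 2).
pose err n := (dl n * vn n) ^+ 2 + dl n ^+ 2 * vn n + vn n ^+ 2 / n%:R + dl n * vn n.
have ni : (n%:R^-1 : R) @[n --> \oo] --> (0 : R) by exact: cvg_invn.
have err0 : err n @[n --> \oo] --> (0 : R).
  have -> : (0 : R) = (0 * v) * (0 * v) + 0 * 0 * v + v * v * 0 + 0 * v by ring.
  have -> : err = fun n => (dl n * vn n) * (dl n * vn n) + dl n * dl n * vn n +
     vn n * vn n * n%:R^-1 + dl n * vn n by apply/funext => n; rewrite /err; ring.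
  apply: cvgD; last exact: cvgM.
  apply: cvgD; last by apply: cvgM => //; exact: cvgM.
  by apply: cvgD; apply: cvgM; try exact: cvgM.
have e1 : expR (- (vn n / 2)) * cos a @[n --> \oo] --> expR (- (v / 2)) * cos a.
  apply: cvgM; last exact: cvg_cst.
  apply: continuous_cvg; first exact: continuous_expR.
  by apply: cvgN; apply: cvgM => //; exact: cvg_cst.
apply/cvgrPdist_le => e e0.
have e20 : 0 < e / 2 by rewrite divr_gt0.
near=> n.
have nn : (0 < n)%N by near: n; exists 1%N.
have b : `|Ex (P n) (fun w => cos (\sum_(i < n) h n (X n i w) + a)) -
    expR (- (vn n / 2)) * cos a| <= err n.
  apply: (char_sum_bound (P := P n) (X := X n) (h := h n) (dl := dl n) (v := vn n)) => //; first by near: n; exact: hdl.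
  by near: n; exact: h0.
have b1 : `|expR (- (v / 2)) * cos a - expR (- (vn n / 2)) * cos a| <= e / 2.
  by near: n; move/cvgrPdist_le : e1 => /(_ _ e20).
have b2 : `|0 - err n| <= e / 2 by near: n; move/cvgrPdist_le : err0 => /(_ _ e20).
rewrite sub0r normrN in b2; have b3 := ler_norm (err n).
rewrite distrC in b.
rewrite (le_trans (ler_distD (expR (- (vn n / 2)) * cos a) _ _))//; lra.
Unshelve. all: by end_near. Qed.

End characteristic_function_clt.

(** * Stone-Weierstrass approximation and weak convergence *)

Section stone_weierstrass.
Context {R : realType} {V : topologicalType}.
Implicit Types (f g h : V -> R) (A : (V -> R) -> Prop).

(** Uniform on the whole space, not on a compact set: functions in the closure stay bounded, and
    clipping one yields approximants in A with a global bound. *)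
Definition unif_closure A f :=
  forall e, 0 < e -> exists2 g, A g & forall y, `|f y - g y| <= e.

Record separating_algebra A : Prop := {
  salg_cst : forall c, A (fun=> c) ;
  salg_add : forall f g, A f -> A g -> A (fun y => f y + g y) ;
  salg_mul : forall f g, A f -> A g -> A (fun y => f y * g y) ;
  salg_bounded : forall f, A f -> exists M, forall y, `|f y| <= M ;
  salg_continuous : forall f, A f -> continuous f ;
  salg_separates : forall x y, x != y -> exists2 g, A g & g x != g y }.

Variable A : (V -> R) -> Prop.
Hypothesis HA : separating_algebra A.
Local Notation clA := (unif_closure A).

Lemma sub_unif_closure f : A f -> clA f.
Proof. by move=> Af e e0; exists f => // y; rewrite subrr normr0 ltW. Qed.

Lemma unif_closure_bounded f : clA f -> exists M, 0 < M /\ forall y, `|f y| <= M.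
Proof.
move=> /(_ 1 ltr01)[g Ag fg]; have [M gM] := salg_bounded HA Ag.
exists (`|M| + 1); split=> [|y]; first by rewrite ltr_wpDl.
have -> : f y = (f y - g y) + g y by ring.
rewrite (le_trans (ler_normD _ _))// addrC lerD//.
by rewrite (le_trans (gM y))// ler_norm.
Qed.

Lemma unif_closure_continuous f : clA f -> continuous f.
Proof.
move=> cf x; apply/cvgrPdist_le => e e0.
have e3 : 0 < e / 3 by rewrite divr_gt0.
have [g Ag fg] := cf _ e3.
have cg : continuous g by exact: salg_continuous HA _ Ag.
have /cvgrPdist_le /(_ _ e3) gx := cg x.
apply: filterS gx => y gxy.
have -> : f x - f y = (f x - g x) + (g x - g y) - (f y - g y) by ring.
rewrite (le_trans (ler_normB _ _))//.
have := ler_normD (f x - g x) (g x - g y); have := fg x; have := fg y; lra.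
Qed.

Lemma unif_closure_idem f : unif_closure clA f -> clA f.
Proof.
move=> cf e e0; have e2 : 0 < e / 2 by rewrite divr_gt0.
have [g cg fg] := cf _ e2; have [h Ah gh] := cg _ e2; exists h => // y.
have -> : f y - h y = (f y - g y) + (g y - h y) by ring.
rewrite (le_trans (ler_normD _ _))//; have := fg y; have := gh y; lra.
Qed.

Lemma unif_closureD f g : clA f -> clA g -> clA (fun y => f y + g y).
Proof.
move=> cf cg e e0; have e2 : 0 < e / 2 by rewrite divr_gt0.
have [f1 Af1 ff1] := cf _ e2; have [g1 Ag1 gg1] := cg _ e2.
exists (fun y => f1 y + g1 y) => [|y]; first exact: (salg_add HA).
have -> : f y + g y - (f1 y + g1 y) = (f y - f1 y) + (g y - g1 y) by ring.
rewrite (le_trans (ler_normD _ _))//; have := ff1 y; have := gg1 y; lra.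
Qed.

Lemma unif_closureM f g : clA f -> clA g -> clA (fun y => f y * g y).
Proof.
move=> cf cg e e0.
have [M [M0 fM]] := unif_closure_bounded cf.
have e2 : 0 < e / 2 / M by rewrite !divr_gt0.
(* The approximant of g comes first, since the tolerance for f depends on its bound N. *)
have [g1 Ag1 gg1] := cg _ e2.
have [N [N0 gN]] := unif_closure_bounded (sub_unif_closure Ag1).
have e3 : 0 < e / 2 / N by rewrite !divr_gt0.
have [f1 Af1 ff1] := cf _ e3.
exists (fun y => f1 y * g1 y) => [|y]; first exact: (salg_mul HA).
have -> : f y * g y - f1 y * g1 y = f y * (g y - g1 y) + (f y - f1 y) * g1 y by ring.
rewrite (le_trans (ler_normD _ _))// !normrM.
have h1 : `|f y| * `|g y - g1 y| <= M * (e / 2 / M) by rewrite ler_pM.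
have h2 : `|f y - f1 y| * `|g1 y| <= (e / 2 / N) * N by rewrite ler_pM.
rewrite divfK ?gt_eqF// in h2.
have E : M * (e / 2 / M) = e / 2 by rewrite mulrC divfK// gt_eqF.
lra.
Qed.

Lemma unif_closure_cst c : clA (fun=> c).
Proof. exact/sub_unif_closure/(salg_cst HA). Qed.

Lemma unif_closureZ c f : clA f -> clA (fun y => c * f y).
Proof. by move=> cf; apply: unif_closureM => //; exact: unif_closure_cst. Qed.

(* The iteration q := q + (u^2 - q^2)/2 started at 0 increases to |u|. *)
Lemma unif_closure_norm_le1 f : clA f -> (forall y, `|f y| <= 1) ->
  clA (fun y => `|f y|).
Proof.
move=> cf f1.
pose q := fix q k y := if k is k'.+1 then q k' y + 2^-1 * (f y * f y + -1 * (q k' y * q k' y)) else 0 : R.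
have cq k : clA (q k).
  elim: k => [|k IH] /=; first exact: unif_closure_cst.
  apply: unif_closureD => //; apply: unif_closureZ.
  by apply: unif_closureD; [|apply: unif_closureZ]; exact: unif_closureM.
(* With u = |f y|, p = q k y and d = u - p, the next error is d (1 - (u + p)/2) <= d (1 - d/2). This
   yields the rate 2/(k + 1), uniformly in y. *)
have qb k y : [/\ 0 <= q k y, q k y <= `|f y| & (`|f y| - q k y) * k.+1%:R <= 2].
  have u1 := f1 y; have u0 := normr_ge0 (f y).
  elim: k => [|k [IH0 IH1 IH2]] /=.
    by split=> //; rewrite subr0 mulr1 (le_trans u1)// ler1n.
  have -> : f y * f y = `|f y| ^+ 2 by rewrite real_normK ?num_real.
  set u := `|f y| in u1 u0 IH1 IH2 *; set p := q k y in IH0 IH1 IH2 *.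
  split; [nra|nra|].
  rewrite -[k.+2%:R]natr1; set N : R := k.+1%:R in IH2 *.
  have N1 : 1 <= N by rewrite ler1n.
  have d0 : 0 <= u - p by lra.
  have -> : u - (p + 2^-1 * (u ^+ 2 + -1 * (p * p))) = (u - p) * (1 - (u + p) / 2) by field.
  have h1 : (u - p) * (1 - (u + p) / 2) <= (u - p) * (1 - (u - p) / 2).
    by rewrite ler_wpM2l//; lra.
  have h2 : (u - p) * (1 - (u - p) / 2) * (N + 1) <= 2.
    set dd := u - p in IH2 d0 *; have dd1 : dd <= 1 by rewrite /dd; lra.
    have : 0 <= (2 - dd * N) * (1 - dd) by rewrite mulr_ge0//; lra.
    have := sqr_ge0 dd; have : 0 <= dd * (dd * N) by rewrite !mulr_ge0//; lra.
    nra.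
  by apply: le_trans h2; rewrite ler_wpM2r//; lra.
apply: unif_closure_idem => e e0.
pose k := Num.truncn (2 / e).
exists (q k) => // y; have [q0 q1 q2] := qb k y.
rewrite ger0_norm ?subr_ge0//.
have k1 : 2 / e < k.+1%:R by exact: truncnS_gt.
have : 2 < k.+1%:R * e by rewrite -ltr_pdivrMr.
have kp : 0 < k.+1%:R :> R by rewrite ltr0n.
rewrite -(ler_pM2r kp) => h; apply: le_trans q2 _; rewrite mulrC ltW//.
Qed.

Lemma unif_closure_norm f : clA f -> clA (fun y => `|f y|).
Proof.
move=> cf; have [M [M0 fM]] := unif_closure_bounded cf.
have := unif_closure_norm_le1 (unif_closureZ M^-1 cf).
have -> : (fun y => `|f y|) = fun y => M * `|M^-1 * f y|.
  apply/funext => y; rewrite normrM ger0_norm ?invr_ge0 ?(ltW M0)//.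
  by rewrite mulrA mulfV ?mul1r// gt_eqF.
move=> H; apply/unif_closureZ/H => y.
by rewrite normrM ger0_norm ?invr_ge0 ?(ltW M0)// ler_pdivrMl// mulr1.
Qed.

Lemma unif_closureN f : clA f -> clA (fun y => - f y).
Proof. by move=> /(unif_closureZ (-1)); under eq_fun do rewrite mulN1r. Qed.

Lemma unif_closure_max f g : clA f -> clA g -> clA (fun y => Num.max (f y) (g y)).
Proof.
move=> cf cg.
have -> : (fun y => Num.max (f y) (g y)) =
    fun y => 2^-1 * (f y + g y + `|f y + -1 * g y|).
  by apply/funext => y; rewrite maxr_absE mulN1r mulrC.
apply/unif_closureZ/unif_closureD; first exact: unif_closureD.
exact/unif_closure_norm/unif_closureD/unif_closureZ.
Qed.

Lemma unif_closure_min f g : clA f -> clA g -> clA (fun y => Num.min (f y) (g y)).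
Proof.
move=> cf cg; have := unif_closureN (unif_closure_max (unif_closureN cf) (unif_closureN cg)).
by under eq_fun do rewrite oppr_max !opprK.
Qed.

(* A directed family lying above [f] at each point of [K] has a member above [f]
   on [K]: take the filter of its upper sections. *)
Lemma compact_directed_above (K : set V) (B : set (V -> R)) f :
  compact K -> continuous f -> B !=set0 ->
  (forall g, B g -> continuous g) ->
  (forall g h, B g -> B h -> B (fun y => Num.max (g y) (h y))) ->
  (forall x, K x -> exists2 g, B g & f x < g x) ->
  exists2 g, B g & forall x, K x -> f x < g x.
Proof.
move=> cK cf B0 Bc Bmax fB.
pose up g0 := [set g | B g /\ forall y, g0 y <= g y].
pose F := filter_from B up.
have FF : Filter F.
  apply: filter_from_filter => // g h Bg Bh.
  exists (fun y => Num.max (g y) (h y)); first exact: Bmax.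
  by move=> k [Bk mk]; split; split => // y; rewrite (le_trans _ (mk y))// le_max lexx ?orbT.
have [|g0 Bg0 sub] := (compact_near_coveringP K).1 cK _ F (fun g x => f x < g x) FF.
  move=> x Kx; have [g Bg fg] := fB x Kx.
  have n1 : \forall x' \near x, f x' < g x'.
    have c : (fun y => g y - f y) x' @[x' --> x] --> g x - f x.
      by apply: cvgB; [exact: Bc|exact: cf].
    have H0 : 0 < g x - f x by rewrite subr_gt0.
    by near=> y; rewrite -subr_gt0; near: y; exact: (cvgr_gt _ c _ H0).
  have n2 : \forall h \near F, B h /\ forall y, g y <= h y by exists g.
  near=> x' h => /=.
  have fg' : f x' < g x' by near: x'.
  have [_ /(_ x') gh] : B h /\ forall y, g y <= h y by near: h.
  exact: lt_le_trans gh.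
by exists g0 => // x Kx; apply: (sub g0) => //; split.
Unshelve. all: by end_near. Qed.

(** Functions of the closure interpolate f at any two points. Maxima give, for each x, a member
    above f - e/2 on K that equals f at x; minima of such members stay above f - e/2 and come below
    f + e/2 on K. Both passes use compactness through [compact_directed_above]. *)
Lemma stone_weierstrass_bounded (K : set V) f M e :
  compact K -> continuous f -> (forall y, `|f y| <= M) -> 0 < e ->
  exists g, [/\ A g, forall y, `|g y| <= M + e & forall y, K y -> `|f y - g y| <= e].
Proof.
move=> cK cf fM e0.
have e2 : 0 < e / 2 by rewrite divr_gt0.
have fle y : f y <= M by rewrite (le_trans (ler_norm _))// fM.
have interp x y : exists g, [/\ clA g, g x = f x & g y = f y].
  have [->|xy] := eqVneq x y.
    by exists (fun=> f y); split=> //; exact: unif_closure_cst.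
  have [g Ag gxy] := salg_separates HA xy.
  exists (fun z => f x + (f y - f x) / (g y - g x) * (g z + - g x)); split.
  - apply: unif_closureD; first exact: unif_closure_cst.
    apply/unif_closureZ/unif_closureD; first exact: sub_unif_closure.
    exact: unif_closure_cst.
  - by rewrite subrr mulr0 addr0.
  - by rewrite divfK ?subr_eq0 1?eq_sym// addrC subrK.
have above x : exists g, [/\ clA g, g x = f x & forall y, K y -> f y - e / 2 < g y].
  have [|||||g [cg gx] gK] := @compact_directed_above K
    [set g | clA g /\ g x = f x] (fun y => f y - e / 2) cK.
  - by move=> y; apply: cvgB; [exact: cf|exact: cvg_cst].
  - by exists (fun=> f x); split=> //; exact: unif_closure_cst.
  - by move=> g [cg _]; exact: unif_closure_continuous.
  - move=> g h [cg gx] [ch hx]; split; last by rewrite gx hx maxxx.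
    exact: unif_closure_max.
  - move=> y Ky; have [g [cg gx gy]] := interp x y.
    by exists g => //; rewrite gy ltrBlDr ltrDl.
  - by exists g.
(* The pass with minima is the same statement for the opposite functions; the constant M shows that
   the family is not empty. *)
have [|||||_ [g [cg gl] <-] gu] := @compact_directed_above K
  [set h | exists2 g, clA g /\ (forall y, K y -> f y - e / 2 < g y) & (fun y => - g y) = h]
  (fun y => - f y - e / 2) cK.
- by move=> y; apply: cvgB; [apply: cvgN; exact: cf|exact: cvg_cst].
- exists (fun=> - M), (fun=> M) => //; split=> [|y _]; first exact: unif_closure_cst.
  by rewrite ltrBlDr (le_lt_trans (fle y))// ltrDl.
- by move=> _ [g [cg _] <-]; apply/unif_closure_continuous/unif_closureN.
- move=> _ _ [g [cg gl] <-] [h [ch hl] <-].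
  exists (fun y => Num.min (g y) (h y)); last by apply/funext => y; rewrite oppr_min.
  split=> [|y Ky]; first exact: unif_closure_min.
  by rewrite lt_min gl// hl.
- move=> x Kx; have [g [cg gx gl]] := above x.
  by exists (fun y => - g y); [exists g|rewrite gx ltrBlDr ltrDl].
(* Clipping stays in the closure, does not worsen the approximation on K because f itself lies in
   [-M, M], and provides the bound off K. *)
pose g' y := Num.max (- M) (Num.min M (g y)).
have cg' : clA g'.
  apply: unif_closure_max; first exact: unif_closure_cst.
  by apply: unif_closure_min => //; exact: unif_closure_cst.
have g'M y : `|g' y| <= M.
  have M0 := le_trans (normr_ge0 _) (fM y); rewrite ler_norml /g'.
  rewrite le_max lexx/= ge_max ge_min lexx/= andbT.
  lra.
have g'K y : K y -> `|f y - g' y| <= e / 2.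
  move=> Ky; have := gl y Ky; have := gu y Ky; have := fM y.
  have M0 := le_trans (normr_ge0 _) (fM y).
  rewrite !ler_norml /g' => /andP[? ?] ? ?.
  by case: (leP M (g y)) => ?; [case: (leP (- M) M)|case: (leP (- M) (g y))] => ?;
    apply/andP; split; lra.
have [h Ah g'h] := cg' _ e2; exists h; split=> // [y|y Ky].
  have -> : h y = g' y - (g' y - h y) by ring.
  rewrite (le_trans (ler_normB _ _))//; have := g'M y; have := g'h y; lra.
have -> : f y - h y = (f y - g' y) + (g' y - h y) by ring.
rewrite (le_trans (ler_normD _ _))//; have := g'K y Ky; have := g'h y; lra.
Qed.

End stone_weierstrass.

Section continuous_real_functions.
Context {R : realType} {V : topologicalType}.
Implicit Types f g : V -> R.

Lemma continuous_fcst (c : R) : continuous (fun _ : V => c).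
Proof. by move=> x; exact: cvg_cst. Qed.

Lemma continuous_add f g : continuous f -> continuous g ->
  continuous (fun x => f x + g x).
Proof. by move=> cf cg x; apply: cvgD; [exact: cf|exact: cg]. Qed.

Lemma continuous_mul f g : continuous f -> continuous g ->
  continuous (fun x => f x * g x).
Proof. by move=> cf cg x; apply: cvgM; [exact: cf|exact: cg]. Qed.

Lemma continuous_fcomp f (h : R -> R) : continuous f -> continuous h ->
  continuous (fun x => h (f x)).
Proof. by move=> cf ch x; apply: continuous_comp; [exact: cf|exact: ch]. Qed.

Lemma continuous_fsum (I : Type) (s : seq I) (Q : pred I) (f : I -> V -> R) :
  (forall i, continuous (f i)) -> continuous (fun x => \sum_(i <- s | Q i) f i x).
Proof.
move=> cf x; apply: (@cvg_big _ _ +%R) => [|k _]; first exact: add_continuous.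
exact: cf.
Qed.

End continuous_real_functions.

Section trigonometric_polynomials.
Context {R : realType} {p : nat}.
Local Notation Vec := ('rV[R]_p : topologicalType).
Implicit Types (f g : 'rV[R]_p -> R) (y : 'rV[R]_p).

(** The free phase a lets cosines alone generate the real trigonometric polynomials. Generation by
    sums and multiples makes convergence of expectations follow from the generators; closure under
    products is proved separately. *)
Inductive trigpoly : ('rV[R]_p -> R) -> Prop :=
| trigpoly_cos (t : 'I_p -> R) (a : R) :
    trigpoly (fun y => cos (\sum_k t k * y 0 k + a))
| trigpolyD f g : trigpoly f -> trigpoly g -> trigpoly (fun y => f y + g y)
| trigpolyZ c f : trigpoly f -> trigpoly (fun y => c * f y).

Lemma trigpolyM f g : trigpoly f -> trigpoly g -> trigpoly (fun y => f y * g y).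
Proof.
move=> + tg; elim=> {f} [t a|f1 f2 _ IH1 _ IH2|c f _ IH].
- elim: tg => {g} [s b|g1 g2 _ IH1 _ IH2|c g _ IH].
  + have -> : (fun y => cos (\sum_k t k * y 0 k + a) * cos (\sum_k s k * y 0 k + b)) =
      fun y => 2^-1 * (cos (\sum_k (t k + s k) * y 0 k + (a + b)) +
                       cos (\sum_k (t k - s k) * y 0 k + (a - b))).
      apply/funext => y.
      have -> : \sum_k (t k + s k) * y 0 k + (a + b) =
          (\sum_k t k * y 0 k + a) + (\sum_k s k * y 0 k + b).
        by under eq_bigr do rewrite mulrDl; rewrite big_split/=; ring.
      have -> : \sum_k (t k - s k) * y 0 k + (a - b) =
          (\sum_k t k * y 0 k + a) - (\sum_k s k * y 0 k + b).
        by under eq_bigr do rewrite mulrBl; rewrite sumrB; ring.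
      move: (\sum_k t k * y 0 k + a) (\sum_k s k * y 0 k + b) => A B.
      by rewrite cosD cosB; field.
    by apply/trigpolyZ/trigpolyD; exact: trigpoly_cos.
  + by under eq_fun do rewrite mulrDr; exact: trigpolyD.
  + by under eq_fun do rewrite mulrCA; exact: trigpolyZ.
- by under eq_fun do rewrite mulrDl; exact: trigpolyD.
- by under eq_fun do rewrite -mulrA; exact: trigpolyZ.
Qed.

Lemma continuous_coord k : continuous (fun y : Vec => (y : 'rV[R]_p) 0 k).
Proof. exact: coord_continuous. Qed.

Lemma continuous_lin (t : 'I_p -> R) (a : R) :
  continuous (fun y : Vec => \sum_k t k * (y : 'rV[R]_p) 0 k + a).
Proof.
apply: continuous_add; last exact: continuous_fcst.
apply: continuous_fsum => k; apply: continuous_mul; first exact: continuous_fcst.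
exact: continuous_coord.
Qed.

Lemma trigpoly_continuous f : trigpoly f -> continuous (f : Vec -> R).
Proof.
elim=> {f} [t a|f g _ cf _ cg|c f _ cf].
- by apply: (@continuous_fcomp _ Vec _ (@cos R)); [exact: continuous_lin|exact: continuous_cos].
- exact: (@continuous_add _ Vec).
- by apply: (@continuous_mul _ Vec) => //; exact: continuous_fcst.
Qed.

Lemma trigpoly_bounded f : trigpoly f -> exists M, forall y, `|f y| <= M.
Proof.
elim=> {f} [t a|f g _ [M fM] _ [N gN]|c f _ [M fM]].
- by exists 1 => y; rewrite ler_norml cos_geN1 cos_le1.
- by exists (M + N) => y; rewrite (le_trans (ler_normD _ _))// lerD.
- by exists (`|c| * M) => y; rewrite normrM ler_wpM2l.
Qed.

Lemma trigpoly_cst c : trigpoly (fun=> c).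
Proof.
have := trigpolyZ c (trigpoly_cos (fun=> 0) 0).
congr trigpoly; apply/funext => y.
by rewrite big1 ?addr0 ?cos0 ?mulr1// => k _; rewrite mul0r.
Qed.

Lemma trigpoly_separates y z : y != z -> exists2 g, trigpoly g & g y != g z.
Proof.
move=> yz; have [k yzk] : exists k, y 0 k != z 0 k.
  apply/existsP; rewrite -negb_forall; apply: contra yz => /forallP h.
  by apply/eqP/rowP => k; apply/eqP.
(* With this frequency and the phase - s y_k, the cosine is cos 0 = 1 at y and cos pi = -1 at z. *)
pose s := pi / (z 0 k - y 0 k).
exists (fun x => cos (\sum_j (if j == k then s else 0) * x 0 j + (- (s * y 0 k)))).
  exact: trigpoly_cos.
have E x : \sum_j (if j == k then s else 0) * x 0 j = s * x 0 k.
  rewrite (bigD1 k)//= eqxx big1 ?addr0// => j /negbTE ->; exact: mul0r.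
rewrite !E subrr cos0 -mulrBr divfK ?cospi; last by rewrite subr_eq0 eq_sym.
by rewrite -subr_eq0 opprK gt_eqF.
Qed.

Lemma trigpoly_algebra : separating_algebra trigpoly.
Proof.
split; [exact: trigpoly_cst|exact: trigpolyD|exact: trigpolyM
  |exact: trigpoly_bounded|exact: trigpoly_continuous|exact: trigpoly_separates].
Qed.

Definition cube (K : R) : set 'rV[R]_p := [set y | forall k, `[- K, K]%classic (y 0 k)].

Lemma compact_cube K : compact (cube K).
Proof. by apply: (@rV_compact _ _ (fun=> `[- K, K]%classic)) => k; exact: segment_compact. Qed.

(** A substitute for the indicator of the complement of [cube K]: it is 1 there, decreases in K, and
    its expectation is bounded by second moments without Chebyshev's inequality as a separate
    step. *)
Definition cutoff (K : R) y : R := Num.min 1 ((\sum_k y 0 k ^+ 2) / K ^+ 2).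

Lemma cutoff_ge0 K y : 0 <= cutoff K y.
Proof.
rewrite le_min ler01/= divr_ge0 ?sqr_ge0//.
by apply: sumr_ge0 => k _; exact: sqr_ge0.
Qed.

Lemma cutoff_le1 K y : cutoff K y <= 1. Proof. by rewrite ge_min lexx. Qed.

Lemma cutoff_le K y : cutoff K y <= (\sum_k y 0 k ^+ 2) / K ^+ 2.
Proof. by rewrite ge_min lexx orbT. Qed.

Lemma cutoff_anti K L y : 0 < K -> K <= L -> cutoff L y <= cutoff K y.
Proof.
move=> K0 KL; rewrite le_min cutoff_le1/= (le_trans (cutoff_le _ _))//.
rewrite ler_wpM2l//; first by apply: sumr_ge0 => k _; exact: sqr_ge0.
have L0 := lt_le_trans K0 KL.
rewrite lef_pV2 ?posrE ?exprn_gt0//; apply: lerXn2r => //; rewrite nnegrE ltW//.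
Qed.

Lemma cutoff_off_cube K y : 0 < K -> ~ cube K y -> cutoff K y = 1.
Proof.
move=> K0 /existsNP[k]; rewrite /= in_itv/= -ler_norml => /negP; rewrite -ltNge => Ky.
apply/eqP; rewrite eq_le cutoff_le1/= le_min lexx/= ler_pdivlMr ?exprn_gt0// mul1r.
rewrite (bigD1 k)//= (@le_trans _ _ (y 0 k ^+ 2))//.
  rewrite -[leRHS]real_normK ?num_real//; apply: lerXn2r; rewrite ?nnegrE//; exact: ltW.
by rewrite lerDl; apply: sumr_ge0 => j _; exact: sqr_ge0.
Qed.

Lemma le_cutoff (h : 'rV[R]_p -> R) K e C : 0 < K -> 0 <= e -> 0 <= C ->
  (forall y, `|h y| <= C) -> (forall y, cube K y -> `|h y| <= e) ->
  forall y, `|h y| <= e + C * cutoff K y.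
Proof.
move=> K0 e0 C0 hC he y; have [/he hy|/(cutoff_off_cube K0) ->] := pselect (cube K y).
  by rewrite (le_trans hy)// lerDl mulr_ge0// cutoff_ge0.
by rewrite mulr1 (le_trans (hC y))// lerDr.
Qed.

Section random_vector.
Context {d} {T : measurableType d} (P : probability T R) (Y : T -> 'rV[R]_p).
Hypothesis mY : forall k, measurable_fun setT (fun w => Y w 0 k).

Lemma measurable_lin (t : 'I_p -> R) (a : R) :
  measurable_fun setT (fun w => \sum_k t k * Y w 0 k + a).
Proof.
apply: measurable_funD => //; apply: measurable_sum => k; exact: measurable_funM.
Qed.

Lemma bdd_meas_trigpoly f : trigpoly f -> bdd_meas (fun w => f (Y w)).
Proof.
elim=> {f} [t a|f g _ bf _ bg|c f _ bf].
- exact/bdd_meas_cos/measurable_lin.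
- exact: bdd_measD.
- exact: bdd_measZ.
Qed.

Lemma bdd_meas_cutoff K : bdd_meas (fun w => cutoff K (Y w)).
Proof.
split; last by exists 1 => w; rewrite ger0_norm ?cutoff_ge0 ?cutoff_le1.
apply: measurable_minr => //; apply: measurable_funM => //.
by apply: measurable_sum => k; exact: measurable_funX.
Qed.

(** No moments are assumed: the cutoff tends to 0 pointwise as K grows and is at most 1, so
    dominated convergence applies. *)
Lemma tight_random_vector e : 0 < e -> exists2 K, 0 < K & Ex P (fun w => cutoff K (Y w)) <= e.
Proof.
move=> e0.
have mc n : measurable_fun setT (fun w => (cutoff n.+1%:R (Y w))%:E).
  by apply/measurable_EFinP; exact: (bdd_meas_cutoff _).1.
have m0 : measurable_fun [set: T] (cst 0%E : T -> \bar R) by exact: measurable_cst.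
have cv : {ae P, forall w, [set: T] w ->
    (cutoff n.+1%:R (Y w))%:E @[n --> \oo] --> (cst 0%E : T -> \bar R) w}.
  apply: aeW => w _; apply: cvg_EFin; first exact: nearW.
  have sq : (\sum_k Y w 0 k ^+ 2) / n.+1%:R ^+ 2 @[n --> \oo] --> (0 : R).
    have h : (n.+1%:R^-1 : R) @[n --> \oo] --> (0 : R) by exact: cvg_harmonic.
    set S := \sum_k _.
    have -> : (fun n => S / n.+1%:R ^+ 2) = fun n => S * (n.+1%:R^-1 * n.+1%:R^-1).
      by apply/funext => n; rewrite -invfM.
    have -> : (0 : R) = S * (0 * 0) by rewrite !mulr0.
    by apply: cvgM; [exact: cvg_cst|exact: cvgM].
  apply: (squeeze_cvgr _ (cvg_cst 0) sq).
  by near=> n; rewrite /= cutoff_ge0 cutoff_le.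
have i1 : P.-integrable [set: T] (EFin \o (fun=> 1)).
  exact/bdd_meas_integrable/bdd_meas_cst.
have bd : {ae P, forall w n, [set: T] w ->
    (`|(cutoff n.+1%:R (Y w))%:E| <= (EFin \o (fun=> 1%R)) w)%E}.
  by apply: aeW => w n _; rewrite /= lee_fin ger0_norm ?cutoff_ge0 ?cutoff_le1.
have [_ _] := dominated_convergence measurableT mc m0 cv i1 bd.
rewrite integral0.
have -> : [sequence (\int[P]_w (cutoff n.+1%:R (Y w))%:E)%E]_n =
    fun n => (Ex P (fun w => cutoff n.+1%:R (Y w)))%:E.
  by apply/funext => n /=; rewrite Ex_integral//; exact: bdd_meas_cutoff.
move/fine_cvgP => [_ /cvgrPdist_le /(_ _ e0)[n _ /(_ n (leqnn n)) /= H]].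
exists n.+1%:R => //; rewrite sub0r normrN in H.
exact: le_trans (ler_norm _) H.
Unshelve. all: by end_near. Qed.

End random_vector.
End trigonometric_polynomials.

(** * Levy's continuity theorem for tight sequences *)

Section levy_continuity.
Context {R : realType} {p : nat}.
Local Notation Vec := ('rV[R]_p : topologicalType).
Context {d : nat -> measure_display} {T : forall n, measurableType (d n)}.
Variables (P : forall n, probability (T n) R) (Y : forall n, T n -> 'rV[R]_p).
Hypothesis mY : forall n k, measurable_fun setT (fun w => @Y n w 0 k).

Definition tight := forall e : R, 0 < e -> exists2 K : R, 0 < K &
  \forall n \near \oo, Ex (P n) (fun w => cutoff K (@Y n w)) <= e.

Hypothesis tY : tight.
Context {d0} {T0 : measurableType d0} (P0 : probability T0 R) (G : T0 -> 'rV[R]_p).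
Hypothesis mG : forall k, measurable_fun setT (fun w => G w 0 k).
Hypothesis char_cvg : forall (t : 'I_p -> R) a,
  Ex (P n) (fun w => cos (\sum_k t k * @Y n w 0 k + a)) @[n --> \oo] -->
  Ex P0 (fun w => cos (\sum_k t k * G w 0 k + a)).

Lemma trigpoly_cvg g : trigpoly g ->
  Ex (P n) (fun w => g (@Y n w)) @[n --> \oo] --> Ex P0 (fun w => g (G w)).
Proof.
elim=> {g} [t a|f g tf IHf tg IHg|c f tf IH]; first exact: char_cvg.
- rewrite ExD; [|exact: bdd_meas_trigpoly..].
  have -> : (fun n => Ex (P n) (fun w => f (@Y n w) + g (@Y n w))) =
      fun n => Ex (P n) (fun w => f (@Y n w)) + Ex (P n) (fun w => g (@Y n w)).
    by apply/funext => n; rewrite ExD//; exact: bdd_meas_trigpoly.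
  exact: cvgD.
- rewrite ExZ; last exact: bdd_meas_trigpoly.
  have -> : (fun n => Ex (P n) (fun w => c * f (@Y n w))) =
      fun n => c * Ex (P n) (fun w => f (@Y n w)).
    by apply/funext => n; rewrite ExZ//; exact: bdd_meas_trigpoly.
  by apply: cvgM => //; exact: cvg_cst.
Qed.

(** Replacing f by a trigonometric polynomial g costs dl on the cube and at most C off it, hence dl
    + C E[cutoff]. Tightness makes this at most e/4 both along the sequence and for G, and the
    expectations of g converge by [trigpoly_cvg]. *)
Lemma levy_continuity (f : 'rV[R]_p -> R) M :
  continuous (f : Vec -> R) -> (forall y, `|f y| <= M) ->
  (forall n, measurable_fun setT (fun w => f (@Y n w))) ->
  measurable_fun setT (fun w => f (G w)) ->
  Ex (P n) (fun w => f (@Y n w)) @[n --> \oo] --> Ex P0 (fun w => f (G w)).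
Proof.
move=> cf fM mfY mfG; apply/cvgrPdist_le => e e0.
have M0 : 0 <= M := le_trans (normr_ge0 _) (fM 0).
(* Bounds |f - g| everywhere: |f| <= M, and |g| <= M + dl with dl <= 1. *)
pose C := M + (M + 1).
have C0 : 0 < C by rewrite /C; lra.
pose dl := Num.min 1 (e / 8).
have dl0 : 0 < dl by rewrite lt_min ltr01 divr_gt0.
have dl1 : dl <= 1 by rewrite ge_min lexx.
have dle : dl <= e / 8 by rewrite ge_min lexx orbT.
have ec : 0 < e / 8 / C by rewrite !divr_gt0.
have [K1 K10 tK1] := tY ec.
have [K2 K20 tK2] := tight_random_vector P0 mG ec.
pose K := Num.max K1 K2.
have K0 : 0 < K by rewrite lt_max K10.
have [g [tg gM fg]] := stone_weierstrass_bounded trigpoly_algebra (compact_cube (K := K)) cf fM dl0.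
have fgC y : `|f y - g y| <= dl + C * cutoff K y.
  apply: (@le_cutoff _ _ (fun y => f y - g y)) => //; [exact: ltW|exact: ltW|].
  move=> z; rewrite (le_trans (ler_normB _ _))// /C lerD//.
  by rewrite (le_trans (gM z))// lerD2l.
(* Stated for any random vector, since it serves for [Y n] with L = K1 and for G with L = K2. *)
have approx dd (TT : measurableType dd) (PP : probability TT R) (YY : TT -> 'rV[R]_p) L :
    (forall k, measurable_fun setT (fun w => YY w 0 k)) ->
    measurable_fun setT (fun w => f (YY w)) -> 0 < L -> L <= K ->
    Ex PP (fun w => cutoff L (YY w)) <= e / 8 / C ->
    `|Ex PP (fun w => f (YY w)) - Ex PP (fun w => g (YY w))| <= e / 4.
  move=> mYY mfYY L0 LK EL.
  have bK := bdd_meas_cutoff mYY K.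
  have bC := bdd_measZ C bK.
  apply: (@le_trans _ _ (Ex PP (fun w => dl + C * cutoff K (YY w)))).
    apply: Ex_dist => //; last exact: bdd_measD (bdd_meas_cst _) bC.
      by split=> //; exists M.
    exact: bdd_meas_trigpoly.
  rewrite ExD//; last exact: bdd_meas_cst.
  rewrite Ex_cst ExZ//.
  have h : Ex PP (fun w => cutoff K (YY w)) <= e / 8 / C.
    apply: le_trans EL; apply: Ex_le => //; first exact: bdd_meas_cutoff.
    by move=> w; exact: cutoff_anti.
  have : C * Ex PP (fun w => cutoff K (YY w)) <= e / 8.
    by rewrite mulrC -ler_pdivlMr.
  lra.
have e4 : 0 < e / 4 by rewrite divr_gt0.
have gc := trigpoly_cvg tg.
have aG := approx _ _ P0 G K2 mG mfG K20 _ tK2.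
near=> n.
have a1 : `|Ex (P n) (fun w => f (@Y n w)) - Ex (P n) (fun w => g (@Y n w))| <= e / 4.
  apply: (approx _ _ _ _ K1) => //; first by rewrite le_max lexx.
  by near: n; exact: tK1.
have a2 : `|Ex P0 (fun w => g (G w)) - Ex (P n) (fun w => g (@Y n w))| <= e / 4.
  by near: n; move/cvgrPdist_le : gc => /(_ _ e4).
have a3 : `|Ex P0 (fun w => f (G w)) - Ex P0 (fun w => g (G w))| <= e / 4.
  by apply: aG; rewrite le_max lexx orbT.
move: a1 a2 a3; rewrite !ler_norml => /andP[? ?] /andP[? ?] /andP[? ?].
by apply/andP; split; lra.
Unshelve. all: by end_near. Qed.

End levy_continuity.

(** * Gaussian vectors and chi-square laws *)

Lemma Ex_product {R : realType} {d1 d2} {T1 : measurableType d1} {T2 : measurableType d2}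
    (P1 : probability T1 R) (P2 : probability T2 R) (f : T1 * T2 -> R) :
  bdd_meas f ->
  Ex (product_probability P1 P2) f = Ex P1 (fun x => Ex P2 (fun y => f (x, y))).
Proof.
move=> bf; have fi := bdd_meas_integrable (product_probability P1 P2) bf.
have b2 x : bdd_meas (fun y => f (x, y)).
  exact: bdd_meas_comp (measurable_pair1 x) bf.
rewrite {1}/Ex /Rintegral -(integral12_prod_meas1 fi) /fubini_F.
congr fine; apply: eq_integral => x _; exact: Ex_integral.
Qed.

Section product_laws.
Context {R : realType}.
Local Notation mR := (measurableTypeR R).
Local Notation N01 := (normal_prob 0 1 : probability mR R).

Lemma independent_pair_law {d} {T : measurableType d} (P : probability T R)
    (X Y : T -> mR) (nu1 nu2 : probability mR R) :
  measurable_fun setT X -> measurable_fun setT Y ->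
  (forall A B, measurable A -> measurable B ->
    P (X @^-1` A `&` Y @^-1` B) = (nu1 A * nu2 B)%E) ->
  forall D, measurable D ->
    P ((fun w => (X w, Y w)) @^-1` D) = product_probability nu1 nu2 D.
Proof.
move=> mX mY XY D mD.
have mXY : measurable_fun setT (fun w => (X w, Y w)) by exact: measurable_fun_pair.
pose XYf : {mfun T >-> (mR * mR)%type} := HB.pack (fun w => (X w, Y w))
  (isMeasurableFun.Build _ _ _ _ (fun w => (X w, Y w)) mXY).
apply/esym; apply: (@product_measure_unique _ _ _ _ _ nu1 nu2 (distribution P XYf)).
- by move=> A B mA mB; rewrite -XY.
- exact: mD.
Qed.

(** Induction on q along the recursion of [chi2]: each step multiplies the space by a copy of the
    standard normal law, so the law of the sum of squares follows the definition literally. *)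
Lemma gaussian_exists (q : nat) :
  exists (d : measure_display) (T : measurableType d) (P : probability T R)
    (G : nat -> T -> mR),
  [/\ forall k, measurable_fun setT (G k),
      forall (t : nat -> R) a, Ex P (fun w => cos (\sum_(k < q) t k * (G k w : R) + a)) =
        expR (- ((\sum_(k < q) t k ^+ 2) / 2)) * cos a
    & forall B : set mR, measurable B ->
        P ((fun w => \sum_(k < q) (G k w : R) ^+ 2) @^-1` B) = chi2 q B].
Proof.
elim: q => [|q [d [T [P [G [mG cG lG]]]]]].
  exists _, mR, (chi2 0), (fun _ _ => 0); split=> [k|t a|B mB].
  - exact: measurable_cst.
  - under eq_fun do rewrite big_ord0 add0r.
    by rewrite Ex_cst big_ord0 mul0r oppr0 expR0 mul1r.
  - rewrite /=.
    have -> : (fun w : mR => \sum_(k < 0) (0 : R) ^+ 2) @^-1` B =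
        [set _ : mR | B (0 : R)].
      by apply/seteqP; split => w /=; rewrite big_ord0.
    by rewrite /dirac !indicE; congr ((_ : bool)%:R%:E); apply/idP/idP; rewrite !inE.
(* The new variable takes index 0 and shifts the others, to match sums split at their first term. *)
pose G' k (w : T * mR) : mR := if k is k'.+1 then G k' w.1 else w.2.
have mG' k : measurable_fun setT (G' k).
  by case: k => [|k]; [exact: measurable_snd|exact: (measurableT_comp (mG k) measurable_fst)].
have mS : measurable_fun setT (fun w => \sum_(k < q) (G k w : R) ^+ 2).
  by apply: measurable_sum => k; apply: measurable_funX; exact: mG.
exists _, (T * mR)%type, (product_probability P N01), G'; split=> // [t a|B mB].
  have mlin : measurable_fun [set: T * mR]
      (fun w => \sum_(k < q.+1) t k * (G' k w : R) + a).
    apply: measurable_funD => //; apply: measurable_sum => k.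
    by apply: measurable_funM => //; exact: mG'.
  rewrite Ex_product; last exact: bdd_meas_cos.
  pose v : R := expR (- (t 0 ^+ 2 / 2)).
  have -> : (fun x => Ex N01 (fun y => cos (\sum_(k < q.+1) t k * (G' k (x, y) : R) + a))) =
      fun x => v * cos (\sum_(k < q) t k.+1 * (G k x : R) + a).
    apply/funext => x; under eq_fun do rewrite big_ord_recl/= -addrA.
    exact: Ex_normal_cos.
  rewrite ExZ.
    rewrite (cG (fun k => t k.+1)) mulrA /v -expRD big_ord_recl/=.
    by congr (expR _ * _); under [in RHS]eq_bigr do rewrite /bump/= add1n; field.
  apply: bdd_meas_cos; apply: measurable_funD => //; apply: measurable_sum => k.
  by apply: measurable_funM => //; exact: mG.
rewrite [RHS]/=.
have mAB : measurable (@add_square R @^-1` B) by exact: measurable_funPTI.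
rewrite /distribution /pushforward.
transitivity (product_probability P N01
    ((fun w : T * mR => ((\sum_(k < q) (G k w.1 : R) ^+ 2 : mR), w.2)) @^-1` (@add_square R @^-1` B))).
  congr (_ _); apply/seteqP; split => w /=; rewrite big_ord_recl /add_square/= addrC//.
apply: independent_pair_law => //; first exact: (measurableT_comp mS measurable_fst).
move=> A C mA mC.
have -> : (fun w : T * mR => \sum_(k < q) (G k w.1 : R) ^+ 2 : mR) @^-1` A `&` snd @^-1` C =
    ((fun w => \sum_(k < q) (G k w : R) ^+ 2) @^-1` A) `*` C by [].
rewrite /= /product_probability product_measure1E//; last first.
  by rewrite -[X in measurable X]setTI; exact: mS.
by congr (_ * _)%E; exact: lG.
Qed.

(** Coordinate 0 stands for the projection on theta and the q others for the tangential part. The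
    limits depend only on the former and on the squared norm of the latter, so just that joint law
    is recorded. *)
Lemma gaussian_vector_exists (q : nat) :
  exists (d : measure_display) (T : measurableType d) (P : probability T R)
    (G : T -> 'rV[R]_q.+1),
  [/\ forall k, measurable_fun setT (fun w => G w 0 k),
      forall (t : 'I_q.+1 -> R) a, Ex P (fun w => cos (\sum_k t k * G w 0 k + a)) =
        expR (- ((\sum_k t k ^+ 2) / 2)) * cos a
    & forall D : set (mR * mR), measurable D ->
        P ((fun w => ((\sum_(k < q) G w 0 (lift ord0 k) ^+ 2, G w 0 0) : mR * mR)) @^-1` D) =
        product_probability (chi2 q) N01 D].
Proof.
have [d [T [P [G [mG cG lG]]]]] := gaussian_exists q.
pose G' (w : T * mR) : 'rV[R]_q.+1 := \row_k (if unlift ord0 k is Some j then G j w.1 else w.2 : R).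
have G'0 w : G' w 0 0 = w.2 by rewrite mxE unlift_none.
have G'S w k : G' w 0 (lift ord0 k) = G k w.1 by rewrite mxE liftK.
have mG' k : measurable_fun setT (fun w => G' w 0 k).
  case: (unliftP ord0 k) => [j ->|->].
    by under eq_fun do rewrite G'S; exact: (measurableT_comp (mG j) measurable_fst).
  by under eq_fun do rewrite G'0; exact: measurable_snd.
have mS : measurable_fun setT (fun w => \sum_(k < q) (G k w : R) ^+ 2).
  by apply: measurable_sum => k; apply: measurable_funX; exact: mG.
exists _, (T * mR)%type, (product_probability P N01), G'; split=> // [t a|D mD].
  rewrite Ex_product; last exact/bdd_meas_cos/measurable_lin.
  pose v : R := expR (- (t 0 ^+ 2 / 2)).
  (* [gaussian_exists] takes weights indexed by all natural numbers; those from q on are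
     arbitrary. *)
  pose t' k := if insub k is Some j then t (lift ord0 j) else 0.
  have t'E (k : 'I_q) : t' k = t (lift ord0 k) by rewrite /t' valK.
  have -> : (fun x => Ex N01 (fun y => cos (\sum_k t k * G' (x, y) 0 k + a))) =
      fun x => v * cos (\sum_(k < q) t' k * (G k x : R) + a).
    apply/funext => x.
    have -> : (fun y => cos (\sum_k t k * G' (x, y) 0 k + a)) =
        fun y : mR => cos (t 0 * (y : R) + (\sum_(k < q) t' k * (G k x : R) + a)).
      apply/funext => y; rewrite big_ord_recl G'0 addrA.
      by under eq_bigr do rewrite G'S -t'E.
    exact: Ex_normal_cos.
  rewrite ExZ.
    rewrite (cG t') mulrA /v -expRD big_ord_recl.
    by congr (expR _ * _); under eq_bigr do rewrite t'E; field.
  apply: bdd_meas_cos; apply: measurable_funD => //; apply: measurable_sum => k.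
  by apply: measurable_funM => //; exact: mG.
transitivity (product_probability P N01
    ((fun w : T * mR => ((\sum_(k < q) (G k w.1 : R) ^+ 2 : mR), w.2)) @^-1` D)).
  have E w : (\sum_(k < q) G' w 0 (lift ord0 k) ^+ 2, G' w 0 0) = (\sum_(k < q) (G k w.1 : R) ^+ 2, w.2).
    by rewrite G'0; under eq_bigr do rewrite G'S.
  by congr (_ _); apply/seteqP; split => w /=; rewrite E.
apply: independent_pair_law => //; first exact: (measurableT_comp mS measurable_fst).
move=> A C mA mC.
have -> : (fun w : T * mR => \sum_(k < q) (G k w.1 : R) ^+ 2 : mR) @^-1` A `&` snd @^-1` C =
    ((fun w => \sum_(k < q) (G k w : R) ^+ 2) @^-1` A) `*` C by [].
rewrite /= /product_probability product_measure1E//; last first.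
  by rewrite -[X in measurable X]setTI; exact: mS.
by congr (_ * _)%E; exact: lG.
Qed.

End product_laws.

(** * Tangent-normal coordinates *)

Section euclidean.
Context {R : realType} {p : nat}.
Implicit Types (u v x : 'cV[R]_p) (O : 'M[R]_p).

Lemma dotE u v : dot u v = \sum_k u k 0 * v k 0.
Proof. by rewrite /dot mxE; apply: eq_bigr => k _; rewrite mxE. Qed.

Lemma dotC u v : dot u v = dot v u.
Proof. by rewrite !dotE; apply: eq_bigr => k _; rewrite mulrC. Qed.

Lemma dot_ge0 u : 0 <= dot u u.
Proof. by rewrite dotE; apply: sumr_ge0 => k _; exact: sqr_ge0. Qed.

Lemma mx11_dot u v : u^T *m v = (dot u v)%:M.
Proof. exact: mx11_scalar. Qed.

Lemma dot_orthogonal O u v : orthogonal_mx O -> dot (O *m u) (O *m v) = dot u v.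
Proof. by move=> OO; rewrite /dot trmx_mul -mulmxA (mulmxA O^T) OO mul1mx. Qed.

Lemma orthogonal_mxC O : orthogonal_mx O -> O *m O^T = 1%:M.
Proof. exact: mulmx1C. Qed.

Lemma sphereE u : sphere u <-> dot u u = 1.
Proof.
rewrite /sphere/= /enorm; split=> [h|->]; last exact: sqrtr1.
by rewrite -[LHS]sqr_sqrtr ?dot_ge0// h expr1n.
Qed.

Lemma quadratic_proj u x :
  (x^T *m (1%:M - u *m u^T) *m x) 0 0 = dot x x - dot x u ^+ 2.
Proof.
rewrite mulmxBr mulmxBl mulmx1 mxE [X in _ + X]mxE -/(dot x x); congr (_ - _).
rewrite mulmxA mx11_dot mul_scalar_mx -scalemxAl mxE -/(dot u x) (dotC u x).
by rewrite expr2.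
Qed.

End euclidean.

Section householder.
Context {R : realType} {q : nat}.

(** The reflection in the hyperplane orthogonal to v = theta - e0 exchanges the unit vectors theta
    and e0. *)
Lemma householder_exists (theta : 'cV[R]_q.+1) : sphere theta ->
  exists2 H : 'M[R]_q.+1, orthogonal_mx H & H *m theta = delta_mx 0 0.
Proof.
move=> /sphereE th1; pose e0 : 'cV[R]_q.+1 := delta_mx 0 0; pose v := theta - e0.
have e0E (u : 'cV[R]_q.+1) : dot u e0 = u 0 0.
  rewrite dotE (bigD1 0)//= big1 ?addr0 => [|k k0]; first by rewrite mxE eqxx mulr1.
  by rewrite mxE (negbTE k0) mulr0.
have dB (a b c : 'cV[R]_q.+1) : dot (a - b) c = dot a c - dot b c.
  by rewrite !dotE -sumrB; apply: eq_bigr => k _; rewrite !mxE mulrBl.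
have vt : dot v theta = 1 - theta 0 0 by rewrite dB th1 dotC e0E.
have vv : dot v v = 2 * (1 - theta 0 0).
  rewrite {2}/v dotC dB (dotC theta) vt (dotC e0) e0E /v !mxE eqxx/=; ring.
(* When theta = e0 the reflection is undefined and the identity serves. *)
have [v0|v0] := eqVneq (dot v v) 0.
  exists 1%:M; first by rewrite /orthogonal_mx trmx1 mul1mx.
  rewrite mul1mx; apply/subr0_eq/colP => k; rewrite [RHS]mxE; apply/eqP.
  rewrite -sqrf_eq0; have /eqP := v0.
  rewrite dotE psumr_eq0 => [/allP /(_ k (mem_index_enum _))/= |j _]; last exact: sqr_ge0.
  by rewrite -expr2.
pose c := 2 / dot v v.
have HT : (1%:M - c *: (v *m v^T))^T = 1%:M - c *: (v *m v^T).
  by rewrite linearB/= trmx1 linearZ/= trmx_mul trmxK.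
exists (1%:M - c *: (v *m v^T)).
  rewrite /orthogonal_mx HT mulmxBl mul1mx -[X in _ - _ - X]scalemxAl.
  rewrite mulmxBr mulmx1 -scalemxAr mulmxA -(mulmxA v) mx11_dot mul_mx_scalar.
  rewrite -scalemxAl scalerBr !scalerA.
  have -> : c * (c * dot v v) = 2 * c by rewrite /c; field.
  by rewrite mulr_natl mulr2n scalerDl opprB addrK subrK.
rewrite mulmxBl mul1mx -scalemxAl -mulmxA mx11_dot mul_mx_scalar scalerA vt.
have -> : c * (1 - theta 0 0) = 1.
  rewrite /c vv; field; have := v0; rewrite vv mulf_eq0 negb_or => /andP[_ h].
  by rewrite ?h.
by rewrite scale1r /v opprB addrC subrK.
Qed.

End householder.

(** [eq_law_Ex] asks for a bounded test function, which the identity is not; clipping at a common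
    bound of f1 and f2 changes neither. *)
Lemma eq_real_law_Ex {d1 d2} {T1 : measurableType d1} {T2 : measurableType d2}
    {R : realType} (P1 : probability T1 R) (P2 : probability T2 R)
    (f1 : T1 -> R) (f2 : T2 -> R) :
  bdd_meas f1 -> bdd_meas f2 ->
  (forall B, measurable B -> P1 (f1 @^-1` B) = P2 (f2 @^-1` B)) -> Ex P1 f1 = Ex P2 f2.
Proof.
move=> b1 b2 E; have [m1 [M1 f1M]] := b1; have [m2 [M2 f2M]] := b2.
pose M := Num.max `|M1| `|M2|.
pose clip (x : R) := Num.max (- M) (Num.min M x).
have M0 : 0 <= M by rewrite le_max normr_ge0.
have bclip : bdd_meas clip.
  split; first by apply: measurable_maxr => //; exact: measurable_minr.
  exists M => x; rewrite ler_norml le_max lexx/= ge_max ge_min lexx/= andbT.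
  lra.
have clipE x : `|x| <= M -> clip x = x.
  by rewrite ler_norml => /andP[? ?]; rewrite /clip min_r// max_r.
have -> : f1 = fun w => clip (f1 w).
  apply/funext => w; rewrite clipE// (le_trans (f1M w))// (le_trans (ler_norm _))//.
  by rewrite le_max lexx.
have -> : f2 = fun w => clip (f2 w).
  apply/funext => w; rewrite clipE// (le_trans (f2M w))// (le_trans (ler_norm _))//.
  by rewrite le_max lexx orbT.
exact: eq_law_Ex.
Qed.

Section tangent_normal_coordinates.
Context {R : realType} {q : nat}.
Variables (theta : 'cV[R]_q.+1) (H : 'M[R]_q.+1).
Hypotheses (theta1 : sphere theta) (HO : orthogonal_mx H)
  (Htheta : H *m theta = delta_mx 0 0).
Local Notation bV := (borel_cV R q.+1).

(** The value theta off the sphere makes this map commute with every orthogonal matrix fixing theta,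
    so rotational symmetry passes to the retracted observations. *)
Definition retract (x : 'cV[R]_q.+1) := if dot x x == 1 then x else theta.

(* Coordinates of [x] in an orthonormal basis whose first vector is [theta], made
   bounded by sending the null set off the sphere to [theta]. *)
Definition coordH (k : 'I_q.+1) (x : bV) : R := (H *m retract x) k 0.

Lemma dot_retract x : dot (retract x) (retract x) = 1.
Proof. by rewrite /retract; case: ifPn => [/eqP //|_]; exact/sphereE. Qed.

Lemma coordH_sphere k x : sphere x -> coordH k x = (H *m x) k 0.
Proof. by move=> /sphereE x1; rewrite /coordH /retract x1 eqxx. Qed.

Lemma sum_coordH_sqr x : \sum_k coordH k x ^+ 2 = 1.
Proof.
rewrite -(dot_retract x) -(dot_orthogonal _ _ HO) dotE.
by apply: eq_bigr => k _; rewrite expr2.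
Qed.

Lemma coordH_sqr_le1 k x : coordH k x ^+ 2 <= 1.
Proof.
rewrite -(sum_coordH_sqr x) (bigD1 k)//= lerDl.
by apply: sumr_ge0 => j _; exact: sqr_ge0.
Qed.

Lemma coordH_le1 k x : `|coordH k x| <= 1.
Proof.
have := coordH_sqr_le1 k x; rewrite -[_ ^+ 2]real_normK ?num_real//.
by rewrite expr_le1.
Qed.

Lemma coordH0_dot x : sphere x -> coordH 0 x = dot x theta.
Proof.
move=> sx; rewrite coordH_sphere// -(dot_orthogonal _ _ HO) Htheta dotE.
rewrite (bigD1 0)//= big1 ?addr0 => [|k k0]; last by rewrite [delta_mx _ _ _ _]mxE (negbTE k0) mulr0.
by rewrite [delta_mx _ _ _ _]mxE eqxx mulr1.
Qed.

Lemma measurable_coord_rowmul (M : 'M[R]_q.+1) k :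
  measurable_fun [set: bV] (fun x : bV => (M *m (x : 'cV[R]_q.+1)) k 0).
Proof.
have -> : (fun x : bV => (M *m (x : 'cV[R]_q.+1)) k 0) = dotr (\col_j M k j).
  by apply/funext => x; rewrite /dotr dotE mxE; apply: eq_bigr => j _; rewrite mxE mulrC.
exact: measurable_funPT.
Qed.

Lemma measurable_dot_self : measurable_fun [set: bV] (fun x : bV => dot (x : 'cV[R]_q.+1) x).
Proof.
have -> : (fun x : bV => dot (x : 'cV[R]_q.+1) x) =
    fun x : bV => \sum_k ((1%:M *m (x : 'cV[R]_q.+1)) k 0) ^+ 2.
  by apply/funext => x; rewrite dotE mul1mx.
by apply: measurable_sum => k; apply: measurable_funX; exact: measurable_coord_rowmul.
Qed.

Lemma measurable_sphere : measurable [set x : bV | sphere (x : 'cV[R]_q.+1)].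
Proof.
have -> : [set x : bV | sphere (x : 'cV[R]_q.+1)] =
    (fun x : bV => dot (x : 'cV[R]_q.+1) x) @^-1` [set 1].
  by apply/seteqP; split => x /sphereE.
by rewrite -[X in measurable X]setTI; apply: measurable_dot_self.
Qed.

Lemma bdd_meas_coordH k : bdd_meas (coordH k).
Proof.
split; last by exists 1; exact: coordH_le1.
pose S := [set x : bV | sphere (x : 'cV[R]_q.+1)].
have -> : coordH k = fun x : bV => \1_S x * (H *m (x : 'cV[R]_q.+1)) k 0 +
    (1 - \1_S x) * (H *m theta) k 0.
  apply/funext => x; rewrite indicE; have [xS|xS] := boolP (x \in S).
    by rewrite mul1r subrr mul0r addr0 coordH_sphere//; rewrite inE in xS.
  rewrite mul0r add0r subr0 mul1r /coordH /retract ifN//.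
  by apply: contraNN xS => /eqP /sphereE ?; rewrite inE.
have mS : measurable_fun [set: bV] (\1_S : bV -> R).
  by apply: measurable_indic; exact: measurable_sphere.
apply: measurable_funD; apply: measurable_funM => //.
  exact: measurable_coord_rowmul.
exact: measurable_funB.
Qed.

Section moments.
Context {d} {T : measurableType d} (P : probability T R) (X : {RV P >-> bV}).
Hypothesis symX : rotationally_symmetric theta X.

Let bX (f : bV -> R) : bdd_meas f -> bdd_meas (fun w => f (X w)).
Proof. by move=> bf; exact: (bdd_meas_comp (X := X)). Qed.

(* Conjugating by [H] turns an orthogonal [D] fixing the first basis vector into an
   orthogonal matrix fixing [theta]. *)
Lemma Ex_coord_invariant (D : 'M[R]_q.+1) (f f' : bV -> R) :
  orthogonal_mx D -> D *m delta_mx 0 0 = delta_mx 0 0 :> 'cV[R]_q.+1 ->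
  bdd_meas f -> bdd_meas f' ->
  (forall x x' : bV, (forall k, coordH k x' = (D *m (H *m retract x)) k 0) -> f x' = f' x) ->
  Ex P (fun w => f' (X w)) = Ex P (fun w => f (X w)).
Proof.
move=> DO De bf bf' ff'.
pose O := H^T *m D *m H.
have OO : orthogonal_mx O.
  rewrite /orthogonal_mx /O !trmx_mul trmxK !mulmxA -(mulmxA _ H) orthogonal_mxC// mulmx1.
  by rewrite -(mulmxA _ D^T) DO mulmx1.
have Ot : O *m theta = theta.
  by rewrite /O -mulmxA Htheta -mulmxA De -Htheta mulmxA HO mul1mx.
have fO x : f (O *m (x : 'cV[R]_q.+1) : bV) = f' x.
  apply: ff' => k; rewrite /coordH; congr (_ k 0).
  have -> : retract (O *m (x : 'cV[R]_q.+1)) = O *m retract x.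
    by rewrite /retract dot_orthogonal//; case: ifP.
  by rewrite /O !mulmxA orthogonal_mxC// mul1mx.
apply: eq_real_law_Ex; [exact: bX|exact: bX|move=> B mB].
have := symX.2 O OO Ot (f @^-1` B).
have -> : (fun w => O *m X w : bV) @^-1` (f @^-1` B) = (fun w => f' (X w)) @^-1` B.
  by apply/seteqP; split => w /=; rewrite fO.
apply; rewrite -[X in measurable X]setTI; exact: bf.1.
Qed.

Let flip (j : 'I_q.+1) : 'M[R]_q.+1 := diag_mx (\row_k (if k == j then -1 else 1)).

Let flipE j (y : 'cV[R]_q.+1) k : (flip j *m y) k 0 = (if k == j then -1 else 1) * y k 0.
Proof. by rewrite mul_diag_mx !mxE. Qed.

Let flip_orthogonal j : orthogonal_mx (flip j).
Proof.
rewrite /orthogonal_mx tr_diag_mx; apply/matrixP => a b.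
rewrite mul_diag_mx !mxE; case: (a == b); last by rewrite !mulr0n mulr0.
by rewrite !mulr1n; case: ifP => _; rewrite ?mulrNN mulr1.
Qed.

Let flip_fix j : j != 0 -> flip j *m delta_mx 0 0 = delta_mx 0 0 :> 'cV[R]_q.+1.
Proof.
move=> j0; apply/colP => k; rewrite flipE mxE.
by case: (eqVneq k j) => [->|_]; rewrite ?(negbTE j0)/= ?mulr0// mul1r.
Qed.

(** Changing the sign of the tangential coordinate j is a symmetry, so the expectation equals its
    opposite. The same reflection gives the next lemma, where i may be 0. *)
Lemma Ex_coordH j : j != 0 -> Ex P (fun w => coordH j (X w)) = 0.
Proof.
move=> j0; have bc := bdd_meas_coordH j.
have := @Ex_coord_invariant (flip j) (coordH j) (fun x => -1 * coordH j x)
  (flip_orthogonal j) (flip_fix j0) bc (bdd_measZ (-1) bc).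
rewrite ExZ; last exact: bX.
move=> E; have : -1 * Ex P (fun w => coordH j (X w)) = Ex P (fun w => coordH j (X w)).
  by apply: E => x x' ->; rewrite flipE eqxx.
lra.
Qed.

Lemma Ex_coordHM i j : j != 0 -> i != j ->
  Ex P (fun w => coordH i (X w) * coordH j (X w)) = 0.
Proof.
move=> j0 ij; pose f x := coordH i x * coordH j x.
have bc : bdd_meas f by apply: bdd_measM; exact: bdd_meas_coordH.
have := @Ex_coord_invariant (flip j) f (fun x => -1 * f x)
  (flip_orthogonal j) (flip_fix j0) bc (bdd_measZ (-1) bc).
rewrite ExZ; last exact: bX.
move=> E; have : -1 * Ex P (fun w => f (X w)) = Ex P (fun w => f (X w)).
  by apply: E => x x' xx'; rewrite /f !xx' !flipE eqxx (negbTE ij) /coordH; ring.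
rewrite /f; lra.
Qed.

(** Transposing two tangential coordinates is an orthogonal map that fixes the first basis
    vector. *)
Lemma Ex_coordH_sqr_eq i j : i != 0 -> j != 0 ->
  Ex P (fun w => coordH i (X w) ^+ 2) = Ex P (fun w => coordH j (X w) ^+ 2).
Proof.
move=> i0 j0.
have sE (y : 'cV[R]_q.+1) k : (tperm_mx i j *m y) k 0 = y (tperm i j k) 0.
  by rewrite -xrowE mxE.
apply: (@Ex_coord_invariant (tperm_mx i j) (fun x => coordH j x ^+ 2)
  (fun x => coordH i x ^+ 2)).
- by rewrite /orthogonal_mx tr_perm_mx -perm_mxM mulVg perm_mx1.
- apply/colP => k; rewrite sE !mxE; congr ((_ && _)%:R).
  apply/eqP/eqP => [h|->]; last by rewrite tpermD// eq_sym.
  by rewrite -[k](tpermK i j) h tpermD// eq_sym.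
- by apply: bdd_measX; exact: bdd_meas_coordH.
- by apply: bdd_measX; exact: bdd_meas_coordH.
- by move=> x x' xx'; rewrite xx' sE tpermR.
Qed.

Lemma Ex_coordH_sqr j : j != 0 ->
  Ex P (fun w => coordH j (X w) ^+ 2) * q%:R = 1 - Ex P (fun w => coordH 0 (X w) ^+ 2).
Proof.
move=> j0.
have b2 k : bdd_meas (fun w => coordH k (X w) ^+ 2).
  apply: (bX (f := fun x => coordH k x ^+ 2)); apply: bdd_measX; exact: bdd_meas_coordH.
have E : Ex P (fun w => \sum_k coordH k (X w) ^+ 2) = 1.
  by under eq_fun do rewrite sum_coordH_sqr; exact: Ex_cst.
rewrite Ex_sum// big_ord_recl in E.
rewrite -[X in _ = X - _]E addrAC subrr add0r.
under eq_bigr => k _ do rewrite (@Ex_coordH_sqr_eq (lift ord0 k) j)//.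
by rewrite sumr_const card_ord mulr_natr.
Qed.

End moments.
End tangent_normal_coordinates.

(** * Limits of functions of the standardized sums *)

Section slutsky.
Context {R : realType} {p : nat} {U : topologicalType}.
Local Notation Vec := ('rV[R]_p : topologicalType).
Context {d : nat -> measure_display} {T : forall n, measurableType (d n)}.
Variables (P : forall n, probability (T n) R) (Y : forall n, T n -> 'rV[R]_p).
Hypothesis mY : forall n k, measurable_fun setT (fun w => @Y n w 0 k).
Hypothesis tY : tight P Y.
Variables (D : forall n, T n -> R) (u : nat -> U) (u0 : U).
Hypotheses (bD : forall n, bdd_meas (@D n))
  (D0 : Ex (P n) (fun w => @D n w ^+ 2) @[n --> \oo] --> (0 : R))
  (uu0 : u n @[n --> \oo] --> u0).

(** Continuity is available only where D = 0 and u = u0, and compactness of the cube makes it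
    uniform in y. The difference is at most e/4 when Y is in the cube and |D| < dl; otherwise its
    bound C is paid by C cutoff(Y) or by C D^2/dl^2, both small in expectation. *)
Lemma slutsky (h : Vec * (R * U) -> R) (M : R) :
  (forall y : Vec, {for (y, (0, u0)), continuous h}) -> (forall x, `|h x| <= M) ->
  (forall n, measurable_fun setT (fun w => h (@Y n w, (@D n w, u n)))) ->
  (forall n, measurable_fun setT (fun w => h (@Y n w, (0, u0)))) ->
  Ex (P n) (fun w => h (@Y n w, (@D n w, u n))) -
  Ex (P n) (fun w => h (@Y n w, (0, u0))) @[n --> \oo] --> (0 : R).
Proof.
move=> ch hM mh mh0; apply/cvgrPdist_le => e e0.
have M0 : 0 <= M := le_trans (normr_ge0 _) (hM (0, (0, u0))).
pose C := 2 * M + 1.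
have C0 : 0 < C by rewrite /C; lra.
have e4 : 0 < e / 4 by rewrite divr_gt0.
have eC : 0 < e / 4 / C by rewrite divr_gt0.
have [K K0 tK] := tY eC.
have cov : \forall v \near nbhs ((0, u0) : R * U),
    cube K `<=` (fun y => `|h (y, v) - h (y, (0, u0))| <= e / 4).
  have cK := compact_cube (p := p) (K := K).
  apply: ((compact_near_coveringP _).1 cK (R * U)%type (nbhs ((0, u0) : R * U))
    (fun v y => `|h (y, v) - h (y, (0, u0))| <= e / 4)) => y _.
  (* Both (y', v) and (y', (0, u0)) are compared with (y, (0, u0)), so the tolerance is halved. *)
  have e8 : 0 < e / 8 by rewrite divr_gt0.
  have /cvgrPdist_le /(_ _ e8) [[A B] /= [yA vB] AB] := ch y.
  exists (A, B) => //= -[y' v] /= [Ay Bv].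
  have h1 := AB (y', v) (conj Ay Bv).
  have h2 := AB (y', (0, u0)) (conj Ay (nbhs_singleton vB)).
  move: h1 h2; rewrite /= !ler_norml => /andP[? ?] /andP[? ?].
  by apply/andP; split; lra.
case: cov => -[A B] /= [/nbhs_ballP[dl /= dl0 dlA] Bu] AB.
have Dn : \forall n \near \oo, Ex (P n) (fun w => @D n w ^+ 2) <= e / 4 / C * dl ^+ 2.
  have ed : 0 < e / 4 / C * dl ^+ 2 by rewrite mulr_gt0// exprn_gt0.
  move/cvgrPdist_le : D0 => /(_ _ ed); apply: filterS => n.
  by rewrite sub0r normrN; apply: le_trans; exact: ler_norm.
near=> n; rewrite sub0r normrN.
have un : B (u n) by near: n; exact: uu0.
have bc := bdd_measZ C (bdd_meas_cutoff (@mY n) K).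
have bD2 := bdd_measZ (C / dl ^+ 2) (bdd_measX 2 (@bD n)).
have bcD := bdd_measD bc bD2.
apply: (@le_trans _ _ (Ex (P n) (fun w => e / 4 + (C * cutoff K (@Y n w) + C / dl ^+ 2 * @D n w ^+ 2)))).
  apply: Ex_dist.
  - by split=> //; exists M.
  - by split=> //; exists M.
  - by apply: bdd_measD => //; exact: bdd_meas_cst.
  move=> w; set x := h _; set x0 := h _.
  have xx0 : `|x - x0| <= C.
    by rewrite (le_trans (ler_normB _ _))// /C; have := hM (@Y n w, (@D n w, u n)); have := hM (@Y n w, (0, u0)); rewrite -/x -/x0; lra.
  have c0 : 0 <= C * cutoff K (@Y n w) by rewrite mulr_ge0 ?cutoff_ge0// ltW.
  have d0 : 0 <= C / dl ^+ 2 * @D n w ^+ 2.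
    by rewrite mulr_ge0 ?sqr_ge0// divr_ge0 ?sqr_ge0// ltW.
  have [YK|/(cutoff_off_cube K0) ->] := pselect (cube K (@Y n w)); last lra.
  have [Ddl|Ddl] := ltP `|@D n w| dl.
    have AD : A (@D n w) by apply: dlA; rewrite /ball/= sub0r normrN.
    have := AB (@D n w, u n) (conj AD un) _ YK; rewrite -/x -/x0 /=; lra.
  have : C <= C / dl ^+ 2 * @D n w ^+ 2.
    have h1 : 1 <= @D n w ^+ 2 / dl ^+ 2.
      rewrite ler_pdivlMr ?exprn_gt0// mul1r -[leRHS]real_normK ?num_real//.
      by apply: lerXn2r; rewrite ?nnegrE// ltW.
    by have := ler_wpM2l (ltW C0) h1; rewrite mulr1 mulrCA mulrA (mulrC (_ ^+ 2)) mulrAC.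
  lra.
rewrite ExD//; last exact: bdd_meas_cst.
rewrite Ex_cst ExD// !ExZ; [|exact: bdd_measX|exact: bdd_meas_cutoff].
have t1 : C * Ex (P n) (fun w => cutoff K (@Y n w)) <= e / 4.
  by rewrite mulrC -ler_pdivlMr//; near: n; exact: tK.
have t2 : C / dl ^+ 2 * Ex (P n) (fun w => @D n w ^+ 2) <= e / 4.
  rewrite mulrAC ler_pdivrMr ?exprn_gt0// mulrC -ler_pdivlMr// mulrAC.
  by near: n; exact: Dn.
lra.
Unshelve. all: by end_near. Qed.

End slutsky.

(** For k = 1 and U nonzero this is (1 + Q/U^2)^(-1) Q, with the inner denominator cleared so that
    it is continuous at U = 0 on Q >= 0. *)
Definition sratio {R : realType} (Q U k : R) : R := Q * U ^+ 2 / (U ^+ 2 + k * Q).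

Section sratio.
Context {R : realType}.
Implicit Types Q U k : R.

Lemma sratio_ge0 Q U k : 0 <= Q -> 0 <= k -> 0 <= sratio Q U k.
Proof.
move=> Q0 k0; apply: divr_ge0; first by rewrite mulr_ge0 ?sqr_ge0.
by rewrite addr_ge0 ?sqr_ge0// mulr_ge0.
Qed.

Lemma sratio_le Q U k : 0 <= Q -> 0 <= k -> sratio Q U k <= Q.
Proof.
move=> Q0 k0; have kQ : 0 <= k * Q by rewrite mulr_ge0.
have U2 := sqr_ge0 U.
rewrite /sratio -mulrA ler_piMr//.
have := addr_ge0 U2 kQ; rewrite le_eqVlt => /predU1P[<-|h].
  by rewrite invr0 mulr0 ler01.
by rewrite ler_pdivrMr// mul1r lerDl.
Qed.

(** This homogeneity allows a different normalization of U in each regime. *)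
Lemma sratio_scale v Q U k : v != 0 -> sratio Q (v * U) (v ^+ 2 * k) = sratio Q U k.
Proof.
move=> v0; rewrite /sratio.
have -> : (v * U) ^+ 2 + v ^+ 2 * k * Q = v ^+ 2 * (U ^+ 2 + k * Q) by ring.
have [->|h] := eqVneq (U ^+ 2 + k * Q) 0; first by rewrite mulr0 invr0 !mulr0.
by field; rewrite h v0.
Qed.

(* Continuity at the origin, where the formula is 0/0, comes from [sratio_le]. *)
Lemma sratio_cvg {I : Type} (F : set_system I) {FF : Filter F} (Q U k : I -> R) Q0 U0 k0 :
  Q i @[i --> F] --> Q0 -> U i @[i --> F] --> U0 -> k i @[i --> F] --> k0 ->
  (\forall i \near F, 0 <= Q i) -> (\forall i \near F, 0 <= k i) ->
  0 <= Q0 -> 0 <= k0 -> U0 != 0 \/ 0 < k0 ->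
  sratio (Q i) (U i) (k i) @[i --> F] --> sratio Q0 U0 k0.
Proof.
move=> cQ cU ck Qge kge Q00 k00 Uk.
have cU2 : U i ^+ 2 @[i --> F] --> U0 ^+ 2 by rewrite expr2; under eq_fun do rewrite expr2; exact: cvgM.
have [E|E] := eqVneq (U0 ^+ 2 + k0 * Q0) 0.
  have U00 : U0 = 0.
    have := sqr_ge0 U0; have := mulr_ge0 k00 Q00 => ? ?.
    by apply/eqP; rewrite -sqrf_eq0 eq_le; apply/andP; split => //; lra.
  have k0p : 0 < k0 by case: Uk => //; rewrite U00 eqxx.
  have Q0E : Q0 = 0.
    by move/eqP : E; rewrite U00 expr0n/= add0r mulf_eq0 gt_eqF//= => /eqP.
  rewrite /sratio [X in _ --> X]mulrC Q0E mul0r mulr0.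
  rewrite Q0E in cQ; apply: (squeeze_cvgr _ (cvg_cst 0) cQ).
  by apply: filterS2 Qge kge => i Qi ki; rewrite sratio_ge0//= sratio_le.
rewrite /sratio; apply: cvgM; first exact: cvgM.
by apply: cvgV => //; apply: cvgD => //; exact: cvgM.
Qed.

End sratio.

(** * Standardized sums: characteristic function, tightness, denominator *)

Section standardized_sums.
Context {R : realType} {q : nat} {d : nat -> measure_display}.
Context {T : forall n, measurableType (d n)} (P : forall n, probability (T n) R).
Local Notation bV := (borel_cV R q.+1).
Variables (X : forall n, nat -> {RV (P n) >-> bV}) (theta : 'cV[R]_q.+1) (H : 'M[R]_q.+1).
Hypotheses (theta1 : sphere theta) (HO : orthogonal_mx H)
  (Htheta : H *m theta = delta_mx 0 0).
Hypothesis indepX : forall n, mutually_independent (fun i : 'I_n => X n i).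
Hypothesis sameX : forall n (i j : 'I_n), same_distribution (P n) (X n i) (X n j).
Hypothesis symX : forall n (i : 'I_n), rotationally_symmetric theta (X n i).

Local Notation kap := (coordH theta H).

Definition moment1 n : R := Ex (P n) (fun w => kap 0 (X n 0 w)).
Definition moment2 n : R := Ex (P n) (fun w => kap 0 (X n 0 w) ^+ 2).
Definition var1 n : R := moment2 n - moment1 n ^+ 2.

Variables (sv c0 : R).
Hypotheses (sv0 : 0 < sv) (c00 : 0 < c0).
Hypotheses (cvg_var : var1 n @[n --> \oo] --> sv)
  (cvg_c : 1 - moment2 n @[n --> \oo] --> c0).

(** By [Ex_coordH_sqr] a tangential coordinate has second moment (1 - moment2)/q, whence the factor;
    only coordinate 0 needs centring. *)
Definition std_coord n k (x : bV) : R :=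
  if k == 0 then (Num.sqrt (var1 n))^-1 * (kap 0 x - moment1 n)
  else Num.sqrt (q%:R / (1 - moment2 n)) * kap k x.

Definition std_sum n (w : T n) : 'rV[R]_q.+1 :=
  \row_k ((Num.sqrt n%:R)^-1 * \sum_(i < n) std_coord n k (X n i w)).

Let bkap k : bdd_meas (kap k) := bdd_meas_coordH theta1 HO k.

Let bX n i (f : bV -> R) : bdd_meas f -> bdd_meas (fun w => f (X n i w)).
Proof. by move=> bf; exact: (bdd_meas_comp (X := X n i)). Qed.

Let bZ n k : bdd_meas (std_coord n k).
Proof.
rewrite /std_coord; case: (k == 0); apply: bdd_measZ => //.
by apply: bdd_measB => //; exact: bdd_meas_cst.
Qed.

Let cvg_s : (Num.sqrt (var1 n))^-1 @[n --> \oo] --> (Num.sqrt sv)^-1.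
Proof.
apply: cvgV; first by rewrite gt_eqF// sqrtr_gt0.
by apply: continuous_cvg cvg_var; exact: sqrt_continuous.
Qed.

Let cvg_b : Num.sqrt (q%:R / (1 - moment2 n)) @[n --> \oo] --> Num.sqrt (q%:R / c0).
Proof.
apply: continuous_cvg; first exact: sqrt_continuous.
apply: cvgM; first exact: cvg_cst.
by apply: cvgV => //; rewrite gt_eqF.
Qed.

Let Bn n : R := (Num.sqrt (var1 n))^-1 * 2 + Num.sqrt (q%:R / (1 - moment2 n)).

Let Z_le n k x : `|std_coord n k x| <= Bn n.
Proof.
have s0 : 0 <= (Num.sqrt (var1 n))^-1 by rewrite invr_ge0.
have b0 : 0 <= Num.sqrt (q%:R / (1 - moment2 n)) by [].
have e1 : `|moment1 n| <= 1.
  by apply: Ex_norm_cst; [exact: bX|move=> w; exact: (coordH_le1 theta1 HO)].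
rewrite /std_coord /Bn; case: ifPn => _; rewrite normrM ger0_norm//.
  rewrite -[leLHS]addr0 lerD// ler_wpM2l// (le_trans (ler_normB _ _))//.
  have := coordH_le1 theta1 HO 0 x; lra.
rewrite -[leLHS]add0r lerD ?mulr_ge0// ler_piMr//; exact: (coordH_le1 theta1 HO).
Qed.

Let cvg_B : Bn n @[n --> \oo] --> (Num.sqrt sv)^-1 * 2 + Num.sqrt (q%:R / c0).
Proof. by apply: cvgD => //; apply: cvgM => //; exact: cvg_cst. Qed.

Let near_pos : \forall n \near \oo, [/\ (0 < n)%N, 0 < var1 n & 0 < 1 - moment2 n].
Proof.
near=> n; split; near: n; first by exists 1%N.
- exact: (cvgr_gt _ cvg_var _ sv0).
- exact: (cvgr_gt _ cvg_c _ c00).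
Unshelve. all: by end_near. Qed.

Let ExZ0 n k : (0 < n)%N -> Ex (P n) (fun w => std_coord n k (X n 0 w)) = 0.
Proof.
move=> n0; have sX := symX (Ordinal n0).
rewrite /std_coord; have [_|k0] := eqVneq k 0.
  rewrite ExZ ?ExB; [|exact: bX|exact: bdd_meas_cst|].
    by rewrite Ex_cst subrr mulr0.
  by apply: bdd_measB; [exact: bX|exact: bdd_meas_cst].
by rewrite ExZ ?(Ex_coordH theta1 HO Htheta sX k0) ?mulr0//; exact: bX.
Qed.

Let ExZZ n j k : [/\ (0 < n)%N, 0 < var1 n & 0 < 1 - moment2 n] ->
  Ex (P n) (fun w => std_coord n j (X n 0 w) * std_coord n k (X n 0 w)) = (j == k)%:R.
Proof.
move=> [n0 v0 c0']; have sX := symX (Ordinal n0).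
have bk i : bdd_meas (fun w => kap i (X n 0 w)) by exact: bX.
have offdiag i : i != 0 ->
    Ex (P n) (fun w => std_coord n 0 (X n 0 w) * std_coord n i (X n 0 w)) = 0.
  move=> i0; rewrite /std_coord eqxx (negbTE i0).
  set a := _^-1; set b := Num.sqrt _; set m := moment1 n.
  have -> : (fun w => a * (kap 0 (X n 0 w) - m) * (b * kap i (X n 0 w))) =
     fun w => a * b * (kap 0 (X n 0 w) * kap i (X n 0 w) - m * kap i (X n 0 w)).
    by apply/funext => w; ring.
  rewrite ExZ; last by apply: bdd_measB; [exact: bdd_measM|exact: bdd_measZ].
  rewrite ExB; [|exact: bdd_measM|exact: bdd_measZ].
  rewrite ExZ// (Ex_coordH theta1 HO Htheta sX i0) (Ex_coordHM theta1 HO Htheta sX i0) 1?eq_sym//.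
  by rewrite mulr0 subrr mulr0.
have [->|jk] := eqVneq j k.
  rewrite /std_coord; have [_|k0] := eqVneq k 0.
    set a := _^-1; set m := moment1 n.
    have -> : (fun w => a * (kap 0 (X n 0 w) - m) * (a * (kap 0 (X n 0 w) - m))) =
      fun w => a ^+ 2 * (kap 0 (X n 0 w) ^+ 2 - (2 * m * kap 0 (X n 0 w) - m ^+ 2)).
      by apply/funext => w; ring.
    have b2 : bdd_meas (fun w => 2 * m * kap 0 (X n 0 w) - m ^+ 2).
      by apply: bdd_measB; [exact: bdd_measZ|exact: bdd_meas_cst].
    rewrite ExZ; last by apply: bdd_measB => //; exact: bdd_measX.
    rewrite ExB//; last exact: bdd_measX.
    rewrite ExB; [|exact: bdd_measZ|exact: bdd_meas_cst].
    rewrite ExZ// Ex_cst -/(moment1 n) -/(moment2 n) -/m.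
    have -> : moment2 n - (2 * m * m - m ^+ 2) = var1 n by rewrite /var1 /m; ring.
    by rewrite /a exprVn sqr_sqrtr ?mulVf ?gt_eqF// ltW.
  set b := Num.sqrt _.
  have -> : (fun w => b * kap k (X n 0 w) * (b * kap k (X n 0 w))) =
      fun w => b ^+ 2 * kap k (X n 0 w) ^+ 2 by apply/funext => w; ring.
  rewrite ExZ; last exact: bdd_measX.
  have := Ex_coordH_sqr theta1 HO Htheta sX k0; rewrite -/(moment2 n) => E.
  rewrite /b sqr_sqrtr; last by rewrite divr_ge0// ltW.
  by rewrite mulrAC (mulrC q%:R) E divff// gt_eqF.
have [j0|j0] := eqVneq j 0.
  by rewrite j0 offdiag// -j0 eq_sym.
have [k0|k0] := eqVneq k 0.
  by rewrite k0; under eq_fun do rewrite mulrC; rewrite offdiag.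
rewrite /std_coord (negbTE j0) (negbTE k0); set b := Num.sqrt _.
have -> : (fun w => b * kap j (X n 0 w) * (b * kap k (X n 0 w))) =
    fun w => b ^+ 2 * (kap j (X n 0 w) * kap k (X n 0 w)) by apply/funext => w; ring.
rewrite ExZ; last exact: bdd_measM.
by rewrite (Ex_coordHM theta1 HO Htheta sX k0 jk) mulr0.
Qed.

Lemma measurable_std_sum n k : measurable_fun setT (fun w => @std_sum n w 0 k).
Proof.
under eq_fun do rewrite mxE.
apply: measurable_funM => //; apply: measurable_sum => i.
by have [] := bX n i (bZ n k).
Qed.

Let comb (t : 'I_q.+1 -> R) n (x : bV) : R :=
  (Num.sqrt n%:R)^-1 * \sum_k t k * std_coord n k x.

Let bcomb0 t n : bdd_meas (fun x => \sum_k t k * std_coord n k x).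
Proof. by apply: bdd_meas_sum => k; exact: bdd_measZ. Qed.

(** Cramer-Wold: the linear form is a row sum of [comb], which is centred and of order n^(-1/2). By
    the orthonormality [ExZZ], n times its second moment equals the sum of the t_k^2 for all large
    n. *)
Lemma std_sum_char (t : 'I_q.+1 -> R) a :
  Ex (P n) (fun w => cos (\sum_k t k * @std_sum n w 0 k + a)) @[n --> \oo] -->
  expR (- ((\sum_k t k ^+ 2) / 2)) * cos a.
Proof.
have -> : (fun n => Ex (P n) (fun w => cos (\sum_k t k * @std_sum n w 0 k + a))) =
    fun n => Ex (P n) (fun w => cos (\sum_(i < n) comb t n (X n i w) + a)).
  apply/funext => n; congr Ex; apply/funext => w; congr (cos (_ + a)).
  rewrite /comb -mulr_sumr exchange_big mulr_sumr; apply: eq_bigr => k _.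
  by rewrite mxE -mulr_sumr; ring.
pose S : R := \sum_k `|t k|.
apply: (@char_sum_cvg _ _ _ _ _ P X (comb t) (fun n => (Num.sqrt n%:R)^-1 * (S * Bn n))) => //.
- by move=> n; have [] := bdd_measZ (Num.sqrt n%:R)^-1 (bcomb0 t n).
- apply: nearW => n x; rewrite /comb normrM ger0_norm ?invr_ge0// ler_wpM2l ?invr_ge0//.
  rewrite (le_trans (ler_norm_sum _ _ _))// /S mulr_suml ler_sum// => k _.
  by rewrite normrM ler_wpM2l.
- have -> : (0 : R) = 0 * (S * ((Num.sqrt sv)^-1 * 2 + Num.sqrt (q%:R / c0))) by rewrite mul0r.
  apply: cvgM; last by apply: cvgM => //; exact: cvg_cst.
  have -> : (fun n : nat => (Num.sqrt n%:R)^-1 : R) = fun n => Num.sqrt n%:R^-1.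
    by apply/funext => n; rewrite sqrtrV.
  by rewrite -[X in _ --> X]sqrtr0; apply: continuous_cvg; [exact: sqrt_continuous|exact: cvg_invn].
- near=> n; have [n0 _ _] : [/\ (0 < n)%N, 0 < var1 n & 0 < 1 - moment2 n].
    by near: n; exact: near_pos.
  rewrite /comb ExZ; last exact: (bX n 0%N (bcomb0 t n)).
  rewrite Ex_sum; last by move=> k; apply: bdd_measZ; exact: bX.
  rewrite big1 ?mulr0// => k _; rewrite ExZ ?ExZ0 ?mulr0//; exact: bX.
- apply: cvg_near_cst; near=> n.
  have np : [/\ (0 < n)%N, 0 < var1 n & 0 < 1 - moment2 n].
    by near: n; exact: near_pos.
  have [n0 _ _] := np.
  rewrite /comb; under eq_fun do rewrite exprMn.
  have bZZ j k : bdd_meas (fun w => t j * t k * (std_coord n j (X n 0 w) * std_coord n k (X n 0 w))).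
    by apply: bdd_measZ; apply: bdd_measM; exact: bX.
  rewrite ExZ; last by apply: bdd_measX; exact: (bX n 0%N (bcomb0 t n)).
  rewrite exprVn sqr_sqrtr// mulrA divff ?mul1r ?pnatr_eq0 -?lt0n//.
  have -> : (fun w => (\sum_k t k * std_coord n k (X n 0 w)) ^+ 2) = fun w => \sum_j \sum_k
      t j * t k * (std_coord n j (X n 0 w) * std_coord n k (X n 0 w)).
    apply/funext => w; rewrite expr2 mulr_suml; apply: eq_bigr => j _.
    by rewrite mulr_sumr; apply: eq_bigr => k _; ring.
  rewrite Ex_sum; last by move=> j; apply: bdd_meas_sum.
  apply: eq_bigr => j _; rewrite Ex_sum// (bigD1 j)//= big1 => [|k kj].
    by rewrite ExZ ?ExZZ ?eqxx ?addr0 ?mulr1 ?expr2//; apply: bdd_measM; exact: bX.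
  by rewrite ExZ ?ExZZ 1?eq_sym ?(negbTE kj) ?mulr0//; apply: bdd_measM; exact: bX.
Unshelve. all: by end_near. Qed.

Let same0 n i (f : bV -> R) : bdd_meas f -> (i < n)%N ->
  Ex (P n) (fun w => f (X n i w)) = Ex (P n) (fun w => f (X n 0 w)).
Proof.
move=> bf i_n; have n0 : (0 < n)%N by exact: leq_ltn_trans i_n.
by apply: eq_law_Ex => // B mB; exact: (sameX (Ordinal i_n) (Ordinal n0)).
Qed.

Lemma std_sum_tight : tight P std_sum.
Proof.
(* The second moments add up to q + 1, so (q + 1)/K^2 <= e is needed; it holds because K >= 1 and K
   e >= q + 1. *)
move=> e e0; pose K := 1 + q.+1%:R / e.
have K1 : 1 <= K by rewrite /K lerDl divr_ge0// ltW.
exists K; first lra.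
near=> n; have np : [/\ (0 < n)%N, 0 < var1 n & 0 < 1 - moment2 n].
  by near: n; exact: near_pos.
have [n0 _ _] := np.
have bS k : bdd_meas (fun w => @std_sum n w 0 k).
  under eq_fun do rewrite mxE.
  by apply: bdd_measZ; apply: bdd_meas_sum => i; exact: bX.
have bS2 k : bdd_meas (fun w => @std_sum n w 0 k ^+ 2) by exact: bdd_measX.
have E k : Ex (P n) (fun w => @std_sum n w 0 k ^+ 2) = 1.
  have -> : (fun w => @std_sum n w 0 k ^+ 2) =
      fun w => n%:R^-1 * (\sum_(i < n) std_coord n k (X n i w)) ^+ 2.
    by apply/funext => w; rewrite mxE exprMn exprVn sqr_sqrtr.
  rewrite ExZ; last by apply: bdd_measX; apply: bdd_meas_sum => i; exact: bX.
  rewrite (@Ex_sum_sqr _ _ _ _ _ (P n) n (X n) (@indepX n) _ 1)//.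
  - by rewrite mulr1 mulVf// pnatr_eq0 -lt0n.
  - by move=> i i_n; rewrite same0// ExZ0.
  - move=> i i_n; rewrite (same0 (f := fun x => std_coord n k x ^+ 2))//; last exact: bdd_measX.
    by under eq_fun do rewrite expr2; rewrite ExZZ// eqxx.
apply: (@le_trans _ _ (Ex (P n) (fun w => (K ^+ 2)^-1 * \sum_k @std_sum n w 0 k ^+ 2))).
  apply: Ex_le; first exact/bdd_meas_cutoff/measurable_std_sum.
    by apply: bdd_measZ; exact: bdd_meas_sum.
  by move=> w; rewrite mulrC cutoff_le.
rewrite ExZ; last exact: bdd_meas_sum.
rewrite Ex_sum//; under eq_bigr do rewrite E.
rewrite sumr_const card_ord mulrC ler_pdivrMr ?exprn_gt0//; last lra.
have Ke : q.+1%:R <= K * e by rewrite /K mulrDl divfK ?gt_eqF// mul1r lerDr ltW.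
rewrite (le_trans Ke)// mulrC ler_wpM2l ?(ltW e0)// expr2 ler_peMl//; lra.
Unshelve. all: by end_near. Qed.

(** The denominator of W and S is 1 - moment2 minus this quantity, almost surely. *)
Definition cond_dev n (w : T n) : R :=
  n%:R^-1 * \sum_(i < n) kap 0 (X n i w) ^+ 2 - moment2 n.

Lemma bdd_meas_cond_dev n : bdd_meas (@cond_dev n).
Proof.
apply: bdd_measB; last exact: bdd_meas_cst.
apply: bdd_measZ; apply: bdd_meas_sum => i.
by apply: bdd_measX; exact: bX.
Qed.

(** It is a mean of n independent centred terms with values in [-1, 1], so its second moment is at
    most 1/n. *)
Lemma cond_dev_cvg0 : Ex (P n) (fun w => @cond_dev n w ^+ 2) @[n --> \oo] --> (0 : R).
Proof.
pose f n x := kap 0 x ^+ 2 - moment2 n.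
have b2 : bdd_meas (fun x => kap 0 x ^+ 2) by exact: bdd_measX.
have bf n : bdd_meas (f n) by apply: bdd_measB => //; exact: bdd_meas_cst.
apply: (squeeze_cvgr _ (cvg_cst 0) cvg_invn).
near=> n; have n0 : (0 < n)%N by near: n; exists 1%N.
have nn : n%:R != 0 :> R by rewrite pnatr_eq0 -lt0n.
rewrite Ex_ge0 ?andTb//; last by move=> w; exact: sqr_ge0.
have -> : (fun w => @cond_dev n w ^+ 2) =
    fun w => (n%:R^-1) ^+ 2 * (\sum_(i < n) f n (X n i w)) ^+ 2.
  apply/funext => w; rewrite -exprMn; congr (_ ^+ 2).
  by rewrite /cond_dev /f sumrB sumr_const card_ord mulrBr -[moment2 n *+ n]mulr_natl mulrA mulVf ?mul1r.
rewrite ExZ; last by apply: bdd_measX; apply: bdd_meas_sum => i; exact: bX.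
pose v := Ex (P n) (fun w => f n (X n 0 w) ^+ 2).
rewrite (@Ex_sum_sqr _ _ _ _ _ (P n) n (X n) (@indepX n) _ v)//; last 2 first.
- move=> i i_n; rewrite same0// /f ExB ?Ex_cst ?subrr//; first exact: (bX n 0%N b2).
  exact: bdd_meas_cst.
- by move=> i i_n; rewrite (same0 (f := fun x => f n x ^+ 2))//; exact: bdd_measX.
have v1 : v <= 1.
  rewrite -[leRHS](Ex_cst (P n)); apply: Ex_le; [|exact: bdd_meas_cst|].
    by apply: bdd_measX; exact: bX.
  move=> w; have := coordH_sqr_le1 theta1 HO 0 (X n 0 w).
  have m0 : 0 <= moment2 n by apply: Ex_ge0 => w'; exact: sqr_ge0.
  have m1 : moment2 n <= 1.
    rewrite -[leRHS](Ex_cst (P n)); apply: Ex_le; [exact: (bX n 0%N b2)|exact: bdd_meas_cst|].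
    by move=> w'; exact: (coordH_sqr_le1 theta1 HO).
  have := sqr_ge0 (kap 0 (X n 0 w)); rewrite /f; nra.
have -> : n%:R^-1 ^+ 2 * (n%:R * v) = n%:R^-1 * v by field.
by rewrite ler_piMr// invr_ge0.
Unshelve. all: by end_near. Qed.

End standardized_sums.

Lemma measurable_invr {R : realType} : measurable_fun [set: R] (fun x : R => x^-1).
Proof.
rewrite -(setUv [set (0 : R)]); apply/measurable_funU => //; first exact: measurableC.
split; first exact: measurable_fun_set1.
apply: open_continuous_measurable_fun; first by apply: closed_openC; exact: closed_eq.
by apply/in_setP => x /= /eqP x0; exact: inv_continuous.
Qed.

(** * The statistics as functions of the standardized sums *)

Section statistic.
Context {R : realType} {q : nat}.
Local Notation Vec := ('rV[R]_q.+1 : topologicalType).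
Implicit Types y : 'rV[R]_q.+1.

Definition tail_sqr y : R := \sum_(k < q) y 0 (lift ord0 k) ^+ 2.

Lemma tail_sqr_ge0 y : 0 <= tail_sqr y.
Proof. by apply: sumr_ge0 => k _; exact: sqr_ge0. Qed.

(* The parameters are (a, b, k, c), with c standing for 1 - e_n2. With (lam, mu) = (1, 0)
   and (0, 1) this is W and S as functions of the standardized sums [y] and of the
   fluctuation [D] of the denominator [c - D]. *)
Definition statistic (lam mu : R) (x : Vec * (R * (R * R * R * R))) : R :=
  let y : 'rV[R]_q.+1 := x.1 in
  let: (D, (a, b, k, c)) := x.2 in
  c / (c - D) * (lam * tail_sqr y + mu * sratio (tail_sqr y) (a * y 0 0 + b) (k ^+ 2)).

(** The disjunction covers the two regimes: a y_0 + b = 1 with k = 0 when sqrt n e_n1 diverges, and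
    k > 0 otherwise, where y is unrestricted. *)
Lemma statistic_continuous lam mu (y : Vec) (a b k c : R) : c != 0 ->
  (a * (y : 'rV[R]_q.+1) 0 0 + b != 0 \/ k != 0) ->
  {for (y, (0, (a, b, k, c))), continuous (statistic lam mu)}.
Proof.
move=> c0 abk; pose z0 : R * R * R * R := (a, b, k, c).
pose pt : Vec * (R * (R * R * R * R)) := (y, (0, z0)).
have c1 : x.1 @[x --> pt] --> y by exact: cvg_fst.
have c2 : x.2 @[x --> pt] --> ((0, z0) : R * (R * R * R * R)) by exact: cvg_snd.
have cD : x.2.1 @[x --> pt] --> (0 : R) by apply: cvg_comp c2 _; exact: cvg_fst.
have cz : x.2.2 @[x --> pt] --> z0 by apply: cvg_comp c2 _; exact: cvg_snd.
have cc : x.2.2.2 @[x --> pt] --> c by apply: cvg_comp cz _; exact: cvg_snd.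
have cz3 : x.2.2.1 @[x --> pt] --> (a, b, k) by apply: cvg_comp cz _; exact: cvg_fst.
have ck : x.2.2.1.2 @[x --> pt] --> k by apply: cvg_comp cz3 _; exact: cvg_snd.
have cz2 : x.2.2.1.1 @[x --> pt] --> (a, b) by apply: cvg_comp cz3 _; exact: cvg_fst.
have ca : x.2.2.1.1.1 @[x --> pt] --> a by apply: cvg_comp cz2 _; exact: cvg_fst.
have cb : x.2.2.1.1.2 @[x --> pt] --> b by apply: cvg_comp cz2 _; exact: cvg_snd.
have cy j : (x.1 : 'rV[R]_q.+1) 0 j @[x --> pt] --> (y : 'rV[R]_q.+1) 0 j.
  apply: (@cvg_comp _ _ _ fst (fun y : Vec => (y : 'rV[R]_q.+1) 0 j) _ (nbhs y)) => //.
  exact: coord_continuous.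
have cT : tail_sqr x.1 @[x --> pt] --> tail_sqr y.
  apply: (@cvg_big _ _ +%R) => [|j _]; first exact: add_continuous.
  by rewrite expr2; under eq_fun do rewrite expr2; exact: cvgM.
rewrite /prop_for /continuous_at -/pt.
have -> : statistic lam mu = fun x => x.2.2.2 / (x.2.2.2 - x.2.1) *
    (lam * tail_sqr x.1 + mu * sratio (tail_sqr x.1)
      (x.2.2.1.1.1 * (x.1 : 'rV[R]_q.+1) 0 0 + x.2.2.1.1.2) (x.2.2.1.2 ^+ 2)).
  by apply/funext => -[y' [D [[[a' b'] k'] c']]].
rewrite /=; apply: cvgM.
  apply: cvgM => //; apply: cvgV; first by rewrite subr0.
  exact: cvgB.
apply: cvgD; first by apply: cvgM => //; exact: cvg_cst.
apply: cvgM; first exact: cvg_cst.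
have cU : x.2.2.1.1.1 * (x.1 : 'rV[R]_q.+1) 0 0 + x.2.2.1.1.2 @[x --> pt] -->
    a * (y : 'rV[R]_q.+1) 0 0 + b by apply: cvgD => //; exact: cvgM.
have ck2 : x.2.2.1.2 ^+ 2 @[x --> pt] --> k ^+ 2.
  by rewrite expr2; under eq_fun do rewrite expr2; exact: cvgM.
apply: (sratio_cvg (F := nbhs pt) cT cU ck2).
- by apply: nearW => x; exact: tail_sqr_ge0.
- by apply: nearW => x; exact: sqr_ge0.
- exact: tail_sqr_ge0.
- exact: sqr_ge0.
- by case: abk => [|k0]; [left|right; rewrite exprn_even_gt0].
Qed.

Lemma measurable_statistic {d} {T : measurableType d} (Y : T -> 'rV[R]_q.+1) (D : T -> R)
    lam mu (z : R * R * R * R) :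
  (forall k, measurable_fun setT (fun w => Y w 0 k)) -> measurable_fun setT D ->
  measurable_fun setT (fun w => statistic lam mu (Y w, (D w, z))).
Proof.
case: z => -[[a b] k] c mY mD.
have mT : measurable_fun setT (fun w => tail_sqr (Y w)).
  by apply: measurable_sum => j; exact: measurable_funX.
apply: measurable_funM.
  apply: measurable_funM => //; apply: (measurableT_comp measurable_invr).
  exact: measurable_funB.
apply: measurable_funD; first exact: measurable_funM.
apply: measurable_funM => //; apply: measurable_funM.
  apply: measurable_funM => //; apply: measurable_funX.
  by apply: measurable_funD => //; exact: measurable_funM.
apply: (measurableT_comp measurable_invr); apply: measurable_funD.
  by apply: measurable_funX; apply: measurable_funD => //; exact: measurable_funM.
exact: measurable_funM.
Qed.

End statistic.

Section statistic_limit.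
Context {R : realType} {q : nat} {d : nat -> measure_display}.
Local Notation Vec := ('rV[R]_q.+1 : topologicalType).
Context {T : forall n, measurableType (d n)} (P : forall n, probability (T n) R).
Variables (Y : forall n, T n -> 'rV[R]_q.+1) (D : forall n, T n -> R).
Hypothesis mY : forall n k, measurable_fun setT (fun w => @Y n w 0 k).
Hypothesis tY : tight P Y.
Hypothesis bD : forall n, bdd_meas (@D n).
Hypothesis D0 : Ex (P n) (fun w => @D n w ^+ 2) @[n --> \oo] --> (0 : R).
Context {d0} {T0 : measurableType d0} (P0 : probability T0 R) (G : T0 -> 'rV[R]_q.+1).
Hypothesis mG : forall k, measurable_fun setT (fun w => G w 0 k).
Hypothesis char_cvg : forall (t : 'I_q.+1 -> R) a,
  Ex (P n) (fun w => cos (\sum_k t k * @Y n w 0 k + a)) @[n --> \oo] -->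
  Ex P0 (fun w => cos (\sum_k t k * G w 0 k + a)).

(** [slutsky] freezes the fluctuation at 0 and the parameters at their limits; what is left is a
    fixed bounded continuous function of y, to which [levy_continuity] applies. *)
Lemma statistic_cvg lam mu (f : R -> R) M (a b k c : nat -> R) (a0 b0 k0 c0 : R) :
  continuous f -> (forall x, `|f x| <= M) ->
  a n @[n --> \oo] --> a0 -> b n @[n --> \oo] --> b0 ->
  k n @[n --> \oo] --> k0 -> c n @[n --> \oo] --> c0 -> c0 != 0 ->
  (forall x : R, a0 * x + b0 != 0 \/ k0 != 0) ->
  Ex (P n) (fun w => f (statistic lam mu (@Y n w, (@D n w, (a n, b n, k n, c n))))) @[n --> \oo] -->
  Ex P0 (fun w => f (lam * tail_sqr (G w) +
    mu * sratio (tail_sqr (G w)) (a0 * G w 0 0 + b0) (k0 ^+ 2))).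
Proof.
move=> cf fM ca cb ck cc c00 abk.
pose z n : R * R * R * R := (a n, b n, k n, c n); pose z0 : R * R * R * R := (a0, b0, k0, c0).
have cz : z n @[n --> \oo] --> z0.
  exact: (cvg_pair (cvg_pair (cvg_pair ca cb) ck) cc).
pose h (x : Vec * (R * (R * R * R * R))) := f (statistic lam mu x).
have ch (y : Vec) : {for (y, (0, z0)), continuous h}.
  apply: (@continuous_comp _ _ _ (statistic lam mu) f); last exact: cf.
  exact: statistic_continuous.
have mf : measurable_fun [set: R] f by exact: continuous_measurable_fun.
have mh n zz : measurable_fun setT (fun w => h (@Y n w, (@D n w, zz))).
  apply: (measurableT_comp mf); apply: measurable_statistic; first exact: mY.
  by have [] := @bD n.
have mh0 n : measurable_fun setT (fun w => h (@Y n w, (0, z0))).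
  by apply: (measurableT_comp mf); apply: measurable_statistic; first exact: mY.
have sl := slutsky mY tY bD D0 cz ch (fun x => fM _) (fun n => mh n (z n)) mh0.
have E0 (y : Vec) : h (y, (0, z0)) = f (lam * tail_sqr y +
    mu * sratio (tail_sqr y) (a0 * (y : 'rV[R]_q.+1) 0 0 + b0) (k0 ^+ 2)).
  by rewrite /h /statistic/= subr0 divff// mul1r.
have lv : Ex (P n) (fun w => h (@Y n w, (0, z0))) @[n --> \oo] --> Ex P0 (fun w => h (G w, (0, z0))).
  apply: (levy_continuity mY tY mG char_cvg (f := fun y : 'rV[R]_q.+1 => h (y, (0, z0))) (M := M)).
  - move=> y; have cy : (y', (0, z0)) @[y' --> (y : Vec)] --> ((y, (0, z0)) : Vec * (R * (R * R * R * R))).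
      move=> A [[B C] /= [yB zC] BC]; apply: (@filterS _ (nbhs (y : Vec)) _ B) => // y' By'.
      by apply: BC; split=> //; exact: nbhs_singleton zC.
    exact: (cvg_comp _ _ cy (ch y)).
  - by move=> y; exact: fM.
  - exact: mh0.
  - by apply: (measurableT_comp mf); exact: measurable_statistic.
have -> : (fun w => f (lam * tail_sqr (G w) + mu * sratio (tail_sqr (G w)) (a0 * G w 0 0 + b0) (k0 ^+ 2))) =
    fun w => h (G w, (0, z0)) by apply/funext => w; rewrite E0.
rewrite -[X in _ --> X]add0r.
have -> : (fun n => Ex (P n) (fun w => f (statistic lam mu (@Y n w, (@D n w, (a n, b n, k n, c n)))))) =
  fun n => (Ex (P n) (fun w => h (@Y n w, (@D n w, z n))) - Ex (P n) (fun w => h (@Y n w, (0, z0))))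
    + Ex (P n) (fun w => h (@Y n w, (0, z0))) by apply/funext => n; rewrite subrK.
exact: cvgD.
Qed.

End statistic_limit.

Section statistics_in_coordinates.
Context {R : realType} {q : nat} {d : nat -> measure_display}.
Context {T : forall n, measurableType (d n)} (P : forall n, probability (T n) R).
Local Notation bV := (borel_cV R q.+1).
Variables (X : forall n, nat -> {RV (P n) >-> bV}) (theta : 'cV[R]_q.+1) (H : 'M[R]_q.+1).
Hypotheses (HO : orthogonal_mx H) (Htheta : H *m theta = delta_mx 0 0).

(** Built from the observations themselves rather than from [retract], so that the formulas for W
    and S below hold at every sample point and give measurability. *)
Definition mean_coord n (w : T n) k : R :=
  n%:R^-1 * \sum_(i < n) (H *m (X n i w : 'cV[R]_q.+1)) k 0.

Definition denom n (w : T n) : R :=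
  1 - n%:R^-1 * \sum_(i < n) (H *m (X n i w : 'cV[R]_q.+1)) 0 0 ^+ 2.

Let dot_theta (x : 'cV[R]_q.+1) : dot x theta = (H *m x) 0 0.
Proof.
rewrite -(dot_orthogonal _ _ HO) Htheta dotE (bigD1 0)//= big1 ?addr0 => [|k k0].
  by rewrite [delta_mx _ _ _ _]mxE eqxx mulr1.
by rewrite [delta_mx _ _ _ _]mxE (negbTE k0) mulr0.
Qed.

Let mean_coordE n (w : T n) k :
  (H *m sample_mean n (fun i => X n i w : 'cV[R]_q.+1)) k 0 = mean_coord w k.
Proof.
by rewrite /sample_mean -scalemxAr mxE mulmx_sumr summxE.
Qed.

Let dot_mean n (w : T n) (xbar := sample_mean n (fun i => X n i w : 'cV[R]_q.+1)) :
  dot xbar xbar = mean_coord w 0 ^+ 2 + \sum_(k < q) mean_coord w (lift ord0 k) ^+ 2.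
Proof.
rewrite -(dot_orthogonal _ _ HO) dotE big_ord_recl !mean_coordE expr2; congr (_ + _).
by apply: eq_bigr => k _; rewrite mean_coordE expr2.
Qed.

Let denomE n (w : T n) :
  1 - n%:R^-1 * \sum_(i < n) dot (X n i w : 'cV[R]_q.+1) theta ^+ 2 = denom w.
Proof.
by rewrite /denom; congr (_ - _ * _); apply: eq_bigr => i _; rewrite dot_theta.
Qed.

Lemma Wstat_coord n w : @Wstat _ _ _ _ P theta X n w =
  n%:R * q%:R * (\sum_(k < q) mean_coord w (lift ord0 k) ^+ 2) / denom w.
Proof.
rewrite /Wstat denomE quadratic_proj dot_mean dot_theta mean_coordE.
by rewrite addrAC subrr add0r.
Qed.

Lemma Sstat_coord n w : @Sstat _ _ _ _ P theta X n w =
  n%:R * q%:R * mean_coord w 0 ^+ 2 *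
  ((\sum_(k < q) mean_coord w (lift ord0 k) ^+ 2) /
   (mean_coord w 0 ^+ 2 + \sum_(k < q) mean_coord w (lift ord0 k) ^+ 2)) / denom w.
Proof.
rewrite /Sstat denomE dot_theta mean_coordE; congr (_ * _ / _).
rewrite /spherical_mean; set c := _^-1; set x := sample_mean _ _.
have -> : (c *: x)^T = c *: x^T by apply/matrixP => i j; rewrite !mxE.
rewrite -scalemxAl -scalemxAl -scalemxAr scalerA mxE /c /x.
rewrite quadratic_proj dot_theta mean_coordE.
(* This remains valid when the sample mean is 0, since the inverse of 0 is 0. *)
rewrite -invfM -expr2 /enorm sqr_sqrtr ?dot_ge0// dot_mean.
by rewrite [X in _ * X]addrAC subrr add0r mulrC.
Qed.

Lemma measurable_mean_coord n k : measurable_fun setT (fun w : T n => mean_coord w k).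
Proof.
apply: measurable_funM => //; apply: measurable_sum => i.
exact: (measurableT_comp (measurable_coord_rowmul H k)).
Qed.

Lemma measurable_denom n : measurable_fun setT (@denom n).
Proof.
apply: measurable_funB => //; apply: measurable_funM => //; apply: measurable_sum => i.
by apply: measurable_funX; exact: (measurableT_comp (measurable_coord_rowmul H 0)).
Qed.

Let measurable_tail n :
  measurable_fun setT (fun w : T n => \sum_(k < q) mean_coord w (lift ord0 k) ^+ 2).
Proof.
by apply: measurable_sum => k; apply: measurable_funX; exact: measurable_mean_coord.
Qed.

Lemma measurable_Wstat n : measurable_fun setT (@Wstat _ _ _ _ P theta X n).
Proof.
have -> := funext (@Wstat_coord n).
apply: measurable_funM; last exact: (measurableT_comp measurable_invr (@measurable_denom n)).
by apply: measurable_funM.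
Qed.

Lemma measurable_Sstat n : measurable_fun setT (@Sstat _ _ _ _ P theta X n).
Proof.
have -> := funext (@Sstat_coord n).
have m0 := @measurable_mean_coord n 0.
apply: measurable_funM; last exact: (measurableT_comp measurable_invr (@measurable_denom n)).
apply: measurable_funM; first by apply: measurable_funM => //; exact: measurable_funX.
apply: measurable_funM => //; apply: (measurableT_comp measurable_invr).
by apply: measurable_funD => //; exact: measurable_funX.
Qed.

Hypotheses (q0 : (0 < q)%N) (theta1 : sphere theta).

(** The parameters undo the standardization: a y_0 + b becomes v sqrt n times the mean of coordinate
    0, and k^2 Q becomes v^2 n times the squared norm of the tangential mean. [sratio_scale] then
    removes v. *)
Lemma statistic_WS n (w : T n) lam mu v :
  (forall i, (i < n)%N -> sphere (X n i w : 'cV[R]_q.+1)) -> (0 < n)%N ->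
  0 < var1 X theta H n -> 0 < 1 - moment2 X theta H n -> v != 0 ->
  statistic lam mu (std_sum X theta H w, (cond_dev X theta H w,
    (v * Num.sqrt (var1 X theta H n), v * (Num.sqrt n%:R * moment1 X theta H n),
     v * Num.sqrt ((1 - moment2 X theta H n) / q%:R), 1 - moment2 X theta H n))) =
  lam * Wstat theta X w + mu * Sstat theta X w.
Proof.
move=> sX n0 var0 c0 v0.
have nR : 0 < n%:R :> R by rewrite ltr0n.
have qR : 0 < q%:R :> R by rewrite ltr0n.
set c := 1 - moment2 _ _ _ _ in c0 *; set m1 := moment1 _ _ _ _; set va := var1 _ _ _ _ in var0 *.
have kE k (i : 'I_n) : coordH theta H k (X n i w) = (H *m (X n i w : 'cV[R]_q.+1)) k 0.
  by rewrite coordH_sphere//; exact: sX.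
pose sn := Num.sqrt (n%:R : R).
have sn0 : 0 < sn by rewrite sqrtr_gt0.
have sn2 : sn ^+ 2 = n%:R by rewrite sqr_sqrtr// ltW.
pose M1 := \sum_(k < q) mean_coord w (lift ord0 k) ^+ 2.
have YS (k : 'I_q) : std_sum X theta H w 0 (lift ord0 k) =
    sn * Num.sqrt (q%:R / c) * mean_coord w (lift ord0 k).
  rewrite mxE /std_coord/= -mulr_sumr /mean_coord -/sn -/c -sn2.
  under eq_bigr do rewrite kE.
  by field; rewrite gt_eqF.
have Y0 : std_sum X theta H w 0 0 = (Num.sqrt va)^-1 * (sn * (mean_coord w 0 - m1)).
  rewrite mxE /std_coord eqxx -mulr_sumr /mean_coord -/sn -/m1 -/va.
  rewrite sumrB sumr_const card_ord -[m1 *+ n]mulr_natl -sn2.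
  under eq_bigr do rewrite kE.
  by field; rewrite !gt_eqF ?sqrtr_gt0.
have tE : tail_sqr (std_sum X theta H w) = n%:R * (q%:R / c) * M1.
  rewrite /tail_sqr /M1 mulr_sumr; apply: eq_bigr => k _.
  by rewrite YS !exprMn sn2 sqr_sqrtr// divr_ge0 ?(ltW qR) ?(ltW c0).
have dE : c - cond_dev X theta H w = denom w.
  rewrite /cond_dev /denom /c; under eq_bigr do rewrite kE.
  by ring.
rewrite /statistic -/c /= dE tE Y0 Wstat_coord Sstat_coord -/M1 -/sn.
have UE : v * Num.sqrt va * ((Num.sqrt va)^-1 * (sn * (mean_coord w 0 - m1))) + v * (sn * m1) =
    v * (sn * mean_coord w 0).
  by field; rewrite gt_eqF// sqrtr_gt0.
rewrite UE exprMn sqr_sqrtr ?divr_ge0 ?(ltW qR) ?(ltW c0)// sratio_scale//.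
rewrite /sratio exprMn sn2.
have -> : n%:R * mean_coord w 0 ^+ 2 + c / q%:R * (n%:R * (q%:R / c) * M1) =
    n%:R * (mean_coord w 0 ^+ 2 + M1) by field; rewrite !gt_eqF.
rewrite invfM.
set A := (mean_coord w 0 ^+ 2 + M1)^-1; set B := (denom w)^-1.
by field; rewrite !gt_eqF.
Qed.

End statistics_in_coordinates.

Section limit_of_W_and_S.
Context {R : realType} {q : nat} {d : nat -> measure_display}.
Context {T : forall n, measurableType (d n)} (P : forall n, probability (T n) R).
Local Notation bV := (borel_cV R q.+1).
Local Notation mR := (measurableTypeR R).
Variables (X : forall n, nat -> {RV (P n) >-> bV}) (theta : 'cV[R]_q.+1) (H : 'M[R]_q.+1).
Hypotheses (q0 : (0 < q)%N) (theta1 : sphere theta) (HO : orthogonal_mx H)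
  (Htheta : H *m theta = delta_mx 0 0).
Hypothesis indepX : forall n, mutually_independent (fun i : 'I_n => X n i).
Hypothesis sameX : forall n (i j : 'I_n), same_distribution (P n) (X n i) (X n j).
Hypothesis symX : forall n (i : 'I_n), rotationally_symmetric theta (X n i).
Variables (sv c0 : R).
Hypotheses (sv0 : 0 < sv) (c00 : 0 < c0).
Hypotheses (cvg_var : var1 X theta H n @[n --> \oo] --> sv)
  (cvg_c : 1 - moment2 X theta H n @[n --> \oo] --> c0).

Context {d0} {T0 : measurableType d0} (P0 : probability T0 R) (G : T0 -> 'rV[R]_q.+1).
Hypothesis mG : forall k, measurable_fun setT (fun w => G w 0 k).
Hypothesis char_G : forall (t : 'I_q.+1 -> R) a,
  Ex P0 (fun w => cos (\sum_k t k * G w 0 k + a)) =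
  expR (- ((\sum_k t k ^+ 2) / 2)) * cos a.

Let W := Wstat theta X.
Let S := Sstat theta X.

Lemma ae_sample_sphere n :
  {ae P n, forall w, forall i, (i < n)%N -> sphere (X n i w : 'cV[R]_q.+1)}.
Proof.
apply: ae_foralln => i; have [i_n|i_n] := boolP (i < n)%N; last exact: aeW.
by have [+ _] := symX (Ordinal i_n); apply: filterS => w.
Qed.

(** The scale v is at the caller's disposal: it does not affect W and S, only the limits of the
    parameters. *)
Lemma WS_cvg lam mu (f : R -> R) M (v : nat -> R) (a0 b0 k0 : R) :
  continuous f -> (forall x, `|f x| <= M) ->
  (\forall n \near \oo, v n != 0) ->
  v n * Num.sqrt (var1 X theta H n) @[n --> \oo] --> a0 ->
  v n * (Num.sqrt n%:R * moment1 X theta H n) @[n --> \oo] --> b0 ->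
  v n * Num.sqrt ((1 - moment2 X theta H n) / q%:R) @[n --> \oo] --> k0 ->
  (forall x : R, a0 * x + b0 != 0 \/ k0 != 0) ->
  Ex (P n) (fun w => f (lam * @W n w + mu * @S n w)) @[n --> \oo] -->
  Ex P0 (fun w => f (lam * tail_sqr (G w) +
    mu * sratio (tail_sqr (G w)) (a0 * G w 0 0 + b0) (k0 ^+ 2))).
Proof.
move=> cf fM v0 ca cb ck abk.
have mY := measurable_std_sum X theta1 HO.
have tY := std_sum_tight theta1 HO Htheta indepX sameX symX sv0 c00 cvg_var cvg_c.
have bD := bdd_meas_cond_dev X theta1 HO.
have D0 := cond_dev_cvg0 theta1 HO indepX sameX.
have cc (t : 'I_q.+1 -> R) a :
    Ex (P n) (fun w => cos (\sum_k t k * @std_sum _ _ _ _ P X theta H n w 0 k + a)) @[n --> \oo] -->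
    Ex P0 (fun w => cos (\sum_k t k * G w 0 k + a)).
  rewrite char_G.
  exact: (std_sum_char theta1 HO Htheta indepX sameX symX sv0 c00 cvg_var cvg_c).
have c0n : c0 != 0 by rewrite gt_eqF.
have := statistic_cvg mY tY bD D0 mG cc (lam := lam) (mu := mu) cf fM ca cb ck cvg_c c0n abk.
apply: cvg_trans; apply: near_eq_cvg; near=> n.
have mf : measurable_fun [set: R] f by exact: continuous_measurable_fun.
(* [statistic_WS] requires the whole sample to be on the sphere, which holds almost surely. *)
apply: Ex_ae.
- apply: (measurableT_comp mf); apply: measurable_statistic; first exact: mY.
  by have [] := bD n.
- apply: (measurableT_comp mf); apply: measurable_funD; apply: measurable_funM => //.
    exact: (measurable_Wstat X HO Htheta).
  exact: (measurable_Sstat X HO Htheta).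
- have sX := @ae_sample_sphere n; apply: filterS sX => w sX.
  rewrite statistic_WS//; first by near: n; exists 1%N.
  + by near: n; exact: (cvgr_gt _ cvg_var _ sv0).
  + by near: n; exact: (cvgr_gt _ cvg_c _ c00).
  + by near: n.
Unshelve. all: by end_near. Qed.

End limit_of_W_and_S.

(** * The limits of W and S *)

Section proj_moments.
Context {R : realType} {q : nat} {d : nat -> measure_display}.
Context {T : forall n, measurableType (d n)} {P : forall n, probability (T n) R}.
Local Notation bV := (borel_cV R q.+1).
Variables (X : forall n, nat -> {RV (P n) >-> bV}) (theta : 'cV[R]_q.+1) (H : 'M[R]_q.+1).
Hypotheses (theta1 : sphere theta) (HO : orthogonal_mx H)
  (Htheta : H *m theta = delta_mx 0 0).
Variable n : nat.
Hypothesis sX0 : {ae P n, forall w, sphere (X n 0 w : 'cV[R]_q.+1)}.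

Let bk : bdd_meas (fun w => coordH theta H 0 (X n 0 w)).
Proof. exact: (bdd_meas_comp (X := X n 0)) (bdd_meas_coordH theta1 HO 0). Qed.

Let mX : measurable_fun setT (fun w => dotr theta (X n 0 w)).
Proof. exact: (measurableT_comp (measurable_funPT (dotr theta)) (measurable_funPT (X n 0))). Qed.

Let fine_expectation (Z : T n -> R) (f : T n -> R) : measurable_fun setT Z ->
  measurable_fun setT f -> {ae P n, forall w, Z w = f w} -> fine 'E_(P n)[Z]%E = Ex (P n) f.
Proof. by move=> mZ mf Zf; rewrite unlock; exact: (Ex_ae mZ mf Zf). Qed.

Let ae_dotr : {ae P n, forall w, dotr theta (X n 0 w) = coordH theta H 0 (X n 0 w)}.
Proof.
by apply: filterS sX0 => w sw; rewrite /dotr (coordH0_dot HO Htheta).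
Qed.

Lemma proj_mean_moment1 : proj_mean theta X n = moment1 X theta H n.
Proof. by apply: fine_expectation => //; exact: bk.1. Qed.

Lemma proj_var_var1 : proj_var theta X n = var1 X theta H n.
Proof.
rewrite /proj_var /variance unlock.
have -> : fine 'E_(P n)[dotr theta \o X n 0]%E = moment1 X theta H n.
  exact: proj_mean_moment1.
set m := moment1 X theta H n.
have b2 : bdd_meas (fun w => (coordH theta H 0 (X n 0 w) - m) * (coordH theta H 0 (X n 0 w) - m)).
  by apply: bdd_measM; apply: bdd_measB => //; exact: bdd_meas_cst.
rewrite (fine_expectation _ b2.1).
- have -> : (fun w => (coordH theta H 0 (X n 0 w) - m) * (coordH theta H 0 (X n 0 w) - m)) =
    fun w => coordH theta H 0 (X n 0 w) ^+ 2 - (2 * m * coordH theta H 0 (X n 0 w) - m ^+ 2).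
    by apply/funext => w; ring.
  rewrite ExB; [|exact: bdd_measX|]; last first.
    by apply: bdd_measB; [exact: bdd_measZ|exact: bdd_meas_cst].
  rewrite ExB; [|exact: bdd_measZ|exact: bdd_meas_cst].
  by rewrite ExZ// Ex_cst -/(moment1 X theta H n) -/(moment2 X theta H n) -/m /var1 -/m; ring.
- by apply: measurable_funM; exact: measurable_funB.
- by apply: filterS ae_dotr => w <-.
Qed.

End proj_moments.

Section weak_limits.
Context {R : realType} {d : nat -> measure_display}.
Context {T : forall n, measurableType (d n)} (P : forall n, probability (T n) R).
Local Notation mR := (measurableTypeR R).

Lemma cvg_in_distributionP (Y : forall n, T n -> R) (nu : probability mR R) :
  (forall n, measurable_fun setT (@Y n)) ->
  (forall (f : R -> R) M, continuous f -> (forall x, `|f x| <= M) ->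
    Ex (P n) (fun w => f (@Y n w)) @[n --> \oo] --> Ex nu f) ->
  cvg_in_distribution P Y nu.
Proof.
move=> mY cY f cf [M fM].
have mf : measurable_fun [set: R] f by exact: continuous_measurable_fun.
have bf : @bdd_meas _ mR R f by split; [exact: mf|exists M].
rewrite (Ex_integral nu bf).
have -> : (fun n => 'E_(P n)[f \o @Y n])%E = fun n => (Ex (P n) (fun w => f (@Y n w)))%:E.
  apply/funext => n; rewrite unlock -Ex_integral//; split; last by exists M.
  exact: measurableT_comp.
by apply: cvg_EFin; [exact: nearW|exact: cY fM].
Qed.

Lemma cvg_in_probability0P (Y : forall n, T n -> R) :
  (forall n, measurable_fun setT (@Y n)) ->
  (forall (f : R -> R) M, continuous f -> (forall x, `|f x| <= M) ->
    Ex (P n) (fun w => f (@Y n w)) @[n --> \oo] --> f 0) ->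
  cvg_in_probability0 P Y.
Proof.
move=> mY cY e e0.
(* A bounded continuous function that vanishes at 0 and dominates the indicator of |x| >= e. *)
pose g (x : R) := Num.min 1 (`|x| / e).
have g0 x : 0 <= g x by rewrite le_min ler01/= divr_ge0// ltW.
have g1 x : `|g x| <= 1 by rewrite ger0_norm// ge_min lexx.
have cg : continuous g.
  move=> x; apply: (@continuous_min _ _ (fun=> 1) (fun x => `|x| / e)); first exact: cvg_cst.
  by apply: cvgM; [exact: norm_continuous|exact: cvg_cst].
have := cY g 1 cg g1; rewrite {2}/g normr0 mul0r min_r// => gY.
pose A n := [set w | e <= `|@Y n w|].
have mA n : measurable (A n).
  have -> : A n = (fun w => `|@Y n w|) @^-1` `[e, +oo[.
    by apply/seteqP; split => w; rewrite /A /= in_itv/= andbT.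
  have mn : measurable_fun setT (fun w => `|@Y n w|) by exact: measurableT_comp.
  by rewrite -[X in measurable X]setTI; apply: mn => //; exact: measurable_itv.
have EA : Ex (P n) (\1_(A n)) @[n --> \oo] --> (0 : R).
  apply: (squeeze_cvgr _ (cvg_cst 0) gY); apply: nearW => n.
  rewrite Ex_ge0/=; last by move=> w; rewrite indicE.
  apply: Ex_le; first exact: bdd_meas_indic.
    split; last by exists 1.
    by apply: (measurableT_comp _ (mY n)); exact: continuous_measurable_fun.
  move=> w; rewrite indicE; case: (boolP (w \in A n)) => [|_]; last exact: g0.
  by rewrite inE /A/= /g => ew; rewrite le_min lexx/= ler_pdivlMr// mul1r.
have -> : (fun n => P n [set w | e <= `|@Y n w|]) = fun n => (Ex (P n) (\1_(A n)))%:E.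
  by apply/funext => n; rewrite Ex_indic// fineK// fin_num_measure.
by apply: cvg_EFin; [exact: nearW|exact: EA].
Qed.

End weak_limits.

Section limits.
Context {R : realType} {q : nat} {d : nat -> measure_display}.
Context {T : forall n, measurableType (d n)} (P : forall n, probability (T n) R).
Local Notation bV := (borel_cV R q.+1).
Local Notation mR := (measurableTypeR R).
Local Notation N01 := (normal_prob 0 1 : probability mR R).
Variables (X : forall n, nat -> {RV (P n) >-> bV}) (theta : 'cV[R]_q.+1) (H : 'M[R]_q.+1).
Hypotheses (q0 : (0 < q)%N) (theta1 : sphere theta) (HO : orthogonal_mx H)
  (Htheta : H *m theta = delta_mx 0 0).
Hypothesis indepX : forall n, mutually_independent (fun i : 'I_n => X n i).
Hypothesis sameX : forall n (i j : 'I_n), same_distribution (P n) (X n i) (X n j).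
Hypothesis symX : forall n (i : 'I_n), rotationally_symmetric theta (X n i).
Variables (sv c0 : R).
Hypotheses (sv0 : 0 < sv) (c00 : 0 < c0).
Hypotheses (cvg_var : var1 X theta H n @[n --> \oo] --> sv)
  (cvg_c : 1 - moment2 X theta H n @[n --> \oo] --> c0).

Let W := Wstat theta X.
Let S := Sstat theta X.
Let m n : R := Num.sqrt n%:R * moment1 X theta H n.

Let mW n : measurable_fun setT (@W n).
Proof. exact: (measurable_Wstat X HO Htheta). Qed.

Let mS n : measurable_fun setT (@S n).
Proof. exact: (measurable_Sstat X HO Htheta). Qed.

Let qR : 0 < q%:R :> R. Proof. by rewrite ltr0n. Qed.

Let cvg_sd : Num.sqrt (var1 X theta H n) @[n --> \oo] --> Num.sqrt sv.
Proof. by apply: continuous_cvg cvg_var; exact: sqrt_continuous. Qed.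

Let cvg_k : Num.sqrt ((1 - moment2 X theta H n) / q%:R) @[n --> \oo] --> Num.sqrt (c0 / q%:R).
Proof.
apply: continuous_cvg; first exact: sqrt_continuous.
by apply: cvgM => //; exact: cvg_cst.
Qed.

Lemma tail_sqr_law {d0} {T0 : measurableType d0} (P0 : probability T0 R)
    (G : T0 -> 'rV[R]_q.+1) (f : mR -> R) :
  (forall k, measurable_fun setT (fun w => G w 0 k)) ->
  (forall D : set (mR * mR), measurable D ->
     P0 ((fun w => ((\sum_(k < q) G w 0 (lift ord0 k) ^+ 2, G w 0 0) : mR * mR)) @^-1` D) =
     product_probability (chi2 q) N01 D) ->
  bdd_meas f -> Ex P0 (fun w => f (tail_sqr (G w))) = Ex (chi2 q) f.
Proof.
move=> mG lG bf.
have mT : measurable_fun setT (fun w => tail_sqr (G w) : mR).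
  by apply: measurable_sum => j; apply: measurable_funX; exact: mG.
apply: (eq_law_Ex (X2 := fun x : mR => x)) => // B mB.
have := lG (B `*` setT) (measurableX mB measurableT).
rewrite /product_probability product_measure1E//.
have -> : (fun w => ((\sum_(k < q) G w 0 (lift ord0 k) ^+ 2, G w 0 0) : mR * mR)) @^-1` (B `*` setT) =
    (fun w => tail_sqr (G w)) @^-1` B.
  by apply/seteqP; split => w /= => [[]|].
by move=> ->; rewrite -[RHS]mule1; congr (_ * _)%E; exact: probability_setT.
Qed.

Lemma limits_far_from_uniformity : m n @[n --> \oo] --> +oo ->
  [/\ cvg_in_distribution P W (chi2 q), cvg_in_distribution P S (chi2 q)
    & cvg_in_probability0 P (fun n w => S w - W w)].
Proof.
move=> moo.
have [d0 [T0 [P0 [G [mG cG lG]]]]] := gaussian_vector_exists (R := R) q.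
pose v n := (m n)^-1.
have mpos : \forall n \near \oo, 0 < m n by move/cvgryPgt : moo; exact.
have v0 : v n @[n --> \oo] --> (0 : R) by rewrite gtr0_cvgV0.
have vn0 : \forall n \near \oo, v n != 0.
  by apply: filterS mpos => n mn; rewrite invr_eq0 gt_eqF.
have ca : v n * Num.sqrt (var1 X theta H n) @[n --> \oo] --> (0 : R).
  by rewrite -(mul0r (Num.sqrt sv)); exact: cvgM.
have cb : v n * m n @[n --> \oo] --> (1 : R).
  apply: cvg_near_cst; apply: filterS mpos => n mn.
  by rewrite /v mulVf// gt_eqF.
have ck : v n * Num.sqrt ((1 - moment2 X theta H n) / q%:R) @[n --> \oo] --> (0 : R).
  by rewrite -(mul0r (Num.sqrt (c0 / q%:R))); exact: cvgM.
have nz (x : R) : 0 * x + 1 != 0 :> R \/ (0 : R) != 0.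
  by left; rewrite mul0r add0r oner_eq0.
(* At a = k = 0 and b = 1 the ratio is Q itself, so only lam + mu survives; it is 0 for S - W. *)
have lim lam mu f M (cf : continuous f) (fM : forall x, `|f x| <= M) :
    Ex (P n) (fun w => f (lam * @W n w + mu * @S n w)) @[n --> \oo] -->
    Ex P0 (fun w => f ((lam + mu) * tail_sqr (G w))).
  have := WS_cvg q0 theta1 HO Htheta indepX sameX symX sv0 c00 cvg_var cvg_c mG cG
    (lam := lam) (mu := mu) cf fM vn0 ca cb ck nz.
  have -> // : (fun w => f (lam * tail_sqr (G w) +
      mu * sratio (tail_sqr (G w)) (0 * G w 0 0 + 1) (0 ^+ 2))) =
    fun w => f ((lam + mu) * tail_sqr (G w)).
  apply/funext => w; congr f; rewrite mulrDl; congr (_ + _ * _).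
  by rewrite /sratio mul0r add0r expr1n expr0n/= mul0r addr0 divr1 mulr1.
have chi f M : continuous f -> (forall x, `|f x| <= M) ->
    Ex P0 (fun w => f (tail_sqr (G w))) = Ex (chi2 q) f.
  move=> cf fM; apply: (tail_sqr_law mG lG); split; last by exists M.
  by apply: (@continuous_measurable_fun R f).
split.
- apply: cvg_in_distributionP => // f M cf fM; rewrite -(chi f M)//.
  have := lim 1 0 f M cf fM.
  have -> : (fun n => Ex (P n) (fun w => f (1 * @W n w + 0 * @S n w))) =
      fun n => Ex (P n) (fun w => f (@W n w)).
    by apply/funext => n; congr Ex; apply/funext => w; rewrite mul1r mul0r addr0.
  have -> // : (fun w => f ((1 + 0) * tail_sqr (G w))) = fun w => f (tail_sqr (G w)).
  by apply/funext => w; rewrite addr0 mul1r.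
- apply: cvg_in_distributionP => // f M cf fM; rewrite -(chi f M)//.
  have := lim 0 1 f M cf fM.
  have -> : (fun n => Ex (P n) (fun w => f (0 * @W n w + 1 * @S n w))) =
      fun n => Ex (P n) (fun w => f (@S n w)).
    by apply/funext => n; congr Ex; apply/funext => w; rewrite mul1r mul0r add0r.
  have -> // : (fun w => f ((0 + 1) * tail_sqr (G w))) = fun w => f (tail_sqr (G w)).
  by apply/funext => w; rewrite add0r mul1r.
- apply: cvg_in_probability0P => [n|f M cf fM]; first exact: measurable_funB.
  have := lim (-1) 1 f M cf fM.
  have -> : (fun n => Ex (P n) (fun w => f (-1 * @W n w + 1 * @S n w))) =
      fun n => Ex (P n) (fun w => f (@S n w - @W n w)).
    by apply/funext => n; congr Ex; apply/funext => w; rewrite mul1r mulN1r addrC.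
  have -> : (fun w => f ((-1 + 1) * tail_sqr (G w))) = fun=> f 0.
    by apply/funext => w; rewrite addNr mul0r.
  by rewrite Ex_cst.
Qed.

(** With v = 1 the limits of a, b and k are r, r x and r for r = p^(-1/2), and [sratio_scale]
    cancels the common factor. Hence p enters the limit only through [chi2]. *)
Lemma limits_near_uniformity (x : R) :
  sv = q.+1%:R^-1 -> c0 = 1 - q.+1%:R^-1 ->
  m n @[n --> \oo] --> x / Num.sqrt q.+1%:R ->
  cvg_in_distribution P W (chi2 q) /\
  forall (d1 : measure_display) (T1 : measurableType d1) (P1 : probability T1 R)
    (Z Q : {RV P1 >-> R}),
    has_distribution Z N01 -> has_distribution Q (chi2 q) -> independent2 Z Q ->
    cvg_in_distribution P S (distribution P1 (S_limit x Z Q)).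
Proof.
move=> svE c0E mx.
have [d0 [T0 [P0 [G [mG cG lG]]]]] := gaussian_vector_exists (R := R) q.
have pR : 0 < q.+1%:R :> R by rewrite ltr0n.
pose r : R := (Num.sqrt q.+1%:R)^-1.
have r0 : 0 < r by rewrite invr_gt0 sqrtr_gt0.
have r2 : r ^+ 2 = q.+1%:R^-1 by rewrite exprVn sqr_sqrtr// ltW.
have vn0 : \forall n \near \oo, (1 : R) != 0 by apply: nearW => n; exact: oner_neq0.
have ca : 1 * Num.sqrt (var1 X theta H n) @[n --> \oo] --> r.
  under eq_fun do rewrite mul1r.
  have -> : r = Num.sqrt sv by rewrite svE sqrtrV// ltW.
  exact: cvg_sd.
have cb : 1 * m n @[n --> \oo] --> r * x.
  by under eq_fun do rewrite mul1r; rewrite mulrC.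
have ck : 1 * Num.sqrt ((1 - moment2 X theta H n) / q%:R) @[n --> \oo] --> r.
  under eq_fun do rewrite mul1r.
  have -> : r = Num.sqrt (c0 / q%:R); last exact: cvg_k.
  (* That is (1 - 1/p)/(p - 1) = 1/p: at uniformity the radial and tangential variances agree. *)
  have -> : c0 / q%:R = q.+1%:R^-1.
    by rewrite c0E -natr1; field; rewrite natr1 !gt_eqF.
  by rewrite sqrtrV// ltW.
have nz (y : R) : r * y + r * x != 0 \/ r != 0 by right; rewrite gt_eqF.
have lim lam mu f M (cf : continuous f) (fM : forall x, `|f x| <= M) :
    Ex (P n) (fun w => f (lam * @W n w + mu * @S n w)) @[n --> \oo] -->
    Ex P0 (fun w => f (lam * tail_sqr (G w) + mu * sratio (tail_sqr (G w)) (G w 0 0 + x) 1)).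
  have := WS_cvg q0 theta1 HO Htheta indepX sameX symX sv0 c00 cvg_var cvg_c mG cG
    (lam := lam) (mu := mu) cf fM vn0 ca cb ck nz.
  have -> // : (fun w => f (lam * tail_sqr (G w) +
      mu * sratio (tail_sqr (G w)) (r * G w 0 0 + r * x) (r ^+ 2))) =
    fun w => f (lam * tail_sqr (G w) + mu * sratio (tail_sqr (G w)) (G w 0 0 + x) 1).
  apply/funext => w; congr (f (_ + _ * _)).
  by rewrite -mulrDr -[r ^+ 2]mulr1 sratio_scale// gt_eqF.
split.
  apply: cvg_in_distributionP => // f M cf fM.
  rewrite -(tail_sqr_law mG lG); last first.
    by split; [exact: (@continuous_measurable_fun R f)|exists M].
  have := lim 1 0 f M cf fM.
  have -> : (fun n => Ex (P n) (fun w => f (1 * @W n w + 0 * @S n w))) =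
      fun n => Ex (P n) (fun w => f (@W n w)).
    by apply/funext => n; congr Ex; apply/funext => w; rewrite mul1r mul0r addr0.
  have -> // : (fun w => f (1 * tail_sqr (G w) + 0 * sratio (tail_sqr (G w)) (G w 0 0 + x) 1)) =
      fun w => f (tail_sqr (G w)).
  by apply/funext => w; rewrite mul1r mul0r addr0.
move=> d1 T1 P1 Z Q hZ hQ ZQ.
apply: cvg_in_distributionP => // f M cf fM.
have mf : measurable_fun [set: R] f by exact: continuous_measurable_fun.
pose psi (u : mR * mR) : R := f (sratio (u.1 : R) ((u.2 : R) + x) 1).
have bpsi : bdd_meas psi.
  split; last by exists M => u; exact: fM.
  apply: (measurableT_comp mf).
  have mU : measurable_fun [set: mR * mR] (fun u : mR * mR => (u.2 : R) + x).
    by apply: measurable_funD => //; exact: measurable_snd.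
  have m1 : measurable_fun [set: mR * mR] (fun u : mR * mR => u.1 : R).
    exact: measurable_fst.
  apply: measurable_funM; first by apply: measurable_funM => //; exact: measurable_funX.
  apply: (measurableT_comp measurable_invr); apply: measurable_funD.
    exact: measurable_funX.
  exact: measurable_funM.
have mZ : measurable_fun setT (Z : T1 -> mR) := measurable_funPT Z.
have mQ : measurable_fun setT (Q : T1 -> mR) := measurable_funPT Q.
(* Independence and the marginals determine the joint law, so any pair (Z, Q) on any space may
   replace G. *)
have law : Ex P0 (fun w => psi (tail_sqr (G w), G w 0 0)) = Ex P1 (fun w => psi (Q w, Z w)).
  apply: (eq_law_Ex (X1 := fun w => ((tail_sqr (G w), G w 0 0) : mR * mR))
    (X2 := fun w => ((Q w, Z w) : mR * mR))) => //.
  - apply: measurable_fun_pair; last exact: mG.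
    by apply: measurable_sum => j; apply: measurable_funX; exact: mG.
  - exact: measurable_fun_pair.
  move=> D mD; rewrite lG//; apply/esym; apply: independent_pair_law => // A B mA mB.
  by rewrite setIC ZQ// hZ// hQ// muleC.
have nuE : Ex (distribution P1 (S_limit x Z Q)) f = Ex P1 (fun w => f (S_limit x Z Q w)).
  apply: (eq_law_Ex (X1 := fun y : mR => y) (X2 := S_limit x Z Q)) => //.
  by split; [exact: mf|exists M].
(* Where Z + x = 0, division by zero gives [S_limit] the value Q, while [sratio] gives 0. The normal
   law does not charge this point. *)
have Zx : {ae P1, forall w, Z w + x != 0}.
  exists (Z @^-1` [set - x]); split.
  - exact: measurable_funPTI.
  - rewrite hZ//; have /null_content_dominatesP := normal_prob_dominates (0 : R) 1.
    by apply => //; exact: lebesgue_measure_set1.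
  - move=> w /= /negP; rewrite negbK addr_eq0 => /eqP; exact.
have SE : Ex P1 (fun w => f (S_limit x Z Q w)) = Ex P1 (fun w => psi (Q w, Z w)).
  apply: Ex_ae.
  - by apply: (measurableT_comp (f := f : mR -> R) mf (measurable_funPT (S_limit x Z Q))).
  - by apply: (measurableT_comp bpsi.1); exact: measurable_fun_pair.
  - apply: filterS Zx => w Zx; rewrite /psi /S_limit/= /sratio mul1r; congr f.
    have U0 : (Z w + x) ^+ 2 != 0 by rewrite sqrf_eq0.
    have -> : 1 + Q w / (Z w + x) ^+ 2 = ((Z w + x) ^+ 2 + Q w) / (Z w + x) ^+ 2.
      by rewrite mulrDl divff.
    by rewrite invf_div mulrC mulrA.
rewrite nuE SE -law.
have := lim 0 1 f M cf fM.
  have -> : (fun n => Ex (P n) (fun w => f (0 * @W n w + 1 * @S n w))) =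
      fun n => Ex (P n) (fun w => f (@S n w)).
    by apply/funext => n; congr Ex; apply/funext => w; rewrite mul1r mul0r add0r.
have -> // : (fun w => f (0 * tail_sqr (G w) + 1 * sratio (tail_sqr (G w)) (G w 0 0 + x) 1)) =
    fun w => psi (tail_sqr (G w), G w 0 0).
by apply/funext => w; rewrite mul1r mul0r add0r.
Qed.

End limits.

Lemma cvgy_mul_ge {R : realType} (u w : nat -> R) (c : R) : 0 < c ->
  u n @[n --> \oo] --> +oo -> (\forall n \near \oo, c * u n <= w n) ->
  w n @[n --> \oo] --> +oo.
Proof.
move=> c0 uoo uw; apply/cvgryPge => A.
move/cvgryPge : uoo => /(_ (A / c)) uA; near=> n.
apply: (@le_trans _ _ (c * u n)); last by near: n.
by rewrite mulrC -ler_pdivrMr//; near: n.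
Unshelve. all: by end_near. Qed.

Lemma cvgy_sqrtn {R : realType} : (Num.sqrt n%:R : R) @[n --> \oo] --> +oo.
Proof.
apply/cvgryPge => A; near=> n.
have An : A ^+ 2 <= n%:R by near: n; exact: nbhs_infty_ger.
by rewrite (le_trans (ler_norm A))// -sqrtr_sqr ler_wsqrtr.
Unshelve. all: by end_near. Qed.

Lemma not_cvgy_cvg {R : realType} (u : nat -> R) (l : R) :
  u n @[n --> \oo] --> +oo -> u n @[n --> \oo] --> l -> False.
Proof.
move=> uoo ul; have e0 : (0 : R) < 1 by [].
have [n [h1 h2]] : exists n, l + 2 <= u n /\ `|l - u n| <= 1.
  apply: (@filter_ex _ \oo); apply: filterI; first by move/cvgryPge : uoo; exact.
  by move/cvgrPdist_le : ul => /(_ _ e0).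
by move: h2; rewrite ler_norml => /andP[? ?]; lra.
Qed.

Theorem theorem3p1 (R : realType) (p : nat) (hp : (2 <= p)%N)
    (theta0 : 'cV[R]_p) (htheta0 : sphere theta0)
    (F : nat -> cumulativeBounded (0 : R) (1 : R))
    (hF : forall n, cdf_on_m11 (F n))
    (d : nat -> measure_display) (T : forall n, measurableType (d n))
    (P : forall n, probability (T n) R)
    (X : forall n, nat -> {RV (P n) >-> borel_cV R p})
    (hX : forall n, rotsym_sample n theta0 (F n) (X n))
    (eta : nat -> R) (xi te2 : R) (hxi : 0 < xi) (hte2 : 0 < te2)
    (heta :
      [/\ forall n, eta n = 1,
          one_neighbourhood theta0 X xi te2
        & xi ^+ 2 / p%:R + te2 < 1] \/
      [/\ forall n, 0 <= eta n,
          eta n @[n --> \oo] --> (0 : R)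
        & eta_neighbourhood theta0 X eta xi]) :
  let W := Wstat theta0 X in
  let S := Sstat theta0 X in
  [/\ (forall n, eta n = 1) \/
      (eta n @[n --> \oo] --> (0 : R) /\
       Num.sqrt n%:R * eta n @[n --> \oo] --> +oo) ->
      [/\ cvg_in_distribution P W (chi2 p.-1),
          cvg_in_distribution P S (chi2 p.-1)
        & cvg_in_probability0 P (fun n w => S n w - W n w)],
      Num.sqrt n%:R * eta n @[n --> \oo] --> (1 : R) ->
      cvg_in_distribution P W (chi2 p.-1) /\
      forall (d0 : measure_display) (T0 : measurableType d0)
        (P0 : probability T0 R) (Z Q : {RV P0 >-> R}),
        has_distribution Z (normal_prob 0 1) ->
        has_distribution Q (chi2 p.-1) ->
        independent2 Z Q ->
        cvg_in_distribution P S (distribution P0 (S_limit xi Z Q))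
    & Num.sqrt n%:R * eta n @[n --> \oo] --> (0 : R) ->
      cvg_in_distribution P W (chi2 p.-1) /\
      forall (d0 : measure_display) (T0 : measurableType d0)
        (P0 : probability T0 R) (Z Q : {RV P0 >-> R}),
        has_distribution Z (normal_prob 0 1) ->
        has_distribution Q (chi2 p.-1) ->
        independent2 Z Q ->
        cvg_in_distribution P S (distribution P0 (S_limit 0 Z Q))].

Proof.
(* Writing p = q + 1 makes [p.-1] compute to q and provides the index 0 of the direction theta0. *)
case: p hp theta0 htheta0 X hX heta => [//|q] hq theta0 htheta0 X hX heta W S.
have q0 : (0 < q)%N by [].
have [H HO Ht] := householder_exists htheta0.
have indepX n : mutually_independent (fun i : 'I_n => X n i) by have [] := hX n.
have sameX n (i j : 'I_n) : same_distribution (P n) (X n i) (X n j) by have [] := hX n.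
have symX n (i : 'I_n) : rotationally_symmetric theta0 (X n i).
  by have [_ _ /(_ i)[]] := hX n.
pose e1 := moment1 X theta0 H; pose va := var1 X theta0 H.
have e1E : \forall n \near \oo, proj_mean theta0 X n = e1 n.
  near=> n; apply: proj_mean_moment1 => //.
  have n0 : (0 < n)%N by near: n; exists 1%N.
  by have [] := symX n (Ordinal n0).
have vaE : \forall n \near \oo, proj_var theta0 X n = va n.
  near=> n; apply: proj_var_var1 => //.
  have n0 : (0 < n)%N by near: n; exists 1%N.
  by have [] := symX n (Ordinal n0).
have pR : 0 < q.+1%:R :> R by rewrite ltr0n.
pose sp : R := Num.sqrt q.+1%:R.
have sp0 : 0 < sp by rewrite sqrtr_gt0.
have cvg_c (l sv : R) : e1 n @[n --> \oo] --> l -> va n @[n --> \oo] --> sv ->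
    1 - moment2 X theta0 H n @[n --> \oo] --> 1 - (l ^+ 2 + sv).
  move=> cl cv.
  have -> : (fun n => 1 - moment2 X theta0 H n) = fun n => 1 - (e1 n * e1 n + va n).
    by apply/funext => n; rewrite /va /var1 /e1; ring.
  by apply: cvgB; [exact: cvg_cst|apply: cvgD => //; rewrite expr2; exact: cvgM].
case: heta => [[eta1 [me1 mva] lt1]|[eta0 eta_cvg [small mva]]].
  have ce1 : e1 n @[n --> \oo] --> xi / sp.
    by apply: cvg_trans me1; apply: near_eq_cvg.
  have cva : va n @[n --> \oo] --> te2.
    by apply: cvg_trans mva; apply: near_eq_cvg.
  have cc := cvg_c _ _ ce1 cva.
  (* The inequality between xi, p and te2 enters here. *)
  have c00 : 0 < 1 - ((xi / sp) ^+ 2 + te2).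
    by rewrite subr_gt0 exprMn exprVn sqr_sqrtr// ltW.
  have far := limits_far_from_uniformity q0 htheta0 HO Ht indepX sameX symX hte2 c00 cva cc.
  have moo : Num.sqrt n%:R * e1 n @[n --> \oo] --> +oo.
    have c0 : 0 < xi / sp / 2 by rewrite !divr_gt0.
    apply: (cvgy_mul_ge c0 cvgy_sqrtn); near=> n.
    rewrite mulrC ler_wpM2l// ltW//; near: n; apply: (cvgr_gt _ ce1).
    by rewrite ltr_pdivrMr// ltr_pMr ?divr_gt0// ltr1n.
  (* For eta constant equal to 1 this contradicts the premises of the last two claims. *)
  have etaoo : Num.sqrt n%:R * eta n @[n --> \oo] --> +oo.
    by under eq_fun do rewrite eta1 mulr1; exact: cvgy_sqrtn.
  split=> [_|h|h]; first exact: far.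
    by case: (not_cvgy_cvg etaoo h).
  by case: (not_cvgy_cvg etaoo h).
have cva : va n @[n --> \oo] --> (q.+1%:R^-1 : R).
  by apply: cvg_trans mva; apply: near_eq_cvg.
have small' e : 0 < e -> \forall n \near \oo, `|e1 n - eta n * xi / sp| <= e * eta n.
  move=> e0; move/eqoP : small => /(_ _ e0) h.
  near=> n; have -> : e1 n = proj_mean theta0 X n by apply/esym; near: n.
  by rewrite -[X in e * X]ger0_norm//; near: n.
(* The error o(eta_n) on the mean, multiplied by sqrt n, is o(sqrt n eta_n), hence negligible as
   long as sqrt n eta_n is bounded, here by K. *)
have key (l : R) : Num.sqrt n%:R * eta n @[n --> \oo] --> l ->
    Num.sqrt n%:R * e1 n @[n --> \oo] --> l * xi / sp.
  move=> hl; apply/cvgrPdist_le => e e0.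
  pose K := `|l| + 1.
  have K0 : 0 < K by rewrite ltr_wpDl.
  have eK : 0 < e / 2 / K by rewrite !divr_gt0.
  have e2 : 0 < e / 2 by rewrite divr_gt0.
  have cl : Num.sqrt n%:R * eta n * xi / sp @[n --> \oo] --> l * xi / sp.
    by apply: cvgM; [apply: cvgM => //; exact: cvg_cst|exact: cvg_cst].
  near=> n.
  have h1 : `|l * xi / sp - Num.sqrt n%:R * eta n * xi / sp| <= e / 2.
    by near: n; move/cvgrPdist_le : cl => /(_ _ e2).
  have h2 : Num.sqrt n%:R * eta n <= K.
    have : `|l - Num.sqrt n%:R * eta n| <= 1.
      by near: n; move/cvgrPdist_le : hl => /(_ _ ltr01).
    by rewrite ler_norml => /andP[? ?]; have := ler_norm l; rewrite /K; lra.
  have h3 : `|e1 n - eta n * xi / sp| <= e / 2 / K * eta n by near: n; exact: small'.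
  have h4 : `|Num.sqrt n%:R * e1 n - Num.sqrt n%:R * eta n * xi / sp| <= e / 2.
    have -> : Num.sqrt n%:R * e1 n - Num.sqrt n%:R * eta n * xi / sp =
      Num.sqrt n%:R * (e1 n - eta n * xi / sp) by ring.
    rewrite normrM ger0_norm//.
    apply: (le_trans (ler_wpM2l _ h3)) => //.
    rewrite mulrCA -[leRHS](divfK (lt0r_neq0 K0)) ler_wpM2l// ltW//.
  have -> : l * xi / sp - Num.sqrt n%:R * e1 n =
    (l * xi / sp - Num.sqrt n%:R * eta n * xi / sp) -
    (Num.sqrt n%:R * e1 n - Num.sqrt n%:R * eta n * xi / sp) by ring.
  by rewrite (le_trans (ler_normB _ _))//; lra.
have ce1 : e1 n @[n --> \oo] --> (0 : R).
  apply/cvgrPdist_le => e e0.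
  have C0 : 0 < 1 + xi / sp by rewrite ltr_pwDl// divr_ge0// ltW.
  have eC : 0 < e / (1 + xi / sp) by rewrite divr_gt0.
  near=> n; rewrite sub0r normrN.
  have h1 : `|e1 n - eta n * xi / sp| <= 1 * eta n by near: n; exact: small'.
  have h2 : eta n <= e / (1 + xi / sp).
    have : `|0 - eta n| <= e / (1 + xi / sp).
      by near: n; move/cvgrPdist_le : eta_cvg => /(_ _ eC).
    by rewrite sub0r normrN ger0_norm.
  rewrite ler_pdivlMr// in h2.
  have h3 : 0 <= eta n * xi / sp by rewrite divr_ge0 ?(ltW sp0)// mulr_ge0// ltW.
  move: h1; rewrite !ler_norml => /andP[h4 h5].
  rewrite mulrDr mulr1 mulrA in h2.
  by apply/andP; split; lra.
have svp : 0 < q.+1%:R^-1 :> R by rewrite invr_gt0.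
have cc : 1 - moment2 X theta0 H n @[n --> \oo] --> (1 - q.+1%:R^-1 : R).
  by have := cvg_c _ _ ce1 cva; rewrite expr0n/= add0r.
have c00 : 0 < 1 - q.+1%:R^-1 :> R.
  by rewrite subr_gt0 invf_lt1// ltr1n.
have far := limits_far_from_uniformity q0 htheta0 HO Ht indepX sameX symX svp c00 cva cc.
have near0 x := @limits_near_uniformity _ _ _ _ _ _ _ _ q0 htheta0 HO Ht indepX sameX symX _ _ svp c00 cva cc
  x erefl erefl.
split=> [[eta1|[_ etaoo]]|h|h].
(* A sequence constantly 1 cannot tend to 0. *)
- have E : eta n @[n --> \oo] --> (1 : R).
    by apply: cvg_near_cst; exact: nearW.
  have /eqP : (1 : R) = 0 by exact: (cvg_unique _ E eta_cvg).
  by rewrite oner_eq0.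
- apply: far.
  (* With an error of at most half the main term, the mean is at least (xi / sp / 2) eta_n, so sqrt
     n e_n1 diverges along with sqrt n eta_n. *)
  have c0 : 0 < xi / sp / 2 by rewrite !divr_gt0.
  apply: (cvgy_mul_ge c0 etaoo); near=> n.
  have h1 : `|e1 n - eta n * xi / sp| <= xi / sp / 2 * eta n by near: n; exact: small'.
  rewrite mulrCA ler_wpM2l//.
  move: h1; rewrite ler_norml => /andP[h1 _]; rewrite -/(e1 n).
  have E : eta n * xi / sp = xi / sp * eta n by ring.
  rewrite E in h1; lra.
- by apply: near0; have := key _ h; rewrite mul1r.
- by apply: near0; have := key _ h; rewrite !mul0r.
Unshelve. all: by end_near. Qed.
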